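(* Consider the initial value problem $$\partial_t\rho-\partial_x\big(\rho\,(1-\partial_x^2)^{-1}\partial_x(\rho^2)\big)=0,\quad x\in\mathbb{R},\ t>0,\qquad \rho(x,0)=\rho_0(x).$$ Suppose $\rho_0\in H^s(\mathbb{R})$, $s\ge1$, is such that, for some $k\in\mathbb{Z}^+$, $$\rho_0\big|_{\Omega}\in C^k(\Omega)\quad\text{for some open }\Omega\subseteq\mathbb{R}.$$ Then the corresponding solution $\rho=\rho(x,t)$, $t\in[0,T]$, of the initial value problem (described in the context) satisfies, for $t\in[0,T]$, $$\rho(\cdot,t)\big|_{\Omega_t}\in C^k(\Omega_t),$$ where $\Omega_t=\Phi_t(\Omega)$ and $\Phi_t(x_0)=X(t;x_0)$ is the map defined by $$\frac{dX}{dt}=v(X(t),t),\qquad X(0)=x_0,$$ with $v=-(1-\partial_x^2)^{-1}\partial_x(\rho^2)$ the velocity field.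
   Context: $(1-\partial_x^2)^{-1}f=\frac12 e^{-|x|}*f$. The equation is the one-dimensional Brinkman model $\partial_t\rho+\partial_x(\rho v)=0$, $(1-\partial_x^2)v=-\partial_x(\rho^2)$ (density $\rho$, velocity $v$). The solution: for $\rho_0\in H^s(\mathbb{R})$, $s\ge1$, there exist $T=c\,\|\rho_0\|_{H^1}^{-2}>0$ (with $c>0$ a constant) and a unique solution $\rho\in C([0,T]:H^s(\mathbb{R}))\cap C^1((0,T):H^{s-1}(\mathbb{R}))$, and the map data-solution is locally continuous from $H^s(\mathbb{R})$ to $C([0,T]:H^s(\mathbb{R}))$. *)

(* Defs.v *)
From mathcomp Require Import all_boot all_order all_algebra.
From mathcomp Require Import all_classical all_reals all_analysis.

Set Implicit Arguments.
Unset Strict Implicit.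
Unset Printing Implicit Defensive.

Import Order.TTheory GRing.Theory Num.Theory.
Import numFieldNormedType.Exports.

Local Open Scope ring_scope.
Local Open Scope classical_set_scope.

(* Elements of Sobolev spaces are represented by measurable functions R -> R,
   regarded up to almost everywhere equality; a time-dependent function rho is
   written rho t x. *)

Definition trunc_fourier_re (R : realType) (f : R -> R) (n : nat) (xi : R) : R :=
  \int[@lebesgue_measure R]_(x in `[- n%:R, n%:R]) (f x * cos (x * xi)).

Definition trunc_fourier_im (R : realType) (f : R -> R) (n : nat) (xi : R) : R :=
  - \int[@lebesgue_measure R]_(x in `[- n%:R, n%:R]) (f x * sin (x * xi)).

(* F = (real part, imaginary part) is the Fourier-Plancherel transform of f:
   the L^2 limit of the integrals of f(x) e^(- i x xi) over [-n, n]. *)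
Definition is_fourier (R : realType) (f : R -> R) (F : (R -> R) * (R -> R)) : Prop :=
  [/\ F.1 \in Lfun (@lebesgue_measure R) 2%:E,
      F.2 \in Lfun (@lebesgue_measure R) 2%:E,
      Lnorm (@lebesgue_measure R) 2%:E
        (EFin \o (trunc_fourier_re f n \- F.1)) @[n --> \oo] --> 0%E
    & Lnorm (@lebesgue_measure R) 2%:E
        (EFin \o (trunc_fourier_im f n \- F.2)) @[n --> \oo] --> 0%E].

(* Meaningful for f in L^2(R), where the transform exists and is unique up to
   almost everywhere equality. *)
Definition fourier (R : realType) (f : R -> R) : (R -> R) * (R -> R) :=
  xget (fun=> 0, fun=> 0) [set F | is_fourier f F].

Definition sobolev_norm (R : realType) (s : R) (f : R -> R) : \bar R :=
  Lnorm (@lebesgue_measure R) 2%:E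
    (EFin \o (fun xi : R => (1 + xi ^+ 2) `^ (s / 2) *
       Num.sqrt ((fourier f).1 xi ^+ 2 + (fourier f).2 xi ^+ 2))).

(* H^s(R) as a subspace of L^2(R): intended for s >= 0 only. *)
Definition sobolev (R : realType) (s : R) : set (R -> R) :=
  [set f | f \in Lfun (@lebesgue_measure R) 2%:E /\ (sobolev_norm s f < +oo)%E].

(* u in C(I : H^s(R)) *)
Definition sobolev_continuous (R : realType) (s : R) (I : set R)
    (u : R -> R -> R) : Prop :=
  (forall t, I t -> sobolev s (u t)) /\
  (forall t0, I t0 ->
     sobolev_norm s (u t \- u t0) @[t --> within I (nbhs t0)] --> 0%E).

(* For I open: u in C^1(I : H^s(R)) with time derivative du. *)
Definition sobolev_C1 (R : realType) (s : R) (I : set R)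
    (u du : R -> R -> R) : Prop :=
  [/\ sobolev_continuous s I u, sobolev_continuous s I du
    & forall t, I t ->
        sobolev_norm s (fun x => h^-1 * (u (t + h) x - u t x) - du t x)
          @[h --> 0^'] --> 0%E].

Definition test_function (R : realType) (phi : R -> R) : Prop :=
  (forall n x, derivable (phi^`(n) : R -> R) x 1) /\
  (exists M : R, forall x, M < `|x| -> phi x = 0).

Definition is_weak_deriv (R : realType) (f g : R -> R) : Prop :=
  [/\ locally_integrable [set: R] f, locally_integrable [set: R] g
    & forall phi : R -> R, test_function phi ->
        \int[@lebesgue_measure R]_x (f x * derive1 phi x) =
        - \int[@lebesgue_measure R]_x (g x * phi x)].

(* Meaningful when f has a locally integrable weak derivative; it is then
   determined up to almost everywhere equality. *)
Definition weak_deriv (R : realType) (f : R -> R) : R -> R :=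
  xget (fun=> 0) [set g | is_weak_deriv f g].

(* (1 - d_x^2)^(-1) f, convolution with e^(- |x|) / 2 *)
Definition inv_helmholtz (R : realType) (f : R -> R) (x : R) : R :=
  2^-1 * \int[@lebesgue_measure R]_y (expR (- `|x - y|) * f y).

Definition velocity (R : realType) (rho : R -> R -> R) (t x : R) : R :=
  - inv_helmholtz (weak_deriv (fun y => rho t y ^+ 2)) x.

(* rho is a solution of the initial value problem in the class
   C([0,T] : H^s(R)) /\ C^1((0,T) : H^(s-1)(R)); the equation
   d_t rho = d_x (rho (1 - d_x^2)^(-1) d_x (rho^2)) holds in H^(s-1)(R) for
   every t in (0,T), the outer d_x being a weak derivative. *)
Definition brinkman_solution (R : realType) (s T : R) (rho0 : R -> R)
    (rho : R -> R -> R) : Prop :=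
  [/\ sobolev_continuous s `[0, T] rho,
      {ae @lebesgue_measure R, forall x, rho 0 x = rho0 x}
    & exists2 drho : R -> R -> R,
        sobolev_C1 (s - 1) `]0, T[ rho drho &
        forall t, t \in `]0, T[ ->
          is_weak_deriv
            (fun x => rho t x * inv_helmholtz (weak_deriv (fun y => rho t y ^+ 2)) x)
            (drho t)].

(* X t x0 is the position at time t of the particle starting at x0:
   dX/dt = v(X, t) and X = x0 at t = 0, on the time interval [0, T]. *)
Definition is_flow (R : realType) (T : R) (v : R -> R -> R)
    (X : R -> R -> R) : Prop :=
  forall x0 : R,
    [/\ X 0 x0 = x0,
        {within `[0, T], continuous (fun t => X t x0)}
      & forall t : R, t \in `]0, T[ ->
          is_derive t (1 : R) (fun r => X r x0) (v t (X t x0))].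

(* For U open: the restriction to U of the class of f (modulo almost everywhere
   equality) belongs to C^k(U). *)
Definition Ck_on (R : realType) (k : nat) (U : set R) (f : R -> R) : Prop :=
  exists g : R -> R,
    [/\ {ae @lebesgue_measure R, forall x, U x -> f x = g x},
        forall (j : nat) (x : R), (j < k)%N -> U x ->
          derivable (g^`(j) : R -> R) x 1
      & forall (j : nat) (x : R), (j <= k)%N -> U x ->
          {for x, continuous (g^`(j) : R -> R)}].

(* Main.v *)
Require Import Defs.
From mathcomp Require Import all_boot all_order all_algebra.
From mathcomp Require Import all_classical all_reals all_analysis.
From mathcomp Require Import measurable_realfun.
From mathcomp Require Import ring lra.

Set Implicit Arguments.
Unset Strict Implicit.
Unset Printing Implicit Defensive.

Import Order.TTheory GRing.Theory Num.Theory.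
Import numFieldNormedType.Exports.

Local Open Scope classical_set_scope.
Local Open Scope ring_scope.

(** Let u be the continuous representative of the density rho, which exists because
    s >= 1, and let P = (1 - d_x^2)^(-1) u^2.  The kernel exp (- |x|) / 2 is smooth
    off the diagonal, so the velocity v = - P_x is a difference of two one-sided
    integrals of u^2, and v_x = u^2 - P: no derivative of u is involved
    ([inv_helmholtz_weak_deriv], [is_derive_lconv], [is_derive_rconv]).

    The weak equation, integrated in time, says that the mass to the left of a
    point changes by the flux through it ([mass_balance]); hence the mass between
    two trajectories is conserved, and u (t, X) J = u0, where J is the derivative of
    the flow with respect to the starting point ([transport]).  The flow is C^1 with
    J = exp (int_0^t v_x (r, X) dr) ([is_derive_cflow]).

    Along trajectories put p = P (t, X) and q = P_x (t, X).  As J' = (u^2 - p) J and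
    u J = u0, the square of J solves a linear equation and
      J = exp (- A) sqrt (1 + 2 u0^2 B),  A = int_0^t p,  B = int_0^t exp (2 A)
    ([jacobianE]).  In the starting point x the derivatives are p_x = q J and
    q_x = p J - u0^2 / J.  So if p and q have n derivatives in x and u0 has at least
    as many, then so does J, and then p and q have n + 1: by induction J is as
    regular as u0 on Omega ([bootstrap]).  Finally u (t, .) is u0 / J composed with the
    inverse of the flow, whose derivative is 1 / J, and is thus C^k on the image of
    Omega, which is open because the flow is continuous and increasing
    ([CK_image], [open_image]).

    The Sobolev space is defined by the Fourier-Plancherel transform as an L^2
    limit, so its existence and the embedding into continuous functions are built
    from Bessel's inequality and Parseval's identity, both obtained by Abel damping
    ([bessel], [parseval], [crep_ae]). *)

Ltac derive_ring := apply: trigger_derive; rewrite /GRing.scale/=; ring.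

(** * Square-integrable functions *)

Section square_integrable.
Context {R : realType}.
Notation mu := (@lebesgue_measure R).
Implicit Types f g h : R -> R.

Lemma ae_sub (P Q : R -> Prop) : (forall x, P x -> Q x) ->
  {ae mu, forall x, P x} -> {ae mu, forall x, Q x}.
Proof. by move=> PQ; apply: (@filterS _ _ (ae_filter_ringOfSetsType mu)). Qed.

Lemma ae_and (P Q : R -> Prop) : {ae mu, forall x, P x} ->
  {ae mu, forall x, Q x} -> {ae mu, forall x, P x /\ Q x}.
Proof. exact: (@filterI _ _ (ae_filter_ringOfSetsType mu)). Qed.

Lemma ae_all (P : R -> Prop) : (forall x, P x) -> {ae mu, forall x, P x}.
Proof. by move=> H; apply: (@filterE _ _ (ae_filter_ringOfSetsType mu)). Qed.

Definition sq f : R := \int[mu]_x (f x ^+ 2).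

Lemma Lnorm2E f : Lnorm mu 2%:E (EFin \o f) = ((\int[mu]_x (f x ^+ 2)%:E) `^ 2^-1)%E.
Proof.
rewrite unlock; congr (_ `^ _)%E; apply: eq_integral => x _ /=.
by rewrite powR_mulrn// real_normK// num_real.
Qed.

Lemma L2P f : f \in Lfun mu 2%:E <->
  measurable_fun setT f /\ mu.-integrable setT (EFin \o (fun x => f x ^+ 2)).
Proof.
split=> [fL|[mf fi]].
  split; last exact: Lfun2_integrable_sqr.
  by move: fL; rewrite inE => /andP[]; rewrite inE.
rewrite inE; apply/andP; split; rewrite inE//= /finite_norm Lnorm2E.
apply: poweR_lty; move/integrableP : fi => [_]; apply: le_lt_trans.
by apply: ge0_le_integral => //= *; rewrite ?lee_fin ?sqr_ge0//;
  [apply/measurable_EFinP; apply: measurable_funX| apply/measurable_EFinP; apply: measurableT_comp => //; apply: measurable_funX | rewrite ger0_norm// sqr_ge0].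
Qed.

Lemma L2_meas f : f \in Lfun mu 2%:E -> measurable_fun setT f.
Proof. by case/L2P. Qed.

Lemma L2_sq f : f \in Lfun mu 2%:E -> (\int[mu]_x (f x ^+ 2)%:E)%E = (sq f)%:E.
Proof.
by case/L2P=> _ fi; rewrite /sq /Rintegral fineK//; apply: integrable_fin_num.
Qed.

Lemma sq_ge0 f : 0 <= sq f.
Proof. by apply: Rintegral_ge0 => x _; rewrite sqr_ge0. Qed.

Lemma L2_Lnorm f : f \in Lfun mu 2%:E ->
  Lnorm mu 2%:E (EFin \o f) = (Num.sqrt (sq f))%:E.
Proof.
by move=> fL; rewrite Lnorm2E L2_sq//= -powR12_sqrt// sq_ge0.
Qed.

Lemma L2_cvg0 (f : nat -> R -> R) : (forall n, f n \in Lfun mu 2%:E) ->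
  sq (f n) @[n --> \oo] --> 0 <->
  Lnorm mu 2%:E (EFin \o f n) @[n --> \oo] --> 0%E.
Proof.
move=> fL; rewrite (_ : (fun n => _) = EFin \o (fun n => Num.sqrt (sq (f n)))); last first.
  by apply/funext => n /=; rewrite L2_Lnorm.
split=> [sf|/fine_cvg sf].
  apply: cvg_EFin; first exact: nearW.
  rewrite -sqrtr0; apply: (continuous_cvg _ _ sf).
  exact: sqrt_continuous.
rewrite (_ : (fun n => sq (f n)) = fun n => Num.sqrt (sq (f n)) * Num.sqrt (sq (f n))); last first.
  by apply/funext => n /=; rewrite -expr2 sqr_sqrtr// sq_ge0.
by rewrite -(mulr0 0); apply: cvgM.
Qed.

Lemma L2_mul f g : f \in Lfun mu 2%:E -> g \in Lfun mu 2%:E ->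
  mu.-integrable setT (EFin \o (fun x => f x * g x)).
Proof. by move=> fL gL; apply/Lfun1_integrable; exact: Lfun2_mul_Lfun1. Qed.

Lemma L2_cs f g : f \in Lfun mu 2%:E -> g \in Lfun mu 2%:E ->
  \int[mu]_x `|f x * g x| <= Num.sqrt (sq f) * Num.sqrt (sq g).
Proof.
move=> fL gL; have fgi := L2_mul fL gL.
have := @hoelder _ _ _ mu f g 2 2 (L2_meas fL) (L2_meas gL) (ltr0n _ 2) (ltr0n _ 2).
rewrite Lnorm1 !L2_Lnorm// -EFinM.
rewrite -lee_fin => H; apply: le_trans (H _); last by rewrite [RHS]splitr !div1r.
rewrite /Rintegral fineK; first by apply: ge0_le_integral => //= *; rewrite ?lee_fin//;
   apply/measurable_EFinP; apply: measurableT_comp => //; apply: measurable_funM; apply: L2_meas.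
by apply: integrable_fin_num => //=; exact: integrable_norm.
Qed.

Lemma L2_cs_int f g : f \in Lfun mu 2%:E -> g \in Lfun mu 2%:E ->
  `|\int[mu]_x (f x * g x)| <= Num.sqrt (sq f) * Num.sqrt (sq g).
Proof.
move=> fL gL; apply: le_trans (L2_cs fL gL).
by apply: le_normr_Rintegral => //; exact: L2_mul.
Qed.

Lemma L2D f g : f \in Lfun mu 2%:E -> g \in Lfun mu 2%:E ->
  (fun x => f x + g x) \in Lfun mu 2%:E.
Proof.
move=> fL gL; have [_ D] := @Lfun_addr_closed _ _ _ mu 2%:E (lee1n 2).
by apply: (D).
Qed.

Lemma L2Z (c : R) f : f \in Lfun mu 2%:E -> (fun x => c * f x) \in Lfun mu 2%:E.
Proof.
move=> fL; rewrite (_ : (fun x => _) = c \o* f).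
  by apply: Lfun_scale fL; rewrite ler1n.
by apply/funext => x /=; rewrite mulrC.
Qed.

Lemma L2N f : f \in Lfun mu 2%:E -> (fun x => - f x) \in Lfun mu 2%:E.
Proof.
move/(L2Z (-1)); rewrite (_ : (fun x => -1 * f x) = fun x => - f x)//.
by apply/funext => x; rewrite mulN1r.
Qed.

Lemma L2B f g : f \in Lfun mu 2%:E -> g \in Lfun mu 2%:E ->
  (fun x => f x - g x) \in Lfun mu 2%:E.
Proof. by move=> fL gL; apply: L2D => //; exact: L2N. Qed.

Lemma L2_le f g : measurable_fun setT f -> g \in Lfun mu 2%:E ->
  (forall x, `|f x| <= `|g x|) -> f \in Lfun mu 2%:E.
Proof.
move=> mf /L2P[mg gi] fg; apply/L2P; split=> //.
apply: le_integrable gi => //.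
  by apply/measurable_EFinP; exact: measurable_funX.
by move=> x _ /=; rewrite lee_fin !normrX lerXn2r// nnegrE.
Qed.

(** Fatou's lemma as lower semicontinuity: bounds of integrals pass to almost
    everywhere limits. *)
Lemma fatou_le (u : nat -> R -> \bar R) (v : R -> \bar R) (c : \bar R) :
  (forall n, measurable_fun setT (u n)) -> measurable_fun setT v ->
  (forall n x, 0%E <= u n x)%E ->
  {ae mu, forall x, u n x @[n --> \oo] --> v x} ->
  (\forall n \near \oo, \int[mu]_x u n x <= c)%E ->
  (\int[mu]_x v x <= c)%E.
Proof.
move=> mu_ mv u0 uv uc.
have -> : (\int[mu]_x v x = \int[mu]_x limn_einf (u ^~ x))%E.
  apply: ae_eq_integral => //.
    rewrite /limn_einf; apply: measurableT_comp => //.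
    apply: (@measurable_fun_limn_esup _ _ _ setT (fun n x => - u n x)%E) => //.
    by move=> n; apply: measurableT_comp.
  apply: ae_sub uv => x uvx _.
  by have [-> _] := cvg_limn_einf_sup uvx.
apply: le_trans (@fatou _ _ _ mu _ measurableT u mu_ _) _; first by move=> n x _.
rewrite limn_einf_lim; apply: lime_le; first exact: is_cvg_einfs.
apply: filterS uc => n; apply: le_trans.
by apply: ereal_inf_lbound; exists n => /=.
Qed.

(** Riesz-Fischer: a subsequence with fast decaying increments converges almost
    everywhere, and Fatou's lemma turns its pointwise limit into an L^2 limit. *)
Lemma L2_complete (f : nat -> R -> R) : (forall n, f n \in Lfun mu 2%:E) ->
  (forall e, 0 < e -> exists N, forall n m, (N <= n)%N -> (N <= m)%N ->
     sq (fun x => f n x - f m x) <= e) ->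
  exists2 g, g \in Lfun mu 2%:E & sq (fun x => f n x - g x) @[n --> \oo] --> 0.
Proof.
move=> fL fC.
have fBL n m : (fun x => f n x - f m x) \in Lfun mu 2%:E by exact: L2B.
have /choice[N0 N0P] : forall k, exists N, forall n m, (N <= n)%N -> (N <= m)%N ->
     sq (fun x => f n x - f m x) <= (4^-1) ^+ k.
  by move=> k; apply: fC; rewrite exprn_gt0.
(* The squares of the increments along N integrate to at most 4 ^- k, so they
   remain summable with the weight 2 ^+ k, and 2 `|a| <= 2 ^- k + 2 ^+ k * a ^+ 2
   then gives the summability of the increments themselves. *)
pose N k := (\sum_(i < k.+1) (N0 i + 1))%N.
have N0N k : (N0 k <= N k)%N by rewrite /N big_ord_recr/= addnCA leq_addr.
have NS k : (N k <= N k.+1)%N by rewrite /N [leqRHS]big_ord_recr/= leq_addr.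
have kN k : (k <= N k)%N.
  elim: k => // k IH; rewrite /N big_ord_recr/= -/(N k) (addnA _ _ 1%N) addn1 ltnS.
  by rewrite (leq_trans IH)// leq_addr.
pose h k x := f (N k.+1) x - f (N k) x.
have hs k : sq (h k) <= 4^-1 ^+ k.
  by apply: N0P; rewrite ?N0N// (leq_trans (N0N k)).
have hL k : h k \in Lfun mu 2%:E by exact: fBL.
have h2 k x : 0 <= 2 ^+ k * h k x ^+ 2.
  by rewrite mulr_ge0 ?sqr_ge0 ?exprn_ge0.
pose H x : \bar R := (\sum_(k <oo) ((2%:R ^+ k * (h k x) ^+ 2)%:E))%E.
have mh k : measurable_fun setT (fun x => (2%:R ^+ k * (h k x) ^+ 2)%:E : \bar R).
  apply/measurable_EFinP; apply: measurable_funM => //.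
  by apply: measurable_funX; exact: L2_meas.
have mH : measurable_fun setT H.
  apply: (@ge0_emeasurable_sum _ _ _ setT (fun k x => (2%:R ^+ k * (h k x) ^+ 2)%:E) predT) => // k x _ _.
  by rewrite lee_fin h2.
have iH : mu.-integrable setT H.
  apply/integrableP; split => //.
  under eq_integral.
    move=> x _; rewrite gee0_abs; last first.
      by rewrite /H; apply: nneseries_ge0 => k _ _; rewrite lee_fin h2.
    over.
  rewrite /H integral_nneseries//; last first.
    by move=> k x _; rewrite lee_fin h2.
  apply: (@le_lt_trans _ _ (\sum_(k <oo) ((2^-1 ^+ k)%:E))%E).
    apply: lee_nneseries => [k _ _|k _].
      by apply: integral_ge0 => x _; rewrite lee_fin h2.
    under eq_integral do rewrite EFinM.
    rewrite ge0_integralZl//; [|by apply/measurable_EFinP; apply: measurable_funX; exact: L2_meas|by move=> x _; rewrite lee_fin sqr_ge0].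
    rewrite L2_sq// -EFinM lee_fin.
    apply: (@le_trans _ _ (2 ^+ k * 4^-1 ^+ k)).
      by rewrite ler_wpM2l// exprn_ge0.
    rewrite -exprMn (_ : 2 * 4^-1 = 2^-1 :> R)//.
    by rewrite -[4]/(2 * 2)%:R natrM invfM mulrA divff// mul1r.
  rewrite (@eq_eseriesr _ _ (fun k => (2 / (2 ^ (k + 1))%:R)%:E)); last first.
    by move=> k _; rewrite addn1 expnS natrM invfM mulrA divff// mul1r natrX exprVn.
  have := cvg_lim (@ereal_hausdorff R) (@cvg_geometric_eseries_half R 2 0).
  by rewrite /eseries/= => ->; rewrite ltry.
have aeH := integrable_ae measurableT iH.
have aecvg : {ae mu, forall x, cvgn (fun k => f (N k) x)}.
  apply: ae_sub aeH => x /(_ I) Hx.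
  have -> : (fun k => f (N k) x) = (fun k => f (N 0%N) x + series (h ^~ x) k).
    apply/funext => k; rewrite seriesEnat/= /h telescope_sumr//.
    by rewrite addrC subrK.
  apply: is_cvgD; first exact: is_cvg_cst.
  apply: normed_cvg => /=.
  apply: (@series_le_cvg _ _ (2^-1 *: ((fun k => 2^-1 ^+ k) + (fun k => 2 ^+ k * h k x ^+ 2)))).
  - by move=> n /=.
  - by move=> n; rewrite /GRing.scale/= mulr_ge0// addr_ge0 ?h2 ?exprn_ge0.
  - move=> n; rewrite /GRing.scale/= fctE /=.
    have p0 : 0 < (2 : R) ^+ n by rewrite exprn_gt0.
    rewrite exprVn -(ler_pM2l p0) mulrCA mulrDr divff ?gt_eqF//.
    rewrite mulrA -expr2 -exprMn -(real_normK (num_real (2 ^+ n * h n x))) normrM (gtr0_norm p0).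
    by set t := _ * _; have := sqr_ge0 (t - 1); lra.
  apply: is_cvg_seriesZ; apply: is_cvg_seriesD.
    by rewrite exprn_geometric; apply: is_cvg_geometric_series; rewrite ger0_norm// invf_lt1// ltr1n.
  apply: nondecreasing_is_cvgn.
    by apply: nondecreasing_series => k _ _; exact: h2.
  exists (fine (H x)) => _ [k _ <-]; rewrite -lee_fin fineK//.
  rewrite seriesEnat/= -sumEFin; apply: nneseries_lim_ge => i _ _.
  by rewrite lee_fin h2.
pose g x := fine (limn_esup (fun k => (f (N k) x)%:E)).
have mg : measurable_fun setT g.
  apply: measurableT_comp => //.
  apply: (@measurable_fun_limn_esup _ _ _ setT (fun k x => (f (N k) x)%:E)) => //.
  by move=> k; apply/measurable_EFinP; exact: L2_meas.
have aeg : {ae mu, forall x, f (N k) x @[k --> \oo] --> g x}.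
  apply: ae_sub aecvg => x /cvg_ex[l fl]; rewrite /g.
  have /cvg_limn_einf_sup[_ ->] // : (f (N k) x)%:E @[k --> \oo] --> l%:E.
  by apply: cvg_EFin => //; exact: nearW.
have key e n : (forall m, (n <= m)%N -> sq (fun x => f n x - f m x) <= e) ->
    (\int[mu]_x (((f n x - g x) ^+ 2)%:E) <= e%:E)%E.
  move=> ne; apply: (@fatou_le (fun k x => ((f n x - f (N k) x) ^+ 2)%:E)).
  - move=> k; apply/measurable_EFinP; apply: measurable_funX.
    by apply: L2_meas.
  - apply/measurable_EFinP; apply: measurable_funX.
    by apply: measurable_funB => //; exact: L2_meas.
  - by move=> k x; rewrite lee_fin sqr_ge0.
  - apply: ae_sub aeg => x fx; apply: cvg_EFin; first exact: nearW.
    by rewrite expr2; apply: cvgM; apply: cvgB => //; exact: cvg_cst.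
  - exists n => // k /= nk; rewrite L2_sq// lee_fin ne//.
    by rewrite (leq_trans nk)//.
have fgL n : (fun x => f n x - g x) \in Lfun mu 2%:E -> g \in Lfun mu 2%:E.
  move=> fg; rewrite (_ : g = fun x => f n x - (f n x - g x)); first exact: L2B.
  by apply/funext => x; rewrite opprB addrC subrK.
have gL : g \in Lfun mu 2%:E.
  apply: (fgL (N0 0%N)); apply/L2P; split.
    by apply: measurable_funB => //; exact: L2_meas.
  apply/integrableP; split.
    apply/measurable_EFinP; apply: measurable_funX.
    by apply: measurable_funB => //; exact: L2_meas.
  under eq_integral do rewrite gee0_abs ?lee_fin ?sqr_ge0//.
  apply: le_lt_trans (key 1 (N0 0%N) _) (ltry _) => m mN.
  by rewrite (N0P 0%N).
exists g => //; apply/cvgrPdist_le => e e0.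
have [M MP] := fC _ e0; exists M => // n /= Mn.
rewrite sub0r normrN ger0_norm ?sq_ge0// -lee_fin -L2_sq; last exact: L2B.
by apply: key => m nm; apply: MP => //; rewrite (leq_trans Mn).
Qed.

End square_integrable.

Notation intg f := ((@lebesgue_measure _).-integrable setT (EFin \o f)).

(** * Integrals over the line *)

Section integrals.
Context {R : realType}.
Notation mu := (@lebesgue_measure R).
Implicit Types f g h k : R -> R.

Lemma intg_meas f : intg f -> measurable_fun setT f.
Proof. by move=> /integrableP[/measurable_EFinP]. Qed.

Lemma intg_le f g : measurable_fun setT f -> intg g ->
  (forall x, `|f x| <= `|g x|) -> intg f.
Proof.
move=> mf gi fg; apply: le_integrable gi => //; first exact/measurable_EFinP.
by move=> x _ /=; rewrite lee_fin.
Qed.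

Lemma intgD f g : intg f -> intg g -> intg (fun x => f x + g x).
Proof.
by move=> fi gi; have := integrableD measurableT fi gi; apply: eq_integrable.
Qed.

Lemma intgN f : intg f -> intg (fun x => - f x).
Proof. by move=> /integrableN; apply: eq_integrable. Qed.

Lemma intgB f g : intg f -> intg g -> intg (fun x => f x - g x).
Proof. by move=> fi gi; apply: intgD => //; exact: intgN. Qed.

Lemma intgZ (c : R) f : intg f -> intg (fun x => c * f x).
Proof. by move=> /(integrableZl measurableT c); apply: eq_integrable. Qed.

Lemma intg_abs f : intg f -> intg (fun x => `|f x|).
Proof. exact: integrable_norm. Qed.

Lemma intg_bM f k (M : R) : intg f -> measurable_fun setT k ->
  (forall x, `|k x| <= M) -> intg (fun x => f x * k x).
Proof.
move=> fi mk kM; apply: intg_le (intgZ M fi) _.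
  by apply: measurable_funM => //; exact: intg_meas.
by move=> x; rewrite !normrM mulrC ler_wpM2r// (le_trans (kM x))// ler_norm.
Qed.

Lemma Rint_le f g : intg f -> intg g -> (forall x, f x <= g x) ->
  \int[mu]_x f x <= \int[mu]_x g x.
Proof. by move=> fi gi fg; apply: le_Rintegral. Qed.

Lemma Rint_norm_le f g : measurable_fun setT f -> intg g ->
  (forall x, `|f x| <= g x) -> `|\int[mu]_x f x| <= \int[mu]_x g x.
Proof.
move=> mf gi fg.
have fi : intg f.
  by apply: intg_le gi _ => // x; rewrite (le_trans (fg x))// ler_norm.
apply: le_trans (le_normr_Rintegral measurableT fi) _.
by apply: Rint_le => //; exact: intg_abs.
Qed.

Lemma EFin_Rint f : intg f -> (\int[mu]_x (f x)%:E)%E = (\int[mu]_x f x)%:E.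
Proof. by move=> fi; rewrite /Rintegral fineK//; exact: integrable_fin_num. Qed.

Lemma intg_ge0 f (c : R) : measurable_fun setT f -> (forall x, 0 <= f x) ->
  (\int[mu]_x (f x)%:E <= c%:E)%E -> intg f /\ \int[mu]_x f x <= c.
Proof.
move=> mf f0 fc; have fi : intg f.
  apply/integrableP; split; first exact/measurable_EFinP.
  under eq_integral do rewrite /= ger0_norm//.
  exact: le_lt_trans fc (ltry _).
by split=> //; rewrite -lee_fin -EFin_Rint.
Qed.

(** All exchanges of integrals below have the form of a bounded kernel against
    two integrable weights. *)
Lemma intg_prod f g (K : R * R -> R) (M : R) : intg f -> intg g ->
  measurable_fun setT K -> (forall z, `|K z| <= M) ->
  (mu \x mu)%E.-integrable setT (fun z => (f z.1 * g z.2 * K z)%:E).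
Proof.
move=> fi gi mK KM.
have mf := intg_meas fi; have mg := intg_meas gi.
have mfgK : measurable_fun setT (fun z : R * R => (f z.1 * g z.2 * K z)%:E).
  apply/measurable_EFinP; apply: measurable_funM => //; apply: measurable_funM.
  - exact: (measurableT_comp mf measurable_fst).
  - exact: (measurableT_comp mg measurable_snd).
apply/integrable12ltyP => //.
have M0 : 0 <= M by exact: le_trans (KM (0, 0)).
have ab h : intg h -> (\int[mu]_x `|h x|%:E = (\int[mu]_x `|h x|)%:E)%E.
  by move=> hi; rewrite EFin_Rint//; exact: intg_abs.
apply: (@le_lt_trans _ _ (\int[mu]_x (`|f x| * (M * \int[mu]_y `|g y|))%:E)%E).
  apply: ge0_le_integral => //.
  - by move=> x _; apply: integral_ge0.
  - have := @measurable_fun_fubini_tonelli_F _ _ _ _ _ mu (fun z : R * R => `|(f z.1 * g z.2 * K z)%:E|%E).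
    by apply => //; apply: measurableT_comp.
  - by apply/measurable_EFinP; apply: measurable_funM => //; apply: measurableT_comp.
  - move=> x _.
    apply: (@le_trans _ _ (\int[mu]_y ((`|f x| * M)%:E * `|g y|%:E))%E).
      apply: ge0_le_integral => //.
      + apply: measurableT_comp => //.
        exact: (measurableT_comp mfgK (measurable_pair1 x)).
      + apply/measurable_EFinP; apply: measurable_funM => //.
        exact: measurableT_comp.
      + move=> y _; rewrite -EFinM /= lee_fin !normrM mulrAC ler_wpM2r//.
        by rewrite ler_wpM2l.
    rewrite ge0_integralZl//; last 2 first.
      by apply/measurable_EFinP; exact: measurableT_comp.
      by rewrite lee_fin mulr_ge0.
    by rewrite ab// -EFinM mulrA.
rewrite EFin_Rint ?ltry//.
apply: (@intg_bM (fun x => `|f x|) (cst (M * \int[mu]_y `|g y|)) (M * \int[mu]_y `|g y|)) => //.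
  exact: intg_abs.
by move=> x /=; rewrite ger0_norm// mulr_ge0// Rintegral_ge0.
Qed.

Lemma Fubini_bounded f g (K : R -> R -> R) (M : R) : intg f -> intg g ->
  measurable_fun setT (fun z : R * R => K z.1 z.2) -> (forall x y, `|K x y| <= M) ->
  \int[mu]_x (f x * \int[mu]_y (g y * K x y)) =
  \int[mu]_y (g y * \int[mu]_x (f x * K x y)).
Proof.
move=> fi gi mK KM; rewrite /Rintegral; congr fine.
have fgi := intg_prod fi gi mK (fun z => KM z.1 z.2).
have mK1 x : measurable_fun setT (fun y => K x y).
  exact: (measurableT_comp mK (measurable_pair1 x)).
have mK2 y : measurable_fun setT (fun x => K x y).
  exact: (measurableT_comp mK (measurable_pair2 y)).
have gK x : intg (fun y => g y * K x y) by exact: intg_bM (KM x).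
have fK y : intg (fun x => f x * K x y) by apply: intg_bM (KM ^~ y).
transitivity (\int[mu]_x \int[mu]_y (f x * g y * K x y)%:E)%E.
  apply: eq_integral => x _; rewrite EFinM -[in LHS]/(Rintegral _ _ _) -EFin_Rint//.
  rewrite -integralZl//; last exact: gK.
  by apply: eq_integral => y _; rewrite -EFinM mulrA.
have := @Fubini _ _ _ _ _ mu mu (fun z : R * R => (f z.1 * g z.2 * K z.1 z.2)%:E) fgi.
rewrite /= => ->.
apply: eq_integral => y _; rewrite EFinM -[in RHS]/(Rintegral _ _ _) -EFin_Rint//.
rewrite -integralZl//; last exact: fK.
by apply: eq_integral => x _ /=; rewrite -EFinM mulrA (mulrC (f x)).
Qed.

Lemma Rint_dct (f_ : nat -> R -> R) f g : (forall n, measurable_fun setT (f_ n)) ->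
  measurable_fun setT f -> {ae mu, forall x, f_ n x @[n --> \oo] --> f x} -> intg g ->
  (forall n x, `|f_ n x| <= g x) ->
  intg f /\ \int[mu]_x f_ n x @[n --> \oo] --> \int[mu]_x f x.
Proof.
move=> mf_ mf f_f gi f_g.
have [|||//||fi _ cv] := @dominated_convergence _ _ _ mu setT measurableT
  (fun n x => (f_ n x)%:E) (EFin \o f) (EFin \o g).
- by move=> n; apply/measurable_EFinP; exact: mf_.
- exact/measurable_EFinP.
- apply: ae_sub f_f => x fx _; apply: cvg_EFin => //; exact: nearW.
- by apply: ae_all => x n _; rewrite /= lee_fin.
by split => //; move: cv => /=; rewrite EFin_Rint// => /fine_cvg.
Qed.

End integrals.

(** * Cosine and sine transforms: Bessel and Parseval *)

Section cosine_transforms.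
Context {R : realType}.
Notation mu := (@lebesgue_measure R).
Implicit Types f g h k : R -> R.

Definition cosT f (xi : R) : R := \int[mu]_x (f x * cos (x * xi)).
Definition sinT f (xi : R) : R := \int[mu]_x (f x * sin (x * xi)).

Lemma sin_max (x : R) : `|sin x| <= 1.
Proof. by rewrite ler_norml sin_geN1 sin_le1. Qed.

Lemma meas_mulr (F : R -> R) : continuous F ->
  measurable_fun setT (fun z : R * R => F (z.1 * z.2)).
Proof.
move=> cF; apply: (@measurableT_comp _ _ _ _ _ _ F).
  exact: continuous_measurable_fun.
exact: measurable_funM.
Qed.

Lemma meas_cos (c : R) : measurable_fun setT (fun x : R => cos (x * c)).
Proof.
apply: (@measurableT_comp _ _ _ _ _ _ cos); last exact: measurable_funM.
by apply: continuous_measurable_fun; exact: continuous_cos.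
Qed.

Lemma meas_sin (c : R) : measurable_fun setT (fun x : R => sin (x * c)).
Proof.
apply: (@measurableT_comp _ _ _ _ _ _ sin); last exact: measurable_funM.
by apply: continuous_measurable_fun; exact: continuous_sin.
Qed.

Lemma intg_cos f xi : intg f -> intg (fun x => f x * cos (x * xi)).
Proof. by move=> fi; apply: (intg_bM fi (meas_cos _) (M := 1)) => x; exact: cos_max. Qed.

Lemma intg_sin f xi : intg f -> intg (fun x => f x * sin (x * xi)).
Proof. by move=> fi; apply: (intg_bM fi (meas_sin _) (M := 1)) => x; exact: sin_max. Qed.

Lemma continuous_bounded_kernel f (K : R -> R -> R) (M : R) : intg f ->
  (forall x, measurable_fun setT (K x)) -> (forall x y, `|K x y| <= M) ->
  (forall y, continuous (K ^~ y)) -> continuous (fun x => \int[mu]_y (f y * K x y)).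
Proof.
move=> fi mK KM cK x0.
have H := @continuity_under_integral R _ _ mu (fun x y => f y * K x y) setT measurableT
  (x0 - 1) (x0 + 1) _ _ (fun y => M * `|f y|) _ _.
apply: H => //.
- by move=> x _; exact: intg_bM (KM x).
- apply: ae_all => y _ x _; apply: continuousM; [exact: cst_continuous|exact: cK].
- by apply: intgZ; exact: intg_abs.
- by move=> x _; apply: ae_all => y _; rewrite normrM mulrC ler_wpM2r.
- by rewrite inE /= in_itv/= ltrDl ltrBlDr ltrDl ltr01.
Qed.

Lemma continuous_cosT f : intg f -> continuous (cosT f).
Proof.
move=> fi; apply: (continuous_bounded_kernel (M := 1) fi) => [x|x y|y x].
- apply: continuous_measurable_fun => y.
  by apply: continuous_comp; [exact: mulrr_continuous|exact: continuous_cos].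
- exact: cos_max.
- by apply: continuous_comp; [exact: mulrl_continuous|exact: continuous_cos].
Qed.

Lemma continuous_sinT f : intg f -> continuous (sinT f).
Proof.
move=> fi; apply: (continuous_bounded_kernel (M := 1) fi) => [x|x y|y x].
- apply: continuous_measurable_fun => y.
  by apply: continuous_comp; [exact: mulrr_continuous|exact: continuous_sin].
- exact: sin_max.
- by apply: continuous_comp; [exact: mulrl_continuous|exact: continuous_sin].
Qed.

Lemma cosT_bound f xi : intg f -> `|cosT f xi| <= \int[mu]_x `|f x|.
Proof.
move=> fi; apply: Rint_norm_le (intg_abs fi) _.
  exact: intg_meas (intg_cos _ fi).
by move=> x; rewrite normrM ler_piMr// cos_max.
Qed.

Lemma sinT_bound f xi : intg f -> `|sinT f xi| <= \int[mu]_x `|f x|.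
Proof.
move=> fi; apply: Rint_norm_le (intg_abs fi) _.
  exact: intg_meas (intg_sin _ fi).
by move=> x; rewrite normrM ler_piMr// sin_max.
Qed.

(** The Abel damping factor and its transform, the Poisson kernel, whose mass
    is 2 pi for every e. *)
Definition abel (e xi : R) : R := expR (- (e * `|xi|)).
Definition poisson (e a : R) : R := 2 * e / (e ^+ 2 + a ^+ 2).

Lemma continuous_abel e : continuous (abel e).
Proof.
move=> x; apply: continuous_comp; last exact: continuous_expR.
apply: continuousN; apply: continuous_comp; last exact: mulrl_continuous.
exact: norm_continuous.
Qed.

Lemma abel_ge0 e x : 0 <= abel e x. Proof. exact: expR_ge0. Qed.

Lemma poisson_ge0 e a : 0 < e -> 0 <= poisson e a.
Proof. by move=> e0; rewrite divr_ge0 ?addr_ge0 ?sqr_ge0// mulr_ge0// ltW. Qed.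

Lemma poissonN e a : poisson e (- a) = poisson e a.
Proof. by rewrite /poisson sqrrN. Qed.

Lemma continuous_poisson e : 0 < e -> continuous (poisson e).
Proof.
move=> e0 x; apply: cvgM; first exact: cvg_cst.
apply: cvgV; first by rewrite gt_eqF// ltr_pwDl// ?exprn_gt0// sqr_ge0.
by apply: cvgD; [exact: cvg_cst|exact: exprn_continuous].
Qed.

Lemma continuous_poissonBl e x : 0 < e -> continuous (fun y => poisson e (x - y)).
Proof.
move=> e0 y; apply: (continuous_comp (f := fun y => x - y)); last exact: continuous_poisson.
by apply: cvgB => //; exact: cvg_cst.
Qed.

Lemma continuous_poissonBr e y : 0 < e -> continuous (fun x => poisson e (x - y)).
Proof.
move=> e0 x; apply: (continuous_comp (f := fun x => x - y)); last exact: continuous_poisson.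
by apply: cvgB => //; exact: cvg_cst.
Qed.

Lemma ge0_integral_affine h (e x : R) : 0 < e -> continuous h -> (forall y, 0 <= h y) ->
  (\int[mu]_y (h y)%:E = \int[mu]_z (h (x + e * z) * e)%:E)%E.
Proof.
move=> e0 ch h0; have dF : derive1 (fun z : R => x + e * z) = cst e.
  by apply/funext => z; rewrite derive1E; apply: derive_val; derive_ring.
rewrite (@increasing_ge0_integration_by_substitutionT _ (fun z => x + e * z)) //=.
- by apply: eq_integral => z _; rewrite dF.
- by move=> y z yz; rewrite ltrD2l ltr_pM2l.
- by rewrite dF; exact: cst_continuous.
- by rewrite dF; exact: is_cvg_cst.
- by rewrite dF; exact: is_cvg_cst.
- apply: (cvg_comp _ (fun z => x + z)); last exact: cvg_addrl_Ny.
  exact: gt0_cvgMrNy.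
- apply: (cvg_comp _ (fun z => x + z)); last exact: cvg_addrl.
  exact: gt0_cvgMry.
Qed.

(** Adding 1 to the cosine makes the integrand nonnegative, so that the improper
    fundamental theorem of calculus applies without prior integrability. *)
Lemma abel_cos_ge0 (e a : R) : 0 < e ->
  (\int[mu]_xi ((1 + cos (a * xi)) * abel e xi)%:E)%E =
  (2 / e + poisson e a)%:E.
Proof.
move=> e0.
have cf : continuous (fun xi => (1 + cos (a * xi)) * abel e xi).
  move=> x; apply: cvgM; last exact: continuous_abel.
  apply: cvgD; first exact: cvg_cst.
  by apply: continuous_comp; [exact: mulrl_continuous|exact: continuous_cos].
have f0 x : 0 <= (1 + cos (a * x)) * abel e x.
  by rewrite mulr_ge0 ?abel_ge0// -lerBlDl sub0r cos_geN1.
rewrite ge0_symfun_integralT//; last by move=> x /=; rewrite mulrN cosN /abel normrN.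
rewrite -set_itvcy.
have d0 : e ^+ 2 + a ^+ 2 != 0.
  by rewrite gt_eqF// ltr_pwDl// ?exprn_gt0// sqr_ge0.
pose F xi := expR (- (e * xi)) *
  ((a * sin (a * xi) - e * cos (a * xi)) / (e ^+ 2 + a ^+ 2) - e^-1).
have dF (x : R) : is_derive x (1 : R) F ((1 + cos (a * x)) * expR (- (e * x))).
  apply: trigger_derive.
  rewrite /GRing.scale/=; field.
  by rewrite d0 gt_eqF.
rewrite (@ge0_continuous_FTC2y _ _ F 0 0).
- rewrite /F !mulr0 oppr0 expR0 sin0 cos0 -EFinB -EFinM; congr EFin.
  by rewrite /poisson; field; rewrite d0 gt_eqF.
- by move=> x _; exact: f0.
- exact: continuous_subspaceT.
- pose C := (`|a| + e) / (e ^+ 2 + a ^+ 2) + e^-1.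
  have cE : expR (- (e * x)) @[x --> +oo] --> 0.
    apply: (cvg_comp (fun x : R => e * x) (fun z => expR (- z))); last exact: cvgr_expR.
    exact: gt0_cvgMry.
  have [cl ch] : (fun x => - (C * expR (- (e * x)))) x @[x --> +oo] --> 0 /\
     (fun x => C * expR (- (e * x))) x @[x --> +oo] --> 0.
    have H : (fun x => C * expR (- (e * x))) x @[x --> +oo] --> 0.
      by rewrite -(mulr0 C); apply: cvgM => //; exact: cvg_cst.
    by split=> //; rewrite -oppr0; exact: cvgN.
  apply: (squeeze_cvgr _ cl ch); apply: nearW => x.
  rewrite -ler_norml normrM (gtr0_norm (expR_gt0 _)) mulrC ler_wpM2r ?expR_ge0//.
  have d1 : 0 < e ^+ 2 + a ^+ 2 by rewrite ltr_pwDl// ?exprn_gt0// sqr_ge0.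
  apply: (le_trans (ler_normB _ _)); rewrite lerD//; last by rewrite ger0_norm// invr_ge0 ltW.
  rewrite normrM normfV (gtr0_norm d1) ler_wpM2r ?invr_ge0 ?(ltW d1)//.
  apply: (le_trans (ler_normB _ _)); rewrite lerD// normrM.
    by rewrite ler_piMr// sin_max.
  by rewrite (gtr0_norm e0) ler_piMr ?cos_max// ltW.
- by move=> x _; case: (dF x).
- by apply: cvg_at_right_filter; apply: differentiable_continuous; apply/derivable1_diffP; case: (dF 0).
- move=> x; rewrite in_itv/= andbT => x0; rewrite derive1E; case: (dF x) => _ ->.
  by rewrite /abel ger0_norm// ltW.
Qed.

Lemma abel_int (e : R) : 0 < e -> intg (abel e) /\ \int[mu]_xi abel e xi = 2 / e.
Proof.
move=> e0; have := abel_cos_ge0 0 e0.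
rewrite (_ : (fun xi => _) = (fun xi => (2 * abel e xi)%:E)); last first.
  by apply/funext => x; rewrite mul0r cos0.
move=> H; have mA : measurable_fun setT (abel e).
  by apply: continuous_measurable_fun; exact: continuous_abel.
have [|||i2 _] := @intg_ge0 _ (fun xi => 2 * abel e xi) (2 / e + poisson e 0).
- exact: measurable_funM.
- by move=> x; rewrite mulr_ge0// abel_ge0.
- by rewrite H.
have i1 : intg (abel e).
  have := intgZ 2^-1 i2; congr (_.-integrable _ _).
  by apply/funext => x /=; rewrite mulrA mulVf// mul1r.
split=> //; move: H; rewrite EFin_Rint// => -[]; rewrite RintegralZl// => H.
have : 2 * \int[mu]_xi abel e xi = 2 * (2 / e).
  rewrite H /poisson; field.
  by rewrite gt_eqF.
exact: mulfI.
Qed.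

Lemma abel_cos (e a : R) : 0 < e ->
  \int[mu]_xi (abel e xi * cos (a * xi)) = poisson e a.
Proof.
move=> e0; have [ia Ia] := abel_int e0.
have ic : intg (fun xi => abel e xi * cos (a * xi)).
  by have := intg_cos a ia; congr (_.-integrable _ _); apply/funext => x /=; rewrite (mulrC a).
have : \int[mu]_xi (abel e xi + abel e xi * cos (a * xi)) = 2 / e + poisson e a.
  apply: EFin_inj; rewrite -EFin_Rint; last exact: intgD.
  rewrite -abel_cos_ge0//; apply: eq_integral => x _; congr EFin.
  by rewrite mulrDl mul1r (mulrC (cos _)).
by rewrite RintegralD// Ia => /addrI.
Qed.

Lemma poisson_int (e x : R) : 0 < e ->
  (\int[mu]_y (poisson e (x - y))%:E)%E = (2 * pi)%:E.
Proof.
move=> e0.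
have d0 (y : R) : 0 < e ^+ 2 + y ^+ 2 by rewrite ltr_pwDl// ?exprn_gt0// sqr_ge0.
have p0 (y : R) : 0 <= poisson e (x - y) by exact: poisson_ge0.
rewrite (ge0_integral_affine x e0 (@continuous_poissonBl e x e0) p0).
have -> : (\int[mu]_z (poisson e (x - (x + e * z)) * e)%:E = \int[mu]_z (2 * (oneDsqr z)^-1)%:E)%E.
  apply: eq_integral => z _; congr EFin; rewrite /poisson /oneDsqr; field.
  by rewrite (gt_eqF (d0 _)) gt_eqF// ltr_pwDl// sqr_ge0.
rewrite ge0_symfun_integralT; last 3 first.
- by move=> z; rewrite mulr_ge0// invr_ge0 addr_ge0// sqr_ge0.
- by move=> z; apply: cvgM; [exact: cvg_cst|exact: continuous_oneDsqrV].
- by move=> z /=; rewrite /oneDsqr sqrrN.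
rewrite -set_itvcy; under eq_integral do rewrite EFinM.
rewrite ge0_integralZl//.
- rewrite integral0y_oneDsqr -!EFinM; congr EFin; field.
- by [].
- apply/measurable_EFinP; apply: measurable_funTS.
  by apply: continuous_measurable_fun; exact: continuous_oneDsqrV.
Qed.

(** The product of two transforms is the transform of a correlation; damping it
    by exp (- e |xi|) makes the Poisson kernel appear. *)
Lemma abel_correlation f h (e : R) : 0 < e -> intg f -> intg h ->
  \int[mu]_xi (abel e xi * (cosT f xi * cosT h xi + sinT f xi * sinT h xi)) =
  \int[mu]_x (f x * \int[mu]_y (h y * poisson e (x - y))).
Proof.
move=> e0 fi hi; have [ai _] := abel_int e0.
pose Q xi x := cos (x * xi) * cosT h xi + sin (x * xi) * sinT h xi.
have QE xi x : Q xi x = \int[mu]_y (h y * cos ((x - y) * xi)).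
  rewrite /Q /cosT /sinT -!RintegralZl//; [|exact: intg_sin|exact: intg_cos].
  rewrite -RintegralD//; last 2 first.
  - exact: intgZ (intg_cos _ hi).
  - exact: intgZ (intg_sin _ hi).
  apply: eq_Rintegral => y _.
  by rewrite mulrBl cosB; ring.
have H0 : 0 <= \int[mu]_x `|h x| by exact: Rintegral_ge0.
have QM xi x : `|Q xi x| <= 2 * \int[mu]_x `|h x|.
  rewrite (le_trans (ler_normD _ _))// mulr_natl mulr2n !normrM lerD//.
    by rewrite (le_trans _ (cosT_bound xi hi))// ler_piMl// cos_max.
  by rewrite (le_trans _ (sinT_bound xi hi))// ler_piMl// sin_max.
have mQ : measurable_fun setT (fun z : R * R => Q z.1 z.2).
  apply: measurable_funD; apply: measurable_funM.
  - under eq_fun do rewrite mulrC.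
    by apply: meas_mulr; exact: continuous_cos.
  - apply: (measurableT_comp _ measurable_fst); apply: continuous_measurable_fun.
    exact: continuous_cosT.
  - under eq_fun do rewrite mulrC.
    by apply: meas_mulr; exact: continuous_sin.
  - apply: (measurableT_comp _ measurable_fst); apply: continuous_measurable_fun.
    exact: continuous_sinT.
transitivity (\int[mu]_xi (abel e xi * \int[mu]_x (f x * Q xi x))).
  apply: eq_Rintegral => xi _; congr (_ * _).
  rewrite /cosT /sinT -!RintegralZr//; [|exact: intg_sin|exact: intg_cos].
  rewrite -RintegralD//; last 2 first.
  - by apply: (intg_bM (M := `|cosT h xi|) (intg_cos _ fi)).
  - by apply: (intg_bM (M := `|sinT h xi|) (intg_sin _ fi)).
  by apply: eq_Rintegral => x _; rewrite /Q /cosT /sinT; ring.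
rewrite (Fubini_bounded ai fi mQ QM); apply: eq_Rintegral => x _; congr (_ * _).
under eq_Rintegral do rewrite QE.
rewrite (@Fubini_bounded _ (abel e) h (fun xi y => cos ((x - y) * xi)) 1)//.
- by apply: eq_Rintegral => y _; rewrite abel_cos.
- apply: (@measurableT_comp _ _ _ _ _ _ cos).
    by apply: continuous_measurable_fun; exact: continuous_cos.
  by apply: measurable_funM => //; apply: measurable_funB.
- by move=> *; exact: cos_max.
Qed.

Lemma poisson_bound (e a : R) : 0 < e -> `|poisson e a| <= 2 / e.
Proof.
move=> e0; rewrite ger0_norm ?poisson_ge0// /poisson.
have d0 : 0 < e ^+ 2 + a ^+ 2 by rewrite ltr_pwDl// ?exprn_gt0// sqr_ge0.
rewrite ler_pdivrMr// (_ : 2 / e * _ = 2 * e + 2 / e * a ^+ 2); last first.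
  by field; rewrite gt_eqF.
by rewrite lerDl mulr_ge0 ?sqr_ge0// divr_ge0// ltW.
Qed.

Lemma meas_poisson (e : R) : 0 < e ->
  measurable_fun setT (fun z : R * R => poisson e (z.1 - z.2)).
Proof.
move=> e0; apply: (@measurableT_comp _ _ _ _ _ _ (poisson e)).
  apply: continuous_measurable_fun => a; apply: cvgM; first exact: cvg_cst.
  apply: cvgV; first by rewrite gt_eqF// ltr_pwDl// ?exprn_gt0// sqr_ge0.
  by apply: cvgD; [exact: cvg_cst|exact: exprn_continuous].
exact: measurable_funB.
Qed.

Lemma intg_poisson (e x : R) : 0 < e ->
  intg (fun y => poisson e (x - y)) /\ \int[mu]_y poisson e (x - y) = 2 * pi.
Proof.
move=> e0; have mp : measurable_fun setT (fun y : R => poisson e (x - y)).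
  exact: (measurableT_comp (meas_poisson e0) (measurable_pair1 x)).
have [|||ip _] := @intg_ge0 _ (fun y => poisson e (x - y)) (2 * pi) => //.
- by move=> y; exact: poisson_ge0.
- by rewrite poisson_int.
by split=> //; apply: EFin_inj; rewrite -EFin_Rint// poisson_int.
Qed.

(** Convolution with the Poisson kernel multiplies masses by 2 pi (Tonelli). *)
Lemma poisson_smooth_mass g (e : R) : 0 < e -> intg g -> (forall x, 0 <= g x) ->
  intg (fun x => \int[mu]_y (g y * poisson e (x - y))) /\
  \int[mu]_x \int[mu]_y (g y * poisson e (x - y)) <= 2 * pi * \int[mu]_x g x.
Proof.
move=> e0 gi g0; have mp := meas_poisson e0.
have mgp : measurable_fun setT (fun z : R * R => (g z.2 * poisson e (z.1 - z.2))%:E : \bar R).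
  apply/measurable_EFinP; apply: measurable_funM => //.
  exact: (measurableT_comp (intg_meas gi) measurable_snd).
have gp0 x y : 0 <= g y * poisson e (x - y) by rewrite mulr_ge0// poisson_ge0.
have ig x : intg (fun y => g y * poisson e (x - y)).
  apply: (intg_bM (M := 2 / e) gi) => [|y]; last exact: poisson_bound.
  exact: (measurableT_comp mp (measurable_pair1 x)).
have IE : (\int[mu]_x (\int[mu]_y (g y * poisson e (x - y)))%:E =
   (2 * pi * \int[mu]_x g x)%:E)%E.
  transitivity (\int[mu]_x \int[mu]_y (g y * poisson e (x - y))%:E)%E.
    by apply: eq_integral => x _; rewrite EFin_Rint.
  have := @fubini_tonelli _ _ _ _ _ mu mu (fun z : R * R => (g z.2 * poisson e (z.1 - z.2))%:E) mgp.
  rewrite /= => -> //; last by move=> z; rewrite lee_fin.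
  rewrite mulrC EFinM -EFin_Rint// -ge0_integralZr//; last 3 first.
  - by apply/measurable_EFinP; exact: intg_meas.
  - by move=> x _; rewrite lee_fin.
  - by rewrite lee_fin mulr_ge0// pi_ge0.
  apply: eq_integral => y _; under eq_integral do rewrite EFinM.
  rewrite ge0_integralZl//.
  - congr (_ * _)%E; rewrite -(poisson_int y e0); apply: eq_integral => x _.
    by rewrite -poissonN opprB.
  - apply/measurable_EFinP.
    exact: (measurableT_comp mp (measurable_pair2 y)).
  - by move=> x _; rewrite lee_fin poisson_ge0.
  - by rewrite lee_fin.
apply: intg_ge0.
- apply/measurable_EFinP; rewrite (_ : EFin \o _ = (fun x => \int[mu]_y (g y * poisson e (x - y))%:E)%E); last first.
    by apply/funext => x /=; rewrite EFin_Rint.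
  have := @measurable_fun_fubini_tonelli_F _ _ _ _ _ mu (fun z : R * R => (g z.2 * poisson e (z.1 - z.2))%:E).
  by apply => // z; rewrite lee_fin.
- by move=> x; apply: Rintegral_ge0.
- by rewrite IE.
Qed.

(** 2 |h x * h y| <= h x ^+ 2 + h y ^+ 2, and the Poisson kernel has mass 2 pi in
    each variable. *)
Lemma correlation_bound h (e : R) : 0 < e -> intg h -> h \in Lfun mu 2%:E ->
  `|\int[mu]_x (h x * \int[mu]_y (h y * poisson e (x - y)))| <= 2 * pi * sq h.
Proof.
move=> e0 hi hL; have mp := meas_poisson e0.
have [_ h2] := (L2P h).1 hL.
have [Ji Jle] := poisson_smooth_mass e0 h2 (fun x => sqr_ge0 (h x)).
set J := (fun x => _) in Ji Jle.
have mp1 (x : R) : measurable_fun setT (fun y : R => poisson e (x - y)).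
  exact: (measurableT_comp mp (measurable_pair1 x)).
have ih x : intg (fun y => h y * poisson e (x - y)).
  by apply: (intg_bM (M := 2 / e) hi) => // y; exact: poisson_bound.
have i2 : intg (fun x => pi * h x ^+ 2 + 2^-1 * J x).
  by apply: intgD; [exact: intgZ|exact: intgZ].
apply: le_trans (Rint_norm_le _ i2 _) _.
- apply: measurable_funM; first exact: intg_meas.
  apply: continuous_measurable_fun.
  apply: (continuous_bounded_kernel (K := fun x y => poisson e (x - y)) (M := 2 / e) hi) => //.
  + by move=> x y; exact: poisson_bound.
  + by move=> y; exact: continuous_poissonBr.
- move=> x; rewrite -RintegralZl//.
  have [ip Ip] := intg_poisson x e0.
  rewrite (_ : pi * _ + _ = \int[mu]_y (2^-1 * h x ^+ 2 * poisson e (x - y) +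
     2^-1 * (h y ^+ 2 * poisson e (x - y)))); last first.
    rewrite RintegralD//; first last.
    + apply: intgZ; apply: (intg_bM (M := 2 / e) h2) => // y; exact: poisson_bound.
    + exact: intgZ.
    rewrite RintegralZl// Ip RintegralZl//; last first.
      apply: (intg_bM (M := 2 / e) h2) => // y; exact: poisson_bound.
    by congr (_ + _); field.
  apply: Rint_norm_le.
  + by apply: measurable_funM => //; exact: intg_meas.
  + apply: intgD; first exact: intgZ.
    apply: intgZ; apply: (intg_bM (M := 2 / e) h2) => // y; exact: poisson_bound.
  + move=> y; rewrite 2!normrM (ger0_norm (poisson_ge0 _ e0)).
    have := poisson_ge0 (x - y) e0; move: (poisson e _) => p p0.
    rewrite !mulrA -mulrDl ler_wpM2r//.
    have a2 (a : R) : a * a = `|a| * `|a| by rewrite -!expr2 real_normK// num_real.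
    rewrite -[2^-1 * h x * _]mulrA -[2^-1 * h y * _]mulrA (a2 (h x)) (a2 (h y)).
    by have := sqr_ge0 (`|h x| - `|h y|); nra.
- rewrite RintegralD//; first last.
  + exact: intgZ.
  + exact: intgZ.
  rewrite !RintegralZl// -/(sq h); move: Jle; rewrite -/(sq h).
  by nra.
Qed.

(** By [abel_correlation] and [correlation_bound] the damped integrals of the
    squares are at most 2 pi * sq h; Fatou's lemma removes the damping. *)
Lemma bessel h : intg h -> h \in Lfun mu 2%:E ->
  [/\ cosT h \in Lfun mu 2%:E, sinT h \in Lfun mu 2%:E,
      sq (cosT h) <= 2 * pi * sq h & sq (sinT h) <= 2 * pi * sq h].
Proof.
move=> hi hL.
have mC : measurable_fun setT (cosT h).
  by apply: continuous_measurable_fun; exact: continuous_cosT.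
have mS : measurable_fun setT (sinT h).
  by apply: continuous_measurable_fun; exact: continuous_sinT.
pose w xi := cosT h xi * cosT h xi + sinT h xi * sinT h xi.
have mw : measurable_fun setT w by apply: measurable_funD; exact: measurable_funM.
have w0 xi : 0 <= w xi by rewrite addr_ge0// -expr2 sqr_ge0.
have wle : (\int[mu]_xi (w xi)%:E <= (2 * pi * sq h)%:E)%E.
  apply: (@fatou_le _ (fun n xi => (abel n.+1%:R^-1 xi * w xi)%:E)).
  - move=> n; apply/measurable_EFinP; apply: measurable_funM => //.
    by apply: continuous_measurable_fun; exact: continuous_abel.
  - exact/measurable_EFinP.
  - by move=> n xi; rewrite lee_fin mulr_ge0// abel_ge0.
  - apply: ae_all => xi; apply: cvg_EFin; first exact: nearW.
    rewrite -[X in _ --> X]mul1r; apply: cvgM; last exact: cvg_cst.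
    have H : expR (- (n.+1%:R^-1 * `|xi|)) @[n --> \oo] --> expR (- (0 * `|xi|)).
      apply: continuous_cvg; first exact: continuous_expR.
      by apply: cvgN; apply: cvgM; [exact: cvg_harmonic|exact: cvg_cst].
    by move: H; rewrite mul0r oppr0 expR0.
  - apply: nearW => n; have n0 : 0 < (n.+1%:R^-1 : R) by rewrite invr_gt0.
    have [ia _] := abel_int n0.
    have iw : intg (fun xi => abel n.+1%:R^-1 xi * w xi).
      apply: (intg_bM (M := 2 * (\int[mu]_x `|h x|) ^+ 2) ia) => // xi.
      rewrite ger0_norm// /w -!expr2 mulr2n mulrDl mul1r.
      by rewrite lerD// -[leLHS]real_normK ?num_real// lerXn2r ?nnegrE ?cosT_bound ?sinT_bound// Rintegral_ge0.
    rewrite EFin_Rint// lee_fin abel_correlation//.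
    by apply: le_trans (ler_norm _) _; exact: correlation_bound.
have key (F : R -> R) : measurable_fun setT F -> (forall xi, F xi ^+ 2 <= w xi) ->
    F \in Lfun mu 2%:E /\ sq F <= 2 * pi * sq h.
  move=> mF Fw; have [|||iF Fle] := @intg_ge0 _ (fun xi => F xi ^+ 2) (2 * pi * sq h) _ _ _.
  - exact: measurable_funX.
  - by move=> x; rewrite sqr_ge0.
  - apply: le_trans wle; apply: ge0_le_integral => //.
    + by move=> x _; rewrite lee_fin sqr_ge0.
    + by apply/measurable_EFinP; exact: measurable_funX.
    + exact/measurable_EFinP.
    + by move=> xi _; rewrite lee_fin.
  - by split=> //; apply/L2P; split.
have [cL cle] := key _ mC (fun xi => ltac:(by rewrite expr2 lerDl -expr2 sqr_ge0)).
have [sL sle] := key _ mS (fun xi => ltac:(by rewrite expr2 lerDr -expr2 sqr_ge0)).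
by split.
Qed.

(** The kernel is an approximation of the identity: substitute y = x + e z and
    use dominated convergence against the fixed profile poisson 1. *)
Lemma poisson_approx (phi : R -> R) (M x : R) : continuous phi -> (forall y, `|phi y| <= M) ->
  \int[mu]_y (phi y * poisson n.+1%:R^-1 (x - y)) @[n --> \oo] --> 2 * pi * phi x.
Proof.
move=> cphi phiM.
have mphi : measurable_fun setT phi by exact: continuous_measurable_fun.
pose e n : R := n.+1%:R^-1.
have e0 n : 0 < e n by rewrite invr_gt0.
have M0 : 0 <= M by exact: le_trans (phiM 0).
have ip n := intg_poisson x (e0 n).
have ipp n : intg (fun y => phi y * poisson (e n) (x - y)).
  have := intg_bM (ip n).1 mphi phiM.
  by congr (_.-integrable _ _); apply/funext => y /=; rewrite mulrC.
pose d n z := `|phi (x + e n * z) - phi x| * poisson 1 z.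
have cdd n : continuous (fun z => phi (x + e n * z)).
  move=> z; apply: (continuous_comp (f := fun z => x + e n * z)); last exact: cphi.
  by apply: cvgD; [exact: cvg_cst|exact: mulrl_continuous].
have cd n : continuous (d n).
  move=> z; apply: cvgM; last exact: continuous_poisson.
  apply: (continuous_comp (f := fun z => phi (x + e n * z) - phi x)); last exact: norm_continuous.
  by apply: cvgB; [exact: cdd|exact: cvg_cst].
have i1 : intg (poisson 1).
  have [+ _] := intg_poisson 0 ltr01; congr (_.-integrable _ _).
  by apply/funext => z /=; rewrite sub0r poissonN.
have dg n z : `|d n z| <= 2 * M * poisson 1 z.
  rewrite /d normrM normr_id (ger0_norm (poisson_ge0 z ltr01)) ler_wpM2r ?poisson_ge0//.
  by rewrite (le_trans (ler_normB _ _))// mulrDl mul1r lerD.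
have [|_] := @Rint_dct R d (fun _ => 0) (fun z => 2 * M * poisson 1 z)
  (fun n => continuous_measurable_fun (@cd n)) (measurable_cst _) _ (intgZ _ i1) dg.
  apply: ae_all => z; rewrite -(mul0r (poisson 1 z)); apply: cvgM; last exact: cvg_cst.
  rewrite -(normr0 R) -(subrr (phi x)); apply: cvg_norm; apply: cvgB; last exact: cvg_cst.
  apply: continuous_cvg; first exact: cphi.
  rewrite -[X in _ --> X]addr0 -(mul0r z); apply: cvgD; first exact: cvg_cst.
  by apply: cvgM; [exact: cvg_harmonic|exact: cvg_cst].
have -> : \int[mu]_(_ in setT) (0 : R) = 0 by rewrite /Rintegral integral0.
move=> dcv.
apply/subr_cvg0; apply: norm_cvg0.
apply: (@squeeze_cvgr _ _ _ _ (cst 0) _ _ _ _ _ dcv); last exact: cvg_cst.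
apply: nearW => n; rewrite normr_ge0/=.
rewrite -(ip n).2 mulrC -RintegralZl//; last exact: (ip n).1.
rewrite -RintegralB//; [|exact: ipp|exact: intgZ (ip n).1].
apply: (@le_trans _ _ (\int[mu]_y (`|phi y - phi x| * poisson (e n) (x - y)))).
  apply: Rint_norm_le.
  - by apply: measurable_funB; apply: intg_meas; [exact: ipp|exact: intgZ (ip n).1].
  - have := @intg_bM R _ (fun y => `|phi y - phi x|) (2 * M) (ip n).1 _ _.
    move=> /(_ _ _)H; apply: eq_integrable (H _ _) => //.
    + by move=> y _ /=; rewrite mulrC.
    + by apply: measurableT_comp => //; exact: measurable_funB.
    + by move=> y; rewrite normr_id (le_trans (ler_normB _ _))// mulrDl mul1r lerD.
  - by move=> y; rewrite -mulrBl normrM (ger0_norm (poisson_ge0 _ (e0 n))).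
rewrite le_eqVlt; apply/orP; left; apply/eqP; rewrite /Rintegral; congr fine.
rewrite (@ge0_integral_affine _ (e n) x).
- apply: eq_integral => z _; congr EFin; rewrite /d -mulrA; congr (_ * _).
  have z0 : 1 + z ^+ 2 != 0 by rewrite gt_eqF// ltr_pwDl// sqr_ge0.
  rewrite opprD addNKr poissonN /poisson expr1n exprMn -[X in _ / (X + _)]mulr1 -mulrDr /=.
  by field; rewrite z0 gt_eqF.
- exact: e0.
- move=> y; apply: cvgM; last exact: continuous_poissonBl.
  apply: (continuous_comp (f := fun z => phi z - phi x)); last exact: norm_continuous.
  by apply: cvgB; [exact: cphi|exact: cvg_cst].
- by move=> y; rewrite mulr_ge0// poisson_ge0.
Qed.

(** Parseval's identity against a bounded continuous weight: let the damping
    tend to 0 in [abel_correlation]. *)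
Lemma parseval f (phi : R -> R) (M : R) : intg f -> f \in Lfun mu 2%:E ->
  intg phi -> phi \in Lfun mu 2%:E -> continuous phi -> (forall y, `|phi y| <= M) ->
  \int[mu]_xi (cosT f xi * cosT phi xi + sinT f xi * sinT phi xi) =
  2 * pi * \int[mu]_x (f x * phi x).
Proof.
move=> fi fL phii phiL cphi phiM.
have [cf sf _ _] := bessel fi fL; have [cp sp _ _] := bessel phii phiL.
pose w xi := cosT f xi * cosT phi xi + sinT f xi * sinT phi xi.
have wi : intg w by apply: intgD; exact: L2_mul.
have M0 : 0 <= M by exact: le_trans (phiM 0).
pose e n : R := n.+1%:R^-1.
have e0 n : 0 < e n by rewrite invr_gt0.
have mA n : measurable_fun setT (abel (e n)).
  by apply: continuous_measurable_fun; exact: continuous_abel.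
have [|||_ A] := @Rint_dct R (fun n xi => abel (e n) xi * w xi) w (fun xi => `|w xi|) _ (intg_meas wi) _ (intg_abs wi).
- by move=> n; apply: measurable_funM => //; exact: intg_meas.
- apply: ae_all => xi; rewrite -[X in _ --> X]mul1r; apply: cvgM; last exact: cvg_cst.
  have H : expR (- (n.+1%:R^-1 * `|xi|)) @[n --> \oo] --> expR (- (0 * `|xi|)).
    apply: continuous_cvg; first exact: continuous_expR.
    by apply: cvgN; apply: cvgM; [exact: cvg_harmonic|exact: cvg_cst].
  by move: H; rewrite mul0r oppr0 expR0.
- move=> n xi; rewrite normrM ler_piMl// ger0_norm ?abel_ge0//.
  by rewrite /abel -expR0 ler_expR lerNl oppr0 mulr_ge0// ltW.
pose I n x := \int[mu]_y (phi y * poisson (e n) (x - y)).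
have mI n : measurable_fun setT (I n).
  apply: continuous_measurable_fun.
  apply: (continuous_bounded_kernel (K := fun x y => poisson (e n) (x - y)) (M := 2 / e n) phii) => //.
  + by move=> x; exact: intg_meas (intg_poisson x (e0 n)).1.
  + by move=> x y; exact: poisson_bound.
  + by move=> y; exact: continuous_poissonBr.
have [||||_ B] := @Rint_dct R (fun n x => f x * I n x) (fun x => f x * (2 * pi * phi x)) (fun x => 2 * pi * M * `|f x|) _ _ _ (intgZ _ (intg_abs fi)).
- by move=> n; apply: measurable_funM => //; exact: intg_meas.
- apply: measurable_funM; first exact: intg_meas.
  by apply: measurable_funM => //; exact: continuous_measurable_fun.
- apply: ae_all => x; apply: cvgM; first exact: cvg_cst.
  exact: poisson_approx phiM.
- move=> n x; rewrite normrM mulrC ler_wpM2r//.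
  have [ip Ip] := intg_poisson x (e0 n).
  rewrite -Ip mulrC -RintegralZl//; apply: Rint_norm_le.
  + by apply: measurable_funM; [exact: continuous_measurable_fun|exact: intg_meas].
  + exact: intgZ.
  + by move=> y; rewrite normrM (ger0_norm (poisson_ge0 _ (e0 n))) ler_wpM2r// poisson_ge0.
have AB : (fun n => \int[mu]_xi (abel (e n) xi * w xi)) = (fun n => \int[mu]_x (f x * I n x)).
  by apply/funext => n; exact: abel_correlation.
rewrite AB in A; have := cvg_unique (@Rhausdorff R) A B.
move=> ->; rewrite -RintegralZl//; last exact: (intg_bM (M := M) fi (continuous_measurable_fun cphi) phiM).
by apply: eq_Rintegral => x _; ring.
Qed.

End cosine_transforms.

(** * The Fourier-Plancherel transform and its inversion *)

Section fourier_plancherel.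
Context {R : realType}.
Notation mu := (@lebesgue_measure R).
Implicit Types f g h k : R -> R.

Definition trunc (n : nat) f x : R := f x * \1_(`[- n%:R, n%:R] : set R) x.

Lemma ind01 (A : set R) x : 0 <= (\1_A x : R) <= 1.
Proof. by rewrite indicE; case: (_ \in _); rewrite /= ?lexx ?ler01. Qed.

Lemma meas_ind (n : nat) : measurable_fun setT (\1_(`[- n%:R, n%:R]) : R -> R).
Proof. exact: measurable_indic. Qed.

Lemma trunc_le n f x : `|trunc n f x| <= `|f x|.
Proof.
rewrite normrM ler_piMr// ger0_norm; by case/andP: (ind01 `[- n%:R, n%:R] x).
Qed.

Lemma trunc_id (n : nat) f x : `|x| <= n%:R -> trunc n f x = f x.
Proof.
by move=> xn; rewrite /trunc indicE mem_set ?mulr1//= in_itv/= -ler_norml.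
Qed.

Lemma trunc_cvg f x : trunc n f x @[n --> \oo] --> f x.
Proof.
apply: cvg_near_cst; exists (Num.trunc `|x|).+1 => // n /= xn.
apply/trunc_id/ltW/(lt_le_trans (truncnS_gt _)).
by rewrite ler_nat.
Qed.

Lemma meas_trunc n f : measurable_fun setT f -> measurable_fun setT (trunc n f).
Proof. by move=> mf; apply: measurable_funM => //; exact: meas_ind. Qed.

Lemma trunc_L2 n f : f \in Lfun mu 2%:E -> trunc n f \in Lfun mu 2%:E.
Proof.
move=> fL; apply: (L2_le _ fL); first by apply: meas_trunc; exact: L2_meas.
exact: trunc_le.
Qed.

Lemma ind_L2 (n : nat) : (\1_(`[- n%:R, n%:R]) : R -> R) \in Lfun mu 2%:E.
Proof.
apply/L2P; split; first exact: meas_ind.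
rewrite (_ : EFin \o _ = EFin \o \1_(`[- n%:R, n%:R])).
  exact: integrable_indic_itv.
by apply/funext => x /=; rewrite indicE; case: (_ \in _); rewrite /= ?expr1n ?expr0n.
Qed.

Lemma trunc_intg n f : f \in Lfun mu 2%:E -> intg (trunc n f).
Proof. by move=> fL; apply: L2_mul => //; exact: ind_L2. Qed.

Lemma trunc_reE f n : trunc_fourier_re f n = cosT (trunc n f).
Proof.
apply/funext => xi; rewrite /trunc_fourier_re /cosT Rintegral_mkcond.
by apply: eq_Rintegral => x _; rewrite patch_indic /trunc mulrAC.
Qed.

Lemma trunc_imE f n : trunc_fourier_im f n = fun xi => - sinT (trunc n f) xi.
Proof.
apply/funext => xi; rewrite /trunc_fourier_im /sinT Rintegral_mkcond; congr (- _).
by apply: eq_Rintegral => x _; rewrite patch_indic /trunc mulrAC.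
Qed.

Lemma sq_trunc_cvg f : f \in Lfun mu 2%:E ->
  sq (fun x => trunc n f x - f x) @[n --> \oo] --> 0.
Proof.
move=> fL; have [mf f2] := (L2P f).1 fL.
have [|||||_] := @Rint_dct R (fun n x => (trunc n f x - f x) ^+ 2) (fun _ => 0) (fun x => 4 * f x ^+ 2).
- by move=> n; apply: measurable_funX; apply: measurable_funB => //; exact: meas_trunc.
- exact: measurable_cst.
- apply: ae_all => x; rewrite [X in _ --> X](_ : 0 = (f x - f x) * (f x - f x)); last by rewrite subrr mul0r.
  by under eq_fun do rewrite expr2; apply: cvgM; apply: cvgB; (exact: trunc_cvg || exact: cvg_cst).
- exact: intgZ.
- move=> n x; rewrite ger0_norm ?sqr_ge0// (_ : 4 = 2 ^+ 2) -?exprMn; last by rewrite -natrX.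
  rewrite -real_normK ?num_real// -[leRHS]real_normK ?num_real//.
  rewrite lerXn2r ?nnegrE// normrM (ger0_norm (ler0n _ 2)).
  by rewrite (le_trans (ler_normB _ _))// mulrDl mul1r lerD// trunc_le.
by rewrite /Rintegral integral0.
Qed.

Lemma sqB_le f g : f \in Lfun mu 2%:E -> g \in Lfun mu 2%:E ->
  sq (fun x => f x - g x) <= 2 * sq f + 2 * sq g.
Proof.
move=> fL gL; have [_ f2] := (L2P f).1 fL; have [_ g2] := (L2P g).1 gL.
have [_ fg2] := (L2P _).1 (L2B fL gL).
rewrite -!RintegralZl// -RintegralD//; [|exact: intgZ|exact: intgZ].
apply: Rint_le => //; first by apply: intgD; exact: intgZ.
by move=> x; have := sqr_ge0 (f x + g x); nra.
Qed.

Lemma L2_cvg_pair (f_ : nat -> R -> R) f h : (forall n, f_ n \in Lfun mu 2%:E) ->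
  f \in Lfun mu 2%:E -> h \in Lfun mu 2%:E ->
  sq (fun x => f_ n x - f x) @[n --> \oo] --> 0 ->
  \int[mu]_x (f_ n x * h x) @[n --> \oo] --> \int[mu]_x (f x * h x).
Proof.
move=> f_L fL hL cv; apply/subr_cvg0; apply: norm_cvg0.
apply: (@squeeze_cvgr _ _ _ _ (cst 0) (fun n => Num.sqrt (sq (fun x => f_ n x - f x)) * Num.sqrt (sq h))).
- apply: nearW => n; rewrite normr_ge0 -RintegralB//; [|exact: L2_mul|exact: L2_mul].
  under eq_Rintegral do rewrite -mulrBl.
  by apply: L2_cs_int => //; exact: L2B.
- exact: cvg_cst.
- rewrite -(mul0r (Num.sqrt (sq h))); apply: cvgM; last exact: cvg_cst.
  by rewrite -sqrtr0; apply: continuous_cvg => //; exact: sqrt_continuous.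
Qed.

(** The transforms of the truncations form a Cauchy sequence by Bessel. *)
Lemma fourier_exists f : f \in Lfun mu 2%:E -> exists F, is_fourier f F.
Proof.
move=> fL.
have bes n := bessel (trunc_intg n fL) (trunc_L2 n fL).
have lin (t : (R -> R) -> R -> R) : (forall h k, intg h -> intg k -> t (fun x => h x - k x) = fun xi => t h xi - t k xi) ->
   (forall h, intg h -> h \in Lfun mu 2%:E -> t h \in Lfun mu 2%:E /\ sq (t h) <= 2 * pi * sq h) ->
   exists2 F, F \in Lfun mu 2%:E & sq (fun xi => t (trunc n f) xi - F xi) @[n --> \oo] --> 0.
  move=> tB tL; apply: L2_complete.
    by move=> n; case: (tL _ (trunc_intg n fL) (trunc_L2 n fL)).
  move=> e e0.
  pose d := e / (8 * pi).
  have d0 : 0 < d by rewrite divr_gt0// mulr_gt0// pi_gt0.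
  have /cvgrPdist_le/(_ _ d0)[N _ NP] := sq_trunc_cvg fL.
  exists N => n m Nn Nm.
  have := NP _ Nn; have := NP _ Nm; rewrite /= !sub0r !normrN !(ger0_norm (sq_ge0 _)) => sm sn.
  rewrite -tB; [|exact: trunc_intg|exact: trunc_intg].
  apply: le_trans (tL _ _ _).2 _.
  - by apply: intgB; exact: trunc_intg.
  - by apply: L2B; exact: trunc_L2.
  have -> : (fun x => trunc n f x - trunc m f x) = (fun x => (trunc n f x - f x) - (trunc m f x - f x)).
    by apply/funext => x; ring.
  have := sqB_le (L2B (trunc_L2 n fL) fL) (L2B (trunc_L2 m fL) fL).
  have p0 := @pi_gt0 R.
  have aux (a p : R) : p != 0 -> a = 2 * p * (2 * (a / (8 * p)) + 2 * (a / (8 * p))).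
    by move=> p1; field.
  move=> H; rewrite [leRHS](aux e pi) ?gt_eqF// -/d ler_pM2l ?mulr_gt0//; apply: le_trans H _.
  by rewrite lerD// ler_pM2l.
have [F1 F1L c1] : exists2 F, F \in Lfun mu 2%:E & sq (fun xi => cosT (trunc n f) xi - F xi) @[n --> \oo] --> 0.
  apply: lin => [h k hi ki|h hi hL]; last by case: (bessel hi hL).
  apply/funext => xi; rewrite /cosT -RintegralB//; [|exact: intg_cos|exact: intg_cos].
  by apply: eq_Rintegral => x _; rewrite mulrBl.
have [F2 F2L c2] : exists2 F, F \in Lfun mu 2%:E & sq (fun xi => - sinT (trunc n f) xi - F xi) @[n --> \oo] --> 0.
  apply: (lin (fun h xi => - sinT h xi)) => [h k hi ki|h hi hL].
    apply/funext => xi; rewrite -opprB opprK addrC /sinT -RintegralB//; [|exact: intg_sin|exact: intg_sin].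
    by congr (- _); apply: eq_Rintegral => x _; rewrite mulrBl.
  have [_ sL _ sle] := bessel hi hL; split; first exact: L2N.
  by rewrite /sq; under eq_Rintegral do rewrite sqrrN.
exists (F1, F2); split => //=.
- apply/(L2_cvg0 (f := fun n => trunc_fourier_re f n \- F1)) => [n|].
    by rewrite trunc_reE; apply: L2B => //; case: (bes n).
  by apply: cvg_trans c1; apply: near_eq_cvg; apply: nearW => n; rewrite trunc_reE.
- apply/(L2_cvg0 (f := fun n => trunc_fourier_im f n \- F2)) => [n|].
    by rewrite trunc_imE; apply: L2B => //; apply: L2N; case: (bes n).
  by apply: cvg_trans c2; apply: near_eq_cvg; apply: nearW => n; rewrite trunc_imE.
Qed.

Lemma fourierP f : f \in Lfun mu 2%:E ->
  [/\ (fourier f).1 \in Lfun mu 2%:E, (fourier f).2 \in Lfun mu 2%:E,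
     sq (fun xi => cosT (trunc n f) xi - (fourier f).1 xi) @[n --> \oo] --> 0 &
     sq (fun xi => - sinT (trunc n f) xi - (fourier f).2 xi) @[n --> \oo] --> 0].
Proof.
move=> fL; have bes n := bessel (trunc_intg n fL) (trunc_L2 n fL).
have : is_fourier f (fourier f) by apply: xgetPex; exact: fourier_exists.
case=> F1L F2L c1 c2; split=> //.
- have := (L2_cvg0 (f := fun n => trunc_fourier_re f n \- (fourier f).1) _).2 c1.
  have -> : (fun n => sq (trunc_fourier_re f n \- (fourier f).1)) = fun n => sq (fun xi => cosT (trunc n f) xi - (fourier f).1 xi).
    by apply/funext => n; rewrite trunc_reE.
  by apply=> n; rewrite trunc_reE; apply: L2B => //; case: (bes n).
- have := (L2_cvg0 (f := fun n => trunc_fourier_im f n \- (fourier f).2) _).2 c2.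
  have -> : (fun n => sq (trunc_fourier_im f n \- (fourier f).2)) = fun n => sq (fun xi => - sinT (trunc n f) xi - (fourier f).2 xi).
    by apply/funext => n; rewrite trunc_imE.
  by apply=> n; rewrite trunc_imE; apply: L2B => //; apply: L2N; case: (bes n).
Qed.

Definition cc (phi : R -> R) : Prop :=
  continuous phi /\ exists M : R, forall x, M < `|x| -> phi x = 0.

Lemma cc_supp (phi : R -> R) : cc phi -> exists N : nat, forall x, N%:R < `|x| -> phi x = 0.
Proof.
case=> _ [M HM]; exists (Num.trunc `|M|).+1 => x Nx; apply: HM.
apply: le_lt_trans (ler_norm M) _; apply: lt_trans Nx; exact: truncnS_gt.
Qed.

Lemma cc_bounded (phi : R -> R) : cc phi -> exists M : R, forall x, `|phi x| <= M.
Proof.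
move=> cphi; have [N HN] := cc_supp cphi; case: cphi => cphi _.
have NN : - N%:R <= N%:R :> R by rewrite (@le_trans _ _ 0)// oppr_le0.
have cn : {within `[- N%:R, N%:R], continuous (fun x => `|phi x|)}.
  apply: continuous_subspaceT => x; apply: (continuous_comp (f := phi)); first exact: cphi.
  exact: norm_continuous.
have [c _ Hc] := EVT_max NN cn.
exists `|phi c| => x; have [xN|Nx] := leP `|x| N%:R.
  by apply: Hc; rewrite in_itv/= -ler_norml.
by rewrite HN// normr0.
Qed.

Lemma cc_trunc (phi : R -> R) : cc phi -> exists N : nat, forall n, (N <= n)%N -> trunc n phi = phi.
Proof.
move=> /cc_supp[N HN]; exists N => n Nn; apply/funext => x.
have [xN|Nx] := leP `|x| n%:R; first exact: trunc_id.
by rewrite /trunc HN ?mul0r// (le_lt_trans _ Nx)// ler_nat.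
Qed.

Lemma cc_intg (phi : R -> R) : cc phi -> intg phi /\ phi \in Lfun mu 2%:E.
Proof.
move=> cphi; have [M HM] := cc_bounded cphi; have [N HN] := cc_trunc cphi.
have mphi : measurable_fun setT phi by case: cphi => + _; exact: continuous_measurable_fun.
have pL : phi \in Lfun mu 2%:E.
  apply: (L2_le mphi (L2Z M (ind_L2 N))) => x.
  by rewrite -{1}(HN N (leqnn _)) /trunc !normrM ler_wpM2r// (le_trans (HM x))// ler_norm.
by split=> //; rewrite -(HN N (leqnn _)); exact: trunc_intg.
Qed.

(** Parseval holds for the truncations of f; both sides pass to the limit because
    they pair an L^2 convergent sequence with a fixed L^2 function. *)
Lemma parseval_L2 f (phi : R -> R) : f \in Lfun mu 2%:E -> cc phi ->
  \int[mu]_xi ((fourier f).1 xi * cosT phi xi - (fourier f).2 xi * sinT phi xi) =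
  2 * pi * \int[mu]_x (f x * phi x).
Proof.
move=> fL cphi; have [pi1 pL] := cc_intg cphi; have [M HM] := cc_bounded cphi.
have [N HN] := cc_trunc cphi.
have bes n := bessel (trunc_intg n fL) (trunc_L2 n fL).
have [cpL spL _ _] := bessel pi1 pL.
have [F1L F2L c1 c2] := fourierP fL.
have A := L2_cvg_pair (fun n => let: And4 a _ _ _ := bes n in a) F1L cpL c1.
have B := L2_cvg_pair (fun n => let: And4 _ a _ _ := bes n in L2N a) F2L spL c2.
rewrite RintegralB//; [|exact: L2_mul|exact: L2_mul].
apply/esym; apply: (cvg_unique (@Rhausdorff R) _ (cvgB A B)); apply: cvg_near_cst.
exists N => // n /= Nn.
have [cfL sfL _ _] := bes n.
rewrite !fctE -RintegralB//; [|exact: L2_mul|by apply: L2_mul => //; exact: L2N].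
transitivity (2 * pi * \int[mu]_x (trunc n f x * phi x)); last first.
  by congr (_ * _); apply: eq_Rintegral => x _; rewrite -{2}(HN n Nn) /trunc mulrAC mulrA.
rewrite -(parseval (trunc_intg n fL) (trunc_L2 n fL) pi1 pL cphi.1 HM).
by apply: eq_Rintegral => x _; rewrite mulNr opprK.
Qed.

(** Fourier inversion for a real function with transform F1 + i F2. *)
Definition inv_fourier (F1 F2 : R -> R) (x : R) : R :=
  (2 * pi)^-1 * (cosT F1 x - sinT F2 x).

Lemma continuous_inv_fourier (F1 F2 : R -> R) : intg F1 -> intg F2 -> continuous (inv_fourier F1 F2).
Proof.
move=> i1 i2 x; apply: cvgM; first exact: cvg_cst.
by apply: cvgB; [exact: continuous_cosT|exact: continuous_sinT].
Qed.

Lemma inv_fourier_bound (F1 F2 : R -> R) x : intg F1 -> intg F2 ->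
  `|inv_fourier F1 F2 x| <= (2 * pi)^-1 * (\int[mu]_xi `|F1 xi| + \int[mu]_xi `|F2 xi|).
Proof.
move=> i1 i2; rewrite normrM ger0_norm; last by rewrite invr_ge0 mulr_ge0// pi_ge0.
rewrite ler_wpM2l ?invr_ge0 ?mulr_ge0 ?pi_ge0//.
by rewrite (le_trans (ler_normB _ _))// lerD ?cosT_bound ?sinT_bound.
Qed.

(** When the transform of f is integrable, Fubini's theorem in Parseval's identity
    shows that f and its inverse transform agree as distributions. *)
Lemma inv_fourier_pair f phi : f \in Lfun mu 2%:E -> cc phi ->
  intg (fourier f).1 -> intg (fourier f).2 ->
  \int[mu]_x (f x * phi x) = \int[mu]_x (inv_fourier (fourier f).1 (fourier f).2 x * phi x).
Proof.
move=> fL cphi i1 i2; have [pi1 pL] := cc_intg cphi.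
have p0 : 2 * pi != 0 :> R by rewrite mulf_neq0// gt_eqF// pi_gt0.
apply: (mulfI p0); rewrite -parseval_L2//.
have [F1L F2L _ _] := fourierP fL.
have [cpL spL _ _] := bessel pi1 pL.
rewrite RintegralB//; [|exact: L2_mul|exact: L2_mul].
have mc : measurable_fun setT (fun z : R * R => cos (z.2 * z.1)).
  by under eq_fun do rewrite mulrC; apply: meas_mulr; exact: continuous_cos.
have ms : measurable_fun setT (fun z : R * R => sin (z.2 * z.1)).
  by under eq_fun do rewrite mulrC; apply: meas_mulr; exact: continuous_sin.
rewrite (@Fubini_bounded _ _ _ (fun xi x => cos (x * xi)) 1 i1 pi1 mc) => [|xi x]; last exact: cos_max.
rewrite (@Fubini_bounded _ _ _ (fun xi x => sin (x * xi)) 1 i2 pi1 ms) => [|xi x]; last exact: sin_max.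
have ic (T : R -> R) (M : R) : continuous T -> (forall x, `|T x| <= M) -> intg (fun x => phi x * T x).
  by move=> cT TM; apply: (intg_bM (M := M) pi1) => //; exact: continuous_measurable_fun.
have eqc x : \int[mu]_xi ((fourier f).1 xi * cos (x * xi)) = cosT (fourier f).1 x.
  by apply: eq_Rintegral => xi _; rewrite (mulrC x).
have eqs x : \int[mu]_xi ((fourier f).2 xi * sin (x * xi)) = sinT (fourier f).2 x.
  by apply: eq_Rintegral => xi _; rewrite (mulrC x).
under eq_Rintegral do rewrite eqc.
under [X in _ - X]eq_Rintegral do rewrite eqs.
rewrite -RintegralB//; first last.
- by apply: ic => [|x]; [exact: continuous_sinT|exact: sinT_bound].
- by apply: ic => [|x]; [exact: continuous_cosT|exact: cosT_bound].
rewrite -RintegralZl//; last first.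
  have := ic (inv_fourier (fourier f).1 (fourier f).2) _ (continuous_inv_fourier i1 i2) (fun x => inv_fourier_bound x i1 i2).
  by apply: eq_integrable => // x _ /=; rewrite mulrC.
by apply: eq_Rintegral => x _; rewrite /inv_fourier !mulrA divff// mul1r; ring.
Qed.

Lemma is_derive_under_integral (F D : R -> R -> R) (G : R -> R) (x e : R) : 0 < e ->
  (forall z, x - e < z < x + e -> intg (F z)) ->
  (forall z y, is_derive z (1 : R) (F ^~ y) (D z y)) -> intg G ->
  (forall z y, x - e < z < x + e -> `|D z y| <= G y) ->
  is_derive x (1 : R) (fun z => \int[mu]_y F z y) (\int[mu]_y D x y).
Proof.
move=> e0 Fi dF Gi DG.
have D1 z y : derive1 (F ^~ y) z = D z y by rewrite derive1E; have [] := dF z y.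
have xI : `](x - e), (x + e)[%classic x by rewrite /= in_itv/= ltrDl ltrBlDr ltrDl e0.
have Fi' z : `](x - e), (x + e)[%classic z -> intg (F z) by rewrite /= in_itv/= => /Fi.
have dd z y : `](x - e), (x + e)[%classic z -> setT y -> derivable (F ^~ y) z 1.
  by move=> _ _; case: (dF z y).
have Gub z y : `](x - e), (x + e)[%classic z -> setT y -> `|partial1of2 F z y| <= `|G y|.
  by rewrite /= in_itv/= => ze _; rewrite /partial1of2 D1 (le_trans (DG _ _ ze))// ler_norm.
have H1 := @derivable_under_integral R _ _ mu F setT measurableT x _ _ xI Fi' dd _ (fun y => normr_ge0 (G y)) (intg_abs Gi) Gub.
have H2 := @differentiation_under_integral R _ _ mu F setT measurableT x _ _ xI Fi' dd _ (fun y => normr_ge0 (G y)) (intg_abs Gi) Gub.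
split; first exact: H1.
by rewrite -derive1E H2; apply: eq_Rintegral => y _; rewrite /partial1of2 D1.
Qed.

Lemma is_derive_cosT h (x : R) : intg h -> intg (fun xi => xi * h xi) ->
  is_derive x (1 : R) (cosT h) (- sinT (fun xi => xi * h xi) x).
Proof.
move=> hi xhi; rewrite /sinT -mulN1r -RintegralZl//; last exact: intg_sin.
apply: (@is_derive_under_integral (fun x xi => h xi * cos (xi * x))
  (fun x xi => -1 * (xi * h xi * sin (xi * x))) _ x 1 ltr01 _ _ (intg_abs xhi)).
- by move=> z _; exact: intg_cos.
- by move=> z y; derive_ring.
- by move=> z y _; rewrite mulN1r normrN normrM ler_piMr// sin_max.
Qed.

Lemma is_derive_sinT h (x : R) : intg h -> intg (fun xi => xi * h xi) ->
  is_derive x (1 : R) (sinT h) (cosT (fun xi => xi * h xi) x).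
Proof.
move=> hi xhi.
apply: (@is_derive_under_integral (fun x xi => h xi * sin (xi * x))
  (fun x xi => xi * h xi * cos (xi * x)) _ x 1 ltr01 _ _ (intg_abs xhi)).
- by move=> z _; exact: intg_sin.
- by move=> z y; derive_ring.
- by move=> z y _; rewrite normrM ler_piMr// cos_max.
Qed.

End fourier_plancherel.

(** * The Sobolev embedding for s >= 1 *)

Section sobolev_embedding.
Context {R : realType}.
Notation mu := (@lebesgue_measure R).
Implicit Types f g h k : R -> R.

Definition sobolev_weight (s : R) f (xi : R) : R :=
  (1 + xi ^+ 2) `^ (s / 2) * Num.sqrt ((fourier f).1 xi ^+ 2 + (fourier f).2 xi ^+ 2).

Lemma one_sqr (xi : R) : 1 <= 1 + xi ^+ 2.
Proof. by rewrite lerDl sqr_ge0. Qed.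

Lemma sobolev_weight_ge0 s f xi : 0 <= sobolev_weight s f xi.
Proof. by rewrite mulr_ge0 ?powR_ge0 ?sqrtr_ge0. Qed.

Lemma sobolev_weight_L2 s f : sobolev s f ->
  sobolev_weight s f \in Lfun mu 2%:E /\
  sobolev_norm s f = (Num.sqrt (sq (sobolev_weight s f)))%:E.
Proof.
move=> [fL fs]; have [F1L F2L _ _] := fourierP fL.
have WL : sobolev_weight s f \in Lfun mu 2%:E.
  rewrite inE; apply/andP; split; rewrite inE//=.
  apply: measurable_funM.
    apply: (@measurableT_comp _ _ _ _ _ _ (fun x => powR x (s / 2))) => //.
    apply: measurable_funD => //; exact: measurable_funX.
  have mq : measurable_fun setT (fun x : R => Num.sqrt x).
    by apply: continuous_measurable_fun; exact: sqrt_continuous.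
  apply: (measurableT_comp mq).
  by apply: measurable_funD; apply: measurable_funX; exact: L2_meas.
by split=> //; rewrite -L2_Lnorm.
Qed.

Lemma fourier_le_weight0 s f xi : 0 <= s ->
  `|(fourier f).1 xi| <= `|sobolev_weight s f xi| /\
  `|(fourier f).2 xi| <= `|sobolev_weight s f xi|.
Proof.
move=> s0; rewrite (ger0_norm (sobolev_weight_ge0 _ _ _)) /sobolev_weight.
have w1 : 1 <= (1 + xi ^+ 2) `^ (s / 2).
  by have := @ler_powR _ _ (one_sqr xi) 0 (s / 2); rewrite powRr0; apply; rewrite divr_ge0.
have H (a b : R) : `|a| <= (1 + xi ^+ 2) `^ (s / 2) * Num.sqrt (a ^+ 2 + b ^+ 2).
  apply: (@le_trans _ _ (Num.sqrt (a ^+ 2 + b ^+ 2))).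
    by rewrite -sqrtr_sqr ler_sqrt ?addr_ge0 ?sqr_ge0// lerDl sqr_ge0.
  by rewrite ler_peMl// sqrtr_ge0.
by split; [exact: H|rewrite [X in _ * Num.sqrt X]addrC; exact: H].
Qed.

Lemma fourier_le_weight1 s f xi : 1 <= s ->
  Num.sqrt (1 + xi ^+ 2) * `|(fourier f).1 xi| <= sobolev_weight s f xi /\
  Num.sqrt (1 + xi ^+ 2) * `|(fourier f).2 xi| <= sobolev_weight s f xi.
Proof.
move=> s1; rewrite /sobolev_weight.
have w1 : Num.sqrt (1 + xi ^+ 2) <= (1 + xi ^+ 2) `^ (s / 2).
  rewrite -powR12_sqrt ?(le_trans ler01 (one_sqr xi))// ler_powR ?one_sqr//.
  by rewrite -[leLHS]mul1r ler_wpM2r.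
have H (a b : R) : Num.sqrt (1 + xi ^+ 2) * `|a| <= (1 + xi ^+ 2) `^ (s / 2) * Num.sqrt (a ^+ 2 + b ^+ 2).
  apply: ler_pM; rewrite ?sqrtr_ge0//.
  by rewrite -sqrtr_sqr ler_sqrt ?addr_ge0 ?sqr_ge0// lerDl sqr_ge0.
by split; [exact: H|rewrite [X in _ * Num.sqrt X]addrC; exact: H].
Qed.

Lemma sq_le f g : f \in Lfun mu 2%:E -> g \in Lfun mu 2%:E ->
  (forall x, `|f x| <= `|g x|) -> sq f <= sq g.
Proof.
move=> /L2P[_ fi] /L2P[_ gi] fg; apply: Rint_le => // x.
by rewrite -real_normK ?num_real// -[leRHS]real_normK ?num_real// lerXn2r ?nnegrE.
Qed.

Definition pair_const (phi : R -> R) : R :=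
  (2 * pi)^-1 * (Num.sqrt (sq (cosT phi)) + Num.sqrt (sq (sinT phi))).

(** For s >= 0 the H^s norm controls f as a distribution: Parseval and
    Cauchy-Schwarz, the weight being at least 1. *)
Lemma sobolev_pairing s f phi : 0 <= s -> sobolev s f -> cc phi ->
  `|\int[mu]_x (f x * phi x)| <= pair_const phi * fine (sobolev_norm s f).
Proof.
move=> s0 sf cphi; have [WL WE] := sobolev_weight_L2 sf.
have fL := sf.1; have [F1L F2L _ _] := fourierP fL.
have [pi1 pL] := cc_intg cphi; have [cL sL _ _] := bessel pi1 pL.
have p0 : 2 * pi != 0 :> R by rewrite mulf_neq0// gt_eqF// pi_gt0.
have p1 : 0 <= (2 * pi)^-1 :> R by rewrite invr_ge0 mulr_ge0// pi_ge0.
have -> : \int[mu]_x (f x * phi x) = (2 * pi)^-1 *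
    \int[mu]_xi ((fourier f).1 xi * cosT phi xi - (fourier f).2 xi * sinT phi xi).
  by rewrite parseval_L2// mulrA mulVf// mul1r.
rewrite normrM (ger0_norm p1) /pair_const -mulrA ler_wpM2l// WE/=.
rewrite RintegralB//; [|exact: L2_mul|exact: L2_mul].
rewrite (le_trans (ler_normB _ _))// mulrDl lerD//.
- apply: le_trans (L2_cs_int F1L cL) _; rewrite mulrC ler_wpM2l ?sqrtr_ge0//.
  rewrite ler_sqrt ?sq_ge0// sq_le// => xi.
  by have [] := fourier_le_weight0 f xi s0.
- rewrite (le_trans (L2_cs_int F2L sL))// mulrC ler_wpM2l ?sqrtr_ge0//.
  rewrite ler_sqrt ?sq_ge0// sq_le// => xi.
  by have [] := fourier_le_weight0 f xi s0.
Qed.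

Definition bracketV (xi : R) : R := (Num.sqrt (1 + xi ^+ 2))^-1.

Lemma bracketV_L2 : bracketV \in Lfun mu 2%:E.
Proof.
have cb : continuous bracketV.
  move=> x; apply: cvgV.
    by rewrite gt_eqF// sqrtr_gt0 (lt_le_trans ltr01)// one_sqr.
  apply: (continuous_comp (f := fun x : R => 1 + x ^+ 2)); last exact: sqrt_continuous.
  by apply: cvgD; [exact: cvg_cst|exact: exprn_continuous].
apply/L2P; split; first exact: continuous_measurable_fun.
have [ip _] := @intg_poisson R 1 0 ltr01.
have := intgZ 2^-1 ip; apply: eq_integrable => // x _ /=; congr EFin.
rewrite /bracketV sub0r poissonN /poisson exprVn sqr_sqrtr ?(le_trans ler01 (one_sqr x))//.
by rewrite expr1n mulr1 mulrA mulVf// mul1r.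
Qed.

(** The transform is the product of the L^2 functions (1 + xi^2)^(-1/2) and
    (1 + xi^2)^(1/2) F, hence integrable. *)
Lemma sobolev_fourier_intg s f : 1 <= s -> sobolev s f ->
  [/\ intg (fourier f).1, intg (fourier f).2,
    \int[mu]_xi `|(fourier f).1 xi| <= Num.sqrt (sq bracketV) * fine (sobolev_norm s f) &
    \int[mu]_xi `|(fourier f).2 xi| <= Num.sqrt (sq bracketV) * fine (sobolev_norm s f)].
Proof.
move=> s1 sf; have [WL ->] := sobolev_weight_L2 sf => /=.
have [F1L F2L _ _] := fourierP sf.1.
have key F : F \in Lfun mu 2%:E -> (forall xi, Num.sqrt (1 + xi ^+ 2) * `|F xi| <= sobolev_weight s f xi) ->
    intg F /\ \int[mu]_xi `|F xi| <= Num.sqrt (sq bracketV) * Num.sqrt (sq (sobolev_weight s f)).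
  move=> FL FW; have Fle xi : `|F xi| <= `|bracketV xi * sobolev_weight s f xi|.
    have p : 0 < Num.sqrt (1 + xi ^+ 2) by rewrite sqrtr_gt0 (lt_le_trans ltr01)// one_sqr.
    have b0 : 0 <= (Num.sqrt (1 + xi ^+ 2))^-1 by rewrite invr_ge0 ltW.
    by rewrite /bracketV (ger0_norm (mulr_ge0 b0 (sobolev_weight_ge0 s f xi))) mulrC ler_pdivlMr// mulrC.
  have bW := L2_mul bracketV_L2 WL.
  have Fi : intg F by apply: intg_le bW Fle; exact: L2_meas.
  split=> //; apply: le_trans (L2_cs bracketV_L2 WL).
  by apply: Rint_le => //; exact: intg_abs.
have [? ?] := key _ F1L (fun xi => (fourier_le_weight1 f xi s1).1).
have [? ?] := key _ F2L (fun xi => (fourier_le_weight1 f xi s1).2).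
by split.
Qed.

Lemma sobolev_xi_L2 s f : 1 <= s -> sobolev s f ->
  (fun xi => xi * (fourier f).1 xi) \in Lfun mu 2%:E /\
  (fun xi => xi * (fourier f).2 xi) \in Lfun mu 2%:E.
Proof.
move=> s1 sf; have [WL _] := sobolev_weight_L2 sf.
have [F1L F2L _ _] := fourierP sf.1.
have key F : F \in Lfun mu 2%:E -> (forall xi, Num.sqrt (1 + xi ^+ 2) * `|F xi| <= sobolev_weight s f xi) ->
    (fun xi => xi * F xi) \in Lfun mu 2%:E.
  move=> FL FW; apply: (L2_le _ WL).
    by apply: measurable_funM => //; exact: L2_meas.
  move=> xi; rewrite (ger0_norm (sobolev_weight_ge0 _ _ _)) normrM; apply: le_trans (FW xi).
  by rewrite ler_wpM2r// -sqrtr_sqr ler_sqrt ?addr_ge0 ?sqr_ge0// lerDr.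
split; apply: key => // xi; by have [] := fourier_le_weight1 f xi s1.
Qed.

Definition embed_const : R := (2 * pi)^-1 * (Num.sqrt (sq bracketV) + Num.sqrt (sq bracketV)).

(** The continuous representative of an H^s function. *)
Definition crep f : R -> R := inv_fourier (fourier f).1 (fourier f).2.

Lemma crep_bound s f x : 1 <= s -> sobolev s f ->
  `|crep f x| <= embed_const * fine (sobolev_norm s f).
Proof.
move=> s1 sf; have [i1 i2 b1 b2] := sobolev_fourier_intg s1 sf.
apply: le_trans (inv_fourier_bound x i1 i2) _.
rewrite /embed_const -mulrA ler_wpM2l ?invr_ge0 ?mulr_ge0 ?pi_ge0//.
by rewrite mulrDl lerD.
Qed.

Lemma continuous_crep s f : 1 <= s -> sobolev s f -> continuous (crep f).
Proof.
by move=> s1 sf; have [i1 i2 _ _] := sobolev_fourier_intg s1 sf; exact: continuous_inv_fourier.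
Qed.

Lemma crep_pair s f phi : 1 <= s -> sobolev s f -> cc phi ->
  \int[mu]_x (f x * phi x) = \int[mu]_x (crep f x * phi x).
Proof.
move=> s1 sf cphi; have [i1 i2 _ _] := sobolev_fourier_intg s1 sf.
exact: inv_fourier_pair sf.1 cphi i1 i2.
Qed.

(** Smooth approximation of [crep f] by inverting the transform on [-n, n]: the
    functions converge uniformly because the transform is integrable and, by Bessel,
    their derivatives converge in L^2. *)
Lemma crep_approx s f : 1 <= s -> sobolev s f ->
  exists (fN dN : nat -> R -> R) (g : R -> R) (eps : nat -> R),
  [/\ forall n (x : R), is_derive x (1 : R) (fN n) (dN n x),
      forall n, continuous (dN n) /\ dN n \in Lfun mu 2%:E,
      eps n @[n --> \oo] --> 0 /\ forall n x, `|fN n x - crep f x| <= eps n,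
      g \in Lfun mu 2%:E & sq (fun x => dN n x - g x) @[n --> \oo] --> 0].
Proof.
move=> s1 sf; have [i1 i2 _ _] := sobolev_fourier_intg s1 sf.
have [x1 x2] := sobolev_xi_L2 s1 sf.
have [F1L F2L _ _] := fourierP sf.1.
set F1 := (fourier f).1 in i1 x1 F1L *; set F2 := (fourier f).2 in i2 x2 F2L *.
have txi (F : R -> R) n : (fun xi => xi * trunc n F xi) = trunc n (fun xi => xi * F xi).
  by apply/funext => xi; rewrite /trunc mulrA.
pose fN n := inv_fourier (trunc n F1) (trunc n F2).
pose dN n x := (2 * pi)^-1 * (- sinT (trunc n (fun xi => xi * F1 xi)) x - cosT (trunc n (fun xi => xi * F2 xi)) x).
have [_ G1L _ c1] := fourierP x1; have [G2L _ c2 _] := fourierP x2.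
pose G1 := (fourier (fun xi => xi * F1 xi)).2.
pose G2 := (fourier (fun xi => xi * F2 xi)).1.
pose g x := (2 * pi)^-1 * (G1 x - G2 x).
have tE (F : R -> R) : intg F -> \int[mu]_xi `|trunc n F xi - F xi| @[n --> \oo] --> 0.
  move=> Fi; have [|||||_] := @Rint_dct R (fun n xi => `|trunc n F xi - F xi|) (fun _ => 0) (fun xi => 2 * `|F xi|).
  - move=> n; apply: measurableT_comp => //; apply: measurable_funB; last exact: intg_meas.
    by apply: meas_trunc; exact: (intg_meas Fi).
  - exact: measurable_cst.
  - apply: ae_all => xi; rewrite -(normr0 R) -(subrr (F xi)); apply: cvg_norm.
    by apply: cvgB; [exact: trunc_cvg|exact: cvg_cst].
  - by apply: intgZ; exact: intg_abs.
  - move=> n xi; rewrite normr_id (le_trans (ler_normB _ _))// mulrDl mul1r lerD//.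
    exact: trunc_le.
  by rewrite /Rintegral integral0.
exists fN, dN, g, (fun n => (2 * pi)^-1 * (\int[mu]_xi `|trunc n F1 xi - F1 xi| + \int[mu]_xi `|trunc n F2 xi - F2 xi|)).
split.
- move=> n x; rewrite /dN -!txi.
  have d1 := @is_derive_cosT R (trunc n F1) x (trunc_intg n F1L) _.
  have d2 := @is_derive_sinT R (trunc n F2) x (trunc_intg n F2L) _.
  rewrite !txi in d1 d2 *.
  have {}d1 := d1 (trunc_intg n x1); have {}d2 := d2 (trunc_intg n x2).
  rewrite /fN /inv_fourier; apply: trigger_derive.
  by rewrite /GRing.scale/=; ring.
- move=> n; have j1 := trunc_intg n x1; have j2 := trunc_intg n x2; split.
    move=> x; apply: cvgM; first exact: cvg_cst.
    by apply: cvgB; [apply: cvgN; exact: continuous_sinT|exact: continuous_cosT].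
  have [_ sL _ _] := bessel j1 (trunc_L2 n x1); have [cL _ _ _] := bessel j2 (trunc_L2 n x2).
  by apply: L2Z; apply: L2B => //; exact: L2N.
- split.
    rewrite -(mulr0 (2 * pi)^-1); apply: cvgM; first exact: cvg_cst.
    by rewrite -(addr0 0); apply: cvgD; exact: tE.
  move=> n x; have t1 := trunc_intg n F1L; have t2 := trunc_intg n F2L.
  have -> : fN n x - crep f x = inv_fourier (fun xi => trunc n F1 xi - F1 xi) (fun xi => trunc n F2 xi - F2 xi) x.
    rewrite /fN /crep /inv_fourier -mulrBr; congr (_ * _).
    rewrite -/F1 -/F2 /cosT /sinT.
    under [in RHS]eq_Rintegral do rewrite mulrBl.
    under [X in _ = _ - X]eq_Rintegral do rewrite mulrBl.
    rewrite !RintegralB//; try exact: intg_cos; try exact: intg_sin.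
    ring.
  by apply: inv_fourier_bound; exact: intgB.
- by apply: L2Z; exact: L2B.
- have j1 n := trunc_intg n x1; have j2 n := trunc_intg n x2.
  pose a n x := - sinT (trunc n (fun xi => xi * F1 xi)) x - G1 x.
  pose b n x := cosT (trunc n (fun xi => xi * F2 xi)) x - G2 x.
  have aL n : a n \in Lfun mu 2%:E.
    by have [_ sL _ _] := bessel (j1 n) (trunc_L2 n x1); apply: L2B => //; exact: L2N.
  have bL n : b n \in Lfun mu 2%:E.
    by have [cL _ _ _] := bessel (j2 n) (trunc_L2 n x2); exact: L2B.
  have dE n : sq (fun x => dN n x - g x) = (2 * pi) ^- 2 * sq (fun x => a n x - b n x).
    rewrite /sq -RintegralZl//; last by have [] := (L2P _).1 (L2B (aL n) (bL n)).
    apply: eq_Rintegral => x _; rewrite /dN /g /a /b -mulrBr exprMn exprVn; congr (_ * _ ^+ 2).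
    ring.
  have sc : 2 * sq (a n) + 2 * sq (b n) @[n --> \oo] --> 0.
    have z : (2 * 0 + 2 * 0 : R) = 0 by rewrite !mulr0 addr0.
    rewrite -{}z; apply: cvgD; apply: cvgM; (exact: cvg_cst || exact: c1 || exact: c2).
  apply: (@squeeze_cvgr _ _ _ _ (cst 0) (fun n => (2 * pi) ^- 2 * (2 * sq (a n) + 2 * sq (b n)))).
  + apply: nearW => n; rewrite sq_ge0/= dE ler_wpM2l ?invr_ge0 ?sqr_ge0//.
    exact: sqB_le.
  + exact: cvg_cst.
  + rewrite -(mulr0 ((2 * pi) ^- 2)); apply: cvgM => //; exact: cvg_cst.
Qed.

End sobolev_embedding.

(** * Derivatives and primitives *)

Section derivatives.
Context {R : realType}.
Implicit Types f g : R -> R.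

Lemma is_derive_eps f (x l : R) : is_derive x (1 : R) f l <->
  forall e : R, 0 < e -> exists2 d : R, 0 < d &
    forall h : R, `|h| < d -> `|f (x + h) - f x - l * h| <= e * `|h|.
Proof.
have quot (h : R) : h != 0 -> `|l - h^-1 *: (f (h *: (1 : R) + x) - f x)| * `|h| = `|f (x + h) - f x - l * h|.
  move=> h0; rewrite -normrM distrC; congr `|_|.
  by rewrite /GRing.scale/= mulr1 (addrC h) mulrBl mulrAC mulVf// mul1r.
split=> [[df fl] e e0|H].
  have : h^-1 *: (f (h *: (1 : R) + x) - f x) @[h --> 0^'] --> l by rewrite -fl; exact: df.
  move=> /cvgrPdist_le/(_ _ e0); rewrite near_withinE => /nbhs_ballP[d /= d0 Hd].
  exists d => // h hd; have [->|h0] := eqVneq h 0.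
    by rewrite addr0 subrr mulr0 subr0 normr0 mulr0.
  rewrite -quot// ler_wpM2r//; apply: Hd => //.
  by rewrite /ball/= sub0r normrN.
have cv : h^-1 *: (f (h *: (1 : R) + x) - f x) @[h --> 0^'] --> l.
  apply/cvgrPdist_le => e e0; rewrite near_withinE; apply/nbhs_ballP.
  have [d d0 Hd] := H _ e0; exists d => //= h; rewrite /ball/= sub0r normrN => hd h0.
  by rewrite -(@ler_pM2r _ `|h|) ?normr_gt0// quot// Hd.
by split; [apply/cvg_ex; exists l|exact/cvg_lim].
Qed.

Lemma is_derive_continuous f (x l : R) : is_derive x (1 : R) f l -> {for x, continuous f}.
Proof. by case=> df _; exact/differentiable_continuous/derivable1_diffP. Qed.

Notation mu := (@lebesgue_measure R).

Lemma LRcontinuous (F f : R -> R) (a b : R) : (forall x : R, is_derive x (1 : R) F (f x)) ->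
  derivable_oo_LRcontinuous F a b.
Proof.
move=> dF; split.
- by move=> x _; case: (dF x).
- by apply: cvg_at_right_filter; exact: is_derive_continuous (dF a).
- by apply: cvg_at_left_filter; exact: is_derive_continuous (dF b).
Qed.

Lemma is_derive1E (F f : R -> R) : (forall x : R, is_derive x (1 : R) F (f x)) -> derive1 F = f.
Proof. by move=> dF; apply/funext => x; rewrite derive1E; case: (dF x). Qed.

Lemma itv_intg (f : R -> R) (a b : R) : continuous f -> mu.-integrable `[a, b] (EFin \o f).
Proof.
move=> cf; apply: continuous_compact_integrable; first exact: segment_compact.
exact: continuous_subspaceT.
Qed.

Lemma FTC2 (F f : R -> R) (a b : R) : a <= b -> (forall x : R, is_derive x (1 : R) F (f x)) ->
  continuous f -> \int[mu]_(x in `[a, b]) f x = F b - F a.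
Proof.
rewrite le_eqVlt => /predU1P[->|ab] dF cf; first by rewrite set_itv1 Rintegral_set1 subrr.
rewrite /Rintegral (@continuous_FTC2 _ f F)//.
- exact: continuous_subspaceT.
- exact: LRcontinuous dF.
- by move=> x _; rewrite (is_derive1E dF).
Qed.

(** A primitive on the whole line: integrals in time become differentiable
    functions of a real variable without side conditions. *)
Definition prim (f : R -> R) (x : R) : R :=
  if 0 <= x then \int[mu]_(y in `[0, x]) f y else - \int[mu]_(y in `[x, 0]) f y.

Lemma prim0 f : prim f 0 = 0.
Proof. by rewrite /prim lexx set_itv1 Rintegral_set1. Qed.

Lemma is_derive_prim (f : R -> R) : continuous f -> forall x : R, is_derive x (1 : R) (prim f) (f x).
Proof.
move=> cf x; pose N : R := `|x| + 1.
have N0 : 0 < N by rewrite ltr_pwDr.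
have Nx : - N < x by rewrite ltrNl (le_lt_trans (ler_norm _))// normrN ltrDl.
have x1 : x < x + 1 by rewrite ltrDl.
have [dF Fx] := @continuous_FTC1_closed R f (- N) x (x + 1) x1 (itv_intg _ _ cf) Nx (cf x).
have : is_derive x (1 : R) (fun y => \int[mu]_(t in `[- N, y]) f t - \int[mu]_(t in `[- N, 0]) f t) (f x).
  have d1 : is_derive x (1 : R) (fun y : R => \int[mu]_(t in `[- N, y]) f t) (f x).
    by split; [exact: dF|rewrite -derive1E].
  by apply: trigger_derive; rewrite subr0.
apply: near_eq_is_derive; near=> y.
have Ny : - N < y by near: y; exact: lt_nbhsr.
rewrite /prim; case: ifPn => [y0|]; last rewrite -ltNge => y0.
- rewrite (@Rintegral_itvB _ f (BLeft (- N)) (BRight y) 0).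
  + rewrite Rintegral_itv_obnd_cbnd//; apply: integrableS (itv_intg 0 y cf) => //.
    exact: subset_itv_oc_cc.
  + exact: itv_intg.
  + by rewrite bnd_simp lerNl oppr0 ltW.
  + by rewrite bnd_simp.
- rewrite -opprB (@Rintegral_itvB _ f (BLeft (- N)) (BRight 0) y).
  + rewrite Rintegral_itv_obnd_cbnd//; apply: integrableS (itv_intg y 0 cf) => //.
    exact: subset_itv_oc_cc.
  + exact: itv_intg.
  + by rewrite bnd_simp ltW.
  + by rewrite bnd_simp ltW.
Unshelve. all: by end_near. Qed.

Lemma continuous_prim (f : R -> R) : continuous f -> continuous (prim f).
Proof. by move=> cf x; exact: is_derive_continuous (is_derive_prim cf x). Qed.

Lemma Rint_supp (h : R -> R) (a b : R) : (forall x, ~ (a <= x <= b) -> h x = 0) ->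
  \int[mu]_x h x = \int[mu]_(x in `[a, b]) h x.
Proof.
move=> h0; rewrite [RHS]Rintegral_mkcond; apply: eq_Rintegral => x _.
rewrite patchE; case: ifPn => // xab; apply: h0 => /andP[ax xb].
by move: xab; rewrite notin_setE/= in_itv/= ax xb.
Qed.

Lemma mvt (F f : R -> R) (a b : R) : a < b -> (forall x : R, is_derive x (1 : R) F (f x)) ->
  exists2 c, a < c < b & F b - F a = f c * (b - a).
Proof.
move=> ab dF; have [|c cab E] := @MVT R F f a b ab (fun x _ => dF x).
- by apply: continuous_subspaceT => x; exact: is_derive_continuous (dF x).
- by exists c => //; move: cab; rewrite in_itv.
Qed.

End derivatives.

(** * Test functions and the fundamental lemma *)

Section test_functions.
Context {R : realType}.
Notation mu := (@lebesgue_measure R).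
Implicit Types f g : R -> R.

Definition smooth f := forall n x, derivable (derive1n n f) (x : R) 1.

Lemma smooth_family (S : (R -> R) -> Prop) :
  (forall f, S f -> (forall x : R, derivable f x 1) /\ S (derive1 f)) ->
  forall f, S f -> smooth f.
Proof.
move=> HS f Sf n x; suff Sn : S (derive1n n f) by case: (HS _ Sn).
by elim: n => [|n IH] //; rewrite derive1nS; case: (HS _ IH).
Qed.

(** The index makes the family stable under differentiation up to linear
    combinations, see [is_derive_flat]. *)
Definition flat (i : nat) (x : R) : R := if 0 < x then x^-1 ^+ i * expR (- x^-1) else 0.

Lemma flat_neg i x : x <= 0 -> flat i x = 0.
Proof. by rewrite /flat leNgt => /negbTE->. Qed.

Lemma flat_ge0 i x : 0 <= flat i x.
Proof. by rewrite /flat; case: ifP => // x0; rewrite mulr_ge0 ?expR_ge0// exprn_ge0// invr_ge0 ltW. Qed.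

Lemma flat_gt0 i x : 0 < x -> 0 < flat i x.
Proof. by rewrite /flat => x0; rewrite x0 mulr_gt0 ?expR_gt0// exprn_gt0// invr_gt0. Qed.

Lemma flat0_le1 x : flat 0 x <= 1.
Proof.
rewrite /flat; case: ifP => // x0.
by rewrite expr0 mul1r -expR0 ler_expR lerNl oppr0 invr_ge0 ltW.
Qed.

(** exp (1 / x) exceeds every power of 1 / x; a quadratic bound at 0 gives
    differentiability there. *)
Lemma flat_small i x : `|flat i x| <= (i.+2)`!%:R * x ^+ 2.
Proof.
rewrite ger0_norm ?flat_ge0// /flat; case: ifP => x0; last by rewrite mulr_ge0 ?sqr_ge0.
have := @expR_ge1Dxn R x^-1 i.+1; rewrite invr_ge0 => /(_ (ltW x0)).
set E := expR _ => HE.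
have E0 : 0 < E by rewrite expR_gt0.
rewrite expRN -/E ler_pdivrMr//.
have f0 : 0 < (i.+2)`!%:R :> R by rewrite ltr0n fact_gt0.
have : x^-1 ^+ i.+2 / (i.+2)`!%:R <= E by rewrite (le_trans _ HE)// lerDr.
rewrite ler_pdivrMr// => H.
rewrite -(@ler_pM2r _ (x^-1 ^+ 2)) ?exprn_gt0 ?invr_gt0// -exprD addn2.
apply: (le_trans H); rewrite mulrAC -(mulrA _ (x ^+ 2)) -exprMn divff ?gt_eqF//.
by rewrite expr1n mulr1 mulrC.
Qed.

Lemma is_derive_flat_pos i (x : R) : 0 < x ->
  is_derive x (1 : R) (flat i) (flat i.+2 x - i%:R * flat i.+1 x).
Proof.
move=> x0; have x1 : x != 0 by rewrite gt_eqF.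
have dV : is_derive x (1 : R) (fun x : R => x^-1) (- x^-1 ^+ 2).
  by have := is_deriveV x1 (is_derive_id x (1 : R)); rewrite /GRing.scale/= mulr1 exprVn.
elim: i => [|i IH].
  have : is_derive x (1 : R) (fun x => expR (- x^-1)) (flat 2 x - 0%:R * flat 1 x).
    by apply: trigger_derive; rewrite /flat x0 /GRing.scale/=; ring.
  apply: near_eq_is_derive.
  by near=> y; rewrite /flat ifT ?expr0 ?mul1r//; near: y; exact: lt_nbhsr.
have : is_derive x (1 : R) (fun x => x^-1 * flat i x) (flat i.+3 x - i.+1%:R * flat i.+2 x).
  apply: trigger_derive; rewrite /flat x0 /GRing.scale/= !exprS; ring.
apply: near_eq_is_derive.
near=> y; have y0 : 0 < y by near: y; exact: lt_nbhsr.
by rewrite /flat y0 exprS mulrA.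
Unshelve. all: by end_near. Qed.

Lemma is_derive_flat i (x : R) :
  is_derive x (1 : R) (flat i) (flat i.+2 x - i%:R * flat i.+1 x).
Proof.
have [x0|x0|->] := ltgtP x 0.
- rewrite !flat_neg ?(ltW x0)// mulr0 subr0.
  apply: near_eq_is_derive (is_derive_cst 0 x 1).
  by near=> y; rewrite flat_neg//; near: y; exact: lt_le_nbhsl.
- exact: is_derive_flat_pos.
- rewrite !flat_neg// mulr0 subr0; apply/is_derive_eps => e e0.
  pose C : R := (i.+2)`!%:R.
  have C0 : 0 < C by rewrite ltr0n fact_gt0.
  exists (e / C); first by rewrite divr_gt0.
  move=> h hd; rewrite add0r (@flat_neg i 0)// mul0r !subr0.
  apply: le_trans (flat_small i h) _.
  rewrite -(real_normK (num_real h)) expr2 mulrA ler_wpM2r//.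
  by rewrite mulrC -ler_pdivlMr// ltW.
Unshelve. all: by end_near. Qed.

(** A family stable under differentiation that contains the bumps. *)
Inductive flat_span : (R -> R) -> Prop :=
| flat_span_prod i j a b c d : flat_span (fun x => flat i (a * (x - b)) * flat j (c * (d - x)))
| flat_span_add f g : flat_span f -> flat_span g -> flat_span (fun x => f x + g x)
| flat_span_scale (k : R) f : flat_span f -> flat_span (fun x => k * f x).

Lemma is_derive_affine i (a b x : R) : is_derive x (1 : R) (fun x => flat i (a * (x - b)))
  (a * (flat i.+2 (a * (x - b)) - i%:R * flat i.+1 (a * (x - b)))).
Proof.
have d1 : is_derive x (1 : R) (fun x : R => a * (x - b)) a.
  by derive_ring.
have := @is_derive1_comp R (flat i) (fun x => a * (x - b)) x _ _ (is_derive_flat i (a * (x - b))) d1.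
by rewrite mulrC.
Qed.

Lemma smooth_flat_span f : flat_span f -> smooth f.
Proof.
apply: smooth_family => {}f.
suff H : flat_span f -> exists2 g, flat_span g & forall x : R, is_derive x (1 : R) f (g x).
  move=> /H[g Sg dg]; split=> [x|]; first by case: (dg x).
  rewrite (_ : derive1 f = g)//; apply/funext => x; rewrite derive1E.
  by apply: derive_val.
elim=> [i j a b c d|{}f h Sf [f' Sf' df] Sh [h' Sh' dh]|k {}f Sf [f' Sf' df]].
- exists (fun x => (a * (flat i.+2 (a * (x - b)) * flat j (c * (d - x))) +
   (- i%:R * a) * (flat i.+1 (a * (x - b)) * flat j (c * (d - x)))) +
   (- c * (flat i (a * (x - b)) * flat j.+2 (c * (d - x))) +
   (j%:R * c) * (flat i (a * (x - b)) * flat j.+1 (c * (d - x))))).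
    by do ! [apply: flat_span_add|apply: flat_span_scale|exact: flat_span_prod].
  move=> x; have d1 := is_derive_affine i a b x.
  have d2 : is_derive x (1 : R) (fun x => flat j (c * (d - x)))
    (- c * (flat j.+2 (c * (d - x)) - j%:R * flat j.+1 (c * (d - x)))).
    have := is_derive_affine j (- c) d x.
    have aux (y : R) : - c * (y - d) = c * (d - y) by ring.
    by under eq_fun do rewrite aux; rewrite aux.
  by derive_ring.
- exists (fun x => f' x + h' x) => [|x]; first exact: flat_span_add.
  exact: is_deriveD.
- exists (fun x => k * f' x) => [|x]; first exact: flat_span_scale.
  have := df x => dfx; apply: trigger_derive; by rewrite /GRing.scale/=; ring.
Qed.

(** Supported in [b, d]; as a increases to infinity, the bumps increase to the
    indicator of ]b, d[. *)
Definition bump (a b d : R) (x : R) : R := flat 0 (a * (x - b)) * flat 0 (a * (d - x)).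

Lemma bump_ge0 a b d x : 0 <= bump a b d x.
Proof. by rewrite mulr_ge0// flat_ge0. Qed.

Lemma bump_le1 a b d x : bump a b d x <= 1.
Proof. by rewrite /bump mulr_ile1 ?flat_ge0 ?flat0_le1. Qed.

Lemma bump_out a b d x : 0 < a -> ~ (b < x < d) -> bump a b d x = 0.
Proof.
move=> a0 /negP; rewrite negb_and -!leNgt => /orP[xb|dx].
  by rewrite /bump flat_neg ?mul0r// pmulr_rle0// subr_le0.
by rewrite /bump (@flat_neg _ (a * (d - x))) ?mulr0// pmulr_rle0// subr_le0.
Qed.

Lemma bump_test a b d : 0 < a -> test_function (bump a b d).
Proof.
move=> a0; split; first by apply: smooth_flat_span; exact: flat_span_prod.
exists (`|b| + `|d|) => x Hx; apply: bump_out => // /andP[bx xd].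
have : `|x| <= `|b| + `|d|; last by rewrite leNgt Hx.
rewrite ler_norml; apply/andP; split.
  rewrite lerNl; apply: (@le_trans _ _ `|b|); last by rewrite lerDl.
  by rewrite -normrN (le_trans _ (ler_norm _))// lerN2 ltW.
apply: (@le_trans _ _ `|d|); last by rewrite lerDr.
by rewrite (le_trans (ltW xd))// ler_norm.
Qed.

Lemma bump_cvg b d x : bump n.+1%:R b d x @[n --> \oo] --> (\1_(`]b, d[) x : R).
Proof.
have n0 n : 0 < n.+1%:R :> R by [].
rewrite indicE; have [xbd|xbd] := boolP (x \in _).
  move: xbd; rewrite inE/= in_itv/= => /andP[bx xd].
  have H (y : R) : 0 < y -> flat 0 (n.+1%:R * y) @[n --> \oo] --> (1 : R).
    move=> y0; have -> : (fun n => flat 0 (n.+1%:R * y)) = (fun n => expR (- (n.+1%:R^-1 * y^-1))).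
      by apply/funext => n; rewrite /flat mulr_gt0// expr0 mul1r invfM.
    have : expR (- (n.+1%:R^-1 * y^-1)) @[n --> \oo] --> expR (- (0 * y^-1)).
      apply: continuous_cvg; first exact: continuous_expR.
      by apply: cvgN; apply: cvgM; [exact: cvg_harmonic|exact: cvg_cst].
    by rewrite mul0r oppr0 expR0.
  by rewrite /= -[X in _ --> X](mulr1 1); apply: cvgM; apply: H; rewrite subr_gt0.
apply: cvg_near_cst; apply: nearW => n; apply: bump_out => //.
by move=> H; move: xbd; rewrite notin_setE/= in_itv/= H.
Qed.

Lemma test_cc (phi : R -> R) : test_function phi -> cc phi.
Proof.
case=> dphi Mphi; split=> // x.
by apply/differentiable_continuous/derivable1_diffP; exact: (dphi 0%N).
Qed.

Lemma test_deriv (phi : R -> R) : test_function phi -> test_function (derive1 phi).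
Proof.
case=> dphi [M HM]; split.
  move=> n x; have := dphi n.+1 x.
  by rewrite /derive1n iterSr.
exists M => x Mx; rewrite derive1E.
have -> : 'D_1 phi x = 'D_1 (cst 0) x.
  apply: near_eq_derive; near=> y; apply: HM; near: y.
  have := @norm_continuous _ _ x; move/cvgr_gt; exact.
by rewrite derive_cst.
Unshelve. all: by end_near. Qed.

(** The fundamental lemma of the calculus of variations: testing against bumps
    that increase to the indicator of ]b, d[ gives vanishing integrals over all
    intervals, and Lebesgue's differentiation theorem concludes. *)
Lemma fundamental_lemma (h : R -> R) : locally_integrable setT h ->
  (forall phi, test_function phi -> \int[mu]_x (h x * phi x) = 0) ->
  {ae mu, forall x, h x = 0}.
Proof.
move=> lh H.
have mh : measurable_fun setT h by case: lh.
have ih b d : mu.-integrable `[b, d] (EFin \o h).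
  have [_ _ lK] := lh; apply/integrableP; split.
    by apply/measurable_EFinP; exact: measurable_funS mh.
  by apply: lK => //; exact: segment_compact.
have I0 b d : b < d -> \int[mu]_(x in `[b, d]) h x = 0.
  move=> bd.
  have i1 : intg (h \_ `[b, d]).
    have := ih b d; rewrite integrable_mkcond//; apply: eq_integrable => // x _.
    by rewrite /= restrict_EFin.
  have [|||||_ cv] := @Rint_dct R (fun n x => h x * bump n.+1%:R b d x) (fun x => h x * \1_(`]b, d[) x) (fun x => `|(h \_ `[b, d]) x|).
  - move=> n; apply: measurable_funM => //; apply: continuous_measurable_fun.
    by have [] := test_cc (bump_test b d (ltr0Sn R n)).
  - by apply: measurable_funM => //; exact: measurable_indic.
  - by apply: ae_all => x; apply: cvgM; [exact: cvg_cst|exact: bump_cvg].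
  - exact: intg_abs.
  - move=> n x; rewrite patchE; case: ifPn => xbd.
      by rewrite normrM ler_piMr// ger0_norm ?bump_ge0 ?bump_le1.
    rewrite bump_out ?mulr0 ?normr0// => /andP[bx xd].
    by move: xbd; rewrite notin_setE/= in_itv/= !ltW.
  have cz : \int[mu]_x (h x * bump n.+1%:R b d x) @[n --> \oo] --> 0.
    by apply: cvg_near_cst; apply: nearW => n; apply: H; exact: bump_test.
  have := cvg_unique (@Rhausdorff R) cv cz.
  rewrite -Rintegral_itv_obnd_cbnd; last first.
    by apply: integrableS (ih b d) => //; exact: subset_itv_oc_cc.
  rewrite -Rintegral_itv_bndo_bndc; last first.
    by apply: integrableS (ih b d) => //; exact: subset_itv_oo_cc.
  by move=> <-; rewrite Rintegral_mkcond; apply: eq_Rintegral => x _; rewrite patch_indic.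
have HN (N : nat) : {ae mu, forall x, - N%:R < x -> h x = 0}.
  have := @FTC1 R h (BLeft (- N%:R)) (fun y => ih _ y) lh.
  apply: ae_sub => x Hx Nx.
  have [|_ <-] := Hx; first by rewrite (@lte_fin R).
  rewrite derive1E.
  have -> : 'D_1 (fun x0 : R => \int[mu]_(t in `[- N%:R, x0]) h t) x = 'D_1 (cst 0) x.
    apply: near_eq_derive; near=> y; apply: I0; near: y.
    exact: lt_nbhsr.
  by rewrite derive_cst.
have := @ae_foralln _ _ _ mu (fun (N : nat) x => - N%:R < x -> h x = 0) HN.
apply: ae_sub => x Hx; apply: (Hx (Num.trunc `|x|).+1).
by rewrite ltrNl (le_lt_trans (ler_norm _))// normrN truncnS_gt.
Unshelve. all: by end_near. Qed.


Lemma test_supp (phi : R -> R) : test_function phi -> exists2 N : R, 0 < N &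
  forall x, ~ (- N < x < N) -> phi x = 0 /\ derive1 phi x = 0.
Proof.
move=> tphi; have [_ [M HM]] := tphi; have [_ [M' HM']] := test_deriv tphi.
have p : 0 < `|M| + `|M'| + 1 by rewrite ltr_pwDr// addr_ge0.
exists (`|M| + `|M'| + 1) => // x Hx.
have {}Hx : `|M| + `|M'| + 1 <= `|x| by rewrite leNgt; apply/negP; rewrite ltr_norml.
split; [apply: HM|apply: HM'].
- by rewrite (lt_le_trans _ Hx)// (le_lt_trans (ler_norm _))// -addrA ltrDl ltr_wpDl.
- by rewrite (lt_le_trans _ Hx)// (le_lt_trans (ler_norm _))// (addrC `|M|) -addrA ltrDl ltr_wpDl.
Qed.

Lemma test_is_derive (phi : R -> R) : test_function phi ->
  forall x : R, is_derive x (1 : R) phi (derive1 phi x).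
Proof. by move=> [dphi _] x; split; [exact: (dphi 0%N)|rewrite derive1E]. Qed.

Lemma test_ibp (G g phi : R -> R) : (forall x : R, is_derive x (1 : R) G (g x)) -> continuous g ->
  test_function phi -> \int[mu]_x (G x * derive1 phi x) = - \int[mu]_x (g x * phi x).
Proof.
move=> dG cg tphi; have [N N0 HN] := test_supp tphi.
have NN : - N < N by rewrite (lt_trans _ N0)// oppr_lt0.
have cphi' := (test_cc (test_deriv tphi)).1.
have weak x : ~ (- N <= x <= N) -> ~ (- N < x < N).
  by move=> H /andP[a b]; apply: H; rewrite !ltW.
rewrite (@Rint_supp _ _ (- N) N) => [|x /weak/HN[_ ->]]; last by rewrite mulr0.
rewrite (@Rint_supp _ _ (- N) N) => [|x /weak/HN[-> _]]; last by rewrite mulr0.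
rewrite (@Rintegration_by_parts _ G phi g (derive1 phi))//.
- have [-> _] : phi N = 0 /\ derive1 phi N = 0 by apply: HN; rewrite ltxx andbF.
  have [-> _] : phi (- N) = 0 /\ derive1 phi (- N) = 0 by apply: HN; rewrite ltxx.
  by rewrite !mulr0 subrr sub0r.
- exact: continuous_subspaceT.
- exact: LRcontinuous dG.
- by move=> x _; rewrite (is_derive1E dG).
- exact: continuous_subspaceT.
- exact: LRcontinuous (test_is_derive tphi).
Qed.

Lemma test_combination (phi psi : R -> R) (c : R) : test_function phi -> test_function psi ->
  test_function (fun x => phi x - c * psi x).
Proof.
move=> [sphi [M HM]] [spsi [M' HM']]; split.
  apply: (@smooth_family (fun f => exists g h, [/\ smooth g, smooth h & f = fun x => g x - c * h x])); last by exists phi, psi.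
  move=> f [g [h [sg sh ->]]].
  have d (x : R) : is_derive x (1 : R) (fun x => g x - c * h x) (derive1 g x - c * derive1 h x).
    have dg : is_derive x (1 : R) g (derive1 g x) by split; [exact: (sg 0%N)|rewrite derive1E].
    have dh : is_derive x (1 : R) h (derive1 h x) by split; [exact: (sh 0%N)|rewrite derive1E].
    by derive_ring.
  split=> [x|]; first by case: (d x).
  exists (derive1 g), (derive1 h); split; last exact: is_derive1E.
  - by move=> n x; have := sg n.+1 x; rewrite derive1Sn.
  - by move=> n x; have := sh n.+1 x; rewrite derive1Sn.
exists (Num.max M M') => x; rewrite gt_max => /andP[xM xM'].
by rewrite HM// HM'// mulr0 subrr.
Qed.

(** The primitive vanishing to the left of the support of psi vanishes to its
    right as well, since psi has integral 0. *)
Lemma test_antiderivative (psi : R -> R) : test_function psi -> \int[mu]_x psi x = 0 ->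
  exists2 phi, test_function phi & derive1 phi = psi.
Proof.
move=> tpsi psi0; have [N N0 HN] := test_supp tpsi; have cpsi := (test_cc tpsi).1.
have NN : - N < N by rewrite (lt_trans _ N0)// oppr_lt0.
pose phi x := prim psi x - prim psi (- N).
have dphi (x : R) : is_derive x (1 : R) phi (psi x).
  by have d := is_derive_prim cpsi x; apply: trigger_derive; rewrite subr0.
exists phi; last exact: is_derive1E.
split.
  case=> [|n] x; first by case: (dphi x).
  by rewrite derive1Sn (is_derive1E dphi); case: tpsi.
exists N => x; rewrite ltr_normr => /orP[Nx|]; last rewrite ltrNr => xN.
  have [c /andP[Nc _] E] := mvt Nx dphi.
  have [pc _] : psi c = 0 /\ derive1 psi c = 0 by apply: HN; rewrite [c < N]ltNge (ltW Nc) andbF.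
  have -> : phi x = phi N by apply/eqP; rewrite -subr_eq0 E pc mul0r.
  rewrite /phi -(FTC2 (ltW NN) (is_derive_prim cpsi) cpsi) -psi0; apply/esym/Rint_supp => y Hy.
  by have [] : psi y = 0 /\ derive1 psi y = 0 by apply: HN => /andP[? ?]; apply: Hy; rewrite !ltW.
have [c /andP[_ cN] E] := mvt xN dphi.
have [pc _] : psi c = 0 /\ derive1 psi c = 0 by apply: HN; rewrite [- N < c]ltNge (ltW cN).
by move: E; rewrite pc mul0r {1}/phi subrr sub0r => /eqP; rewrite oppr_eq0 => /eqP.
Qed.

End test_functions.

(** * Convolution with exp (- |x|) *)

Section helmholtz.
Context {R : realType}.
Notation mu := (@lebesgue_measure R).
Implicit Types b h : R -> R.
Local Notation setR := (set (g_sigma_algebraType R.-ocitv.-measurable)).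

Lemma seq_cvg_unique (u : nat -> R) (a b : R) : u n @[n --> \oo] --> a ->
  u n @[n --> \oo] --> b -> a = b.
Proof. by move=> A B; exact: (cvg_unique (@Rhausdorff R) A B). Qed.

Lemma restrict_intg (A : setR) h : measurable A ->
  mu.-integrable A (EFin \o h) <-> intg (h \_ A).
Proof.
move=> mA; rewrite integrable_mkcond//.
by split; apply: eq_integrable => // x _; rewrite /= restrict_EFin.
Qed.

Lemma Rint_exhaust h (A : setR) (A_ : nat -> setR) : measurable A ->
  (forall n, measurable (A_ n)) -> (forall n, A_ n `<=` A) ->
  (forall x, A x -> \forall n \near \oo, A_ n x) ->
  mu.-integrable A (EFin \o h) ->
  \int[mu]_(y in A_ n) h y @[n --> \oo] --> \int[mu]_(y in A) h y.
Proof.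
move=> mA mA_ sA cA hA; have hi := (restrict_intg h mA).1 hA.
have mh n : measurable_fun setT (h \_ (A_ n)).
  have := (restrict_intg h (mA_ n)).1 (integrableS mA (mA_ n) (sA n) hA).
  exact: intg_meas.
rewrite [X in _ --> X]Rintegral_mkcond.
under eq_fun do rewrite Rintegral_mkcond.
have [|||||_] // := @Rint_dct R (fun n => h \_ (A_ n)) (h \_ A) (fun x => `|(h \_ A) x|).
- exact: intg_meas.
- apply: ae_all => x; apply: cvg_near_cst; rewrite !patchE.
  case: ifPn => [/set_mem Ax|xA].
    by apply: filterS (cA x Ax) => n Anx; rewrite patchE mem_set.
  apply: nearW => n; rewrite patchE memNset// => /sA Ax.
  by move: xA; rewrite mem_set.
- exact: intg_abs.
- move=> n x; rewrite !patchE; case: ifPn => [/set_mem/sA Ax|_].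
    by rewrite mem_set.
  by rewrite normr0.
Qed.

Lemma cvg_itvNy h (x : R) : mu.-integrable `]-oo, x] (EFin \o h) ->
  \int[mu]_(y in `[x - n%:R, x]) h y @[n --> \oo] --> \int[mu]_(y in `]-oo, x]) h y.
Proof.
move=> hi; apply: Rint_exhaust => //.
- by move=> n y /=; rewrite !in_itv/= => /andP[].
- move=> y /=; rewrite in_itv/= => yx; exists (Num.trunc `|x - y|).+1 => // n /= Nn.
  rewrite in_itv/= yx andbT lerBlDr -lerBlDl (le_trans (ler_norm _))//.
  by rewrite (le_trans (ltW (truncnS_gt _)))// ler_nat.
Qed.

Lemma cvg_itvy h (x : R) : mu.-integrable `[x, +oo[ (EFin \o h) ->
  \int[mu]_(y in `[x, x + n%:R]) h y @[n --> \oo] --> \int[mu]_(y in `[x, +oo[) h y.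
Proof.
move=> hi; apply: Rint_exhaust => //.
- by move=> n y /=; rewrite !in_itv/= andbT => /andP[].
- move=> y /=; rewrite in_itv/= andbT => xy; exists (Num.trunc `|y - x|).+1 => // n /= Nn.
  rewrite in_itv/= xy/= -lerBlDl (le_trans (ler_norm _))//.
  by rewrite (le_trans (ltW (truncnS_gt _)))// ler_nat.
Qed.

Lemma expR_itvy (x : R) : (\int[mu]_(y in `[x, +oo[) (expR (- y))%:E = (expR (- x))%:E)%E.
Proof.
have dF (y : R) : is_derive y (1 : R) (fun y => - expR (- y)) (expR (- y)).
  by derive_ring.
rewrite (@ge0_continuous_FTC2y _ (fun y => expR (- y)) (fun y => - expR (- y)) x 0).
- by rewrite -EFinB sub0r opprK.
- by move=> y _; exact: expR_ge0.
- apply: continuous_subspaceT => y.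
  by apply: (continuous_comp (f := fun y : R => - y)); [exact: oppr_continuous|exact: continuous_expR].
- by rewrite -oppr0; apply: cvgN; exact: cvgr_expR.
- by move=> y _; case: (dF y).
- by apply: cvg_at_right_filter; exact: is_derive_continuous (dF x).
- by move=> y _; rewrite (is_derive1E dF).
Qed.

Lemma expR_itvNy (x : R) : (\int[mu]_(y in `]-oo, x]) (expR y)%:E = (expR x)%:E)%E.
Proof.
rewrite -{1}(opprK x) (@ge0_integration_by_substitutionNy _ (fun y => expR y)).
- by rewrite expR_itvy opprK.
- by apply: continuous_subspaceT => y; exact: continuous_expR.
- by move=> y _; exact: expR_ge0.
Qed.

Lemma intg_expR_itvy (x : R) : mu.-integrable `[x, +oo[ (EFin \o (fun y => expR (- y))).
Proof.
apply/integrableP; split.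
  apply/measurable_EFinP; apply: measurable_funTS; apply: continuous_measurable_fun => y.
  by apply: (continuous_comp (f := fun y : R => - y)); [exact: oppr_continuous|exact: continuous_expR].
under eq_integral do rewrite /= ger0_norm ?expR_ge0//.
by rewrite expR_itvy ltry.
Qed.

Lemma intg_expR_itvNy (x : R) : mu.-integrable `]-oo, x] (EFin \o (fun y => expR y)).
Proof.
apply/integrableP; split.
  apply/measurable_EFinP; apply: measurable_funTS; apply: continuous_measurable_fun => y.
  exact: continuous_expR.
under eq_integral do rewrite /= ger0_norm ?expR_ge0//.
by rewrite expR_itvNy ltry.
Qed.

Lemma intg_dom (A : setR) (h k : R -> R) (M : R) : measurable A -> mu.-integrable A (EFin \o k) ->
  measurable_fun A h -> (forall y, A y -> `|h y| <= M * k y) -> mu.-integrable A (EFin \o h) /\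
  `|\int[mu]_(y in A) h y| <= M * \int[mu]_(y in A) k y.
Proof.
move=> mA ki mh hk.
have Mk : mu.-integrable A (EFin \o (fun y => M * k y)).
  by have := integrableZl mA M ki; apply: eq_integrable.
have hi : mu.-integrable A (EFin \o h).
  apply: le_integrable Mk => //; first exact/measurable_EFinP.
  by move=> y Ay /=; rewrite lee_fin (le_trans (hk y Ay))// ler_norm.
split=> //; apply: le_trans (le_normr_Rintegral mA hi) _.
rewrite -RintegralZl//; apply: le_Rintegral => //.
exact: integrable_norm.
Qed.

(** Convolutions with the two halves of exp (- |x|). They solve L' = b - L and
    R' = R - b, so that all their derivatives are expressed by L, R and b. *)
Definition lconv b (x : R) : R := expR (- x) * \int[mu]_(y in `]-oo, x]) (expR y * b y).
Definition rconv b (x : R) : R := expR x * \int[mu]_(y in `[x, +oo[) (expR (- y) * b y).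

Section bounded.
Variables (b : R -> R) (M : R).
Hypotheses (mb : measurable_fun setT b) (bM : forall x, `|b x| <= M).

Lemma lconv_intg (x : R) : mu.-integrable `]-oo, x] (EFin \o (fun y => expR y * b y)) /\
  `|\int[mu]_(y in `]-oo, x]) (expR y * b y)| <= M * expR x.
Proof.
have [|||i le] := @intg_dom `]-oo, x] (fun y => expR y * b y) (fun y => expR y) M _ (intg_expR_itvNy x) _ _ => //.
- by apply: measurable_funTS; apply: measurable_funM => //; apply: continuous_measurable_fun; exact: continuous_expR.
- by move=> y _; rewrite normrM (ger0_norm (expR_ge0 _)) mulrC ler_wpM2r ?expR_ge0.
by split=> //; apply: le_trans le _; rewrite /Rintegral expR_itvNy.
Qed.

Lemma rconv_intg (x : R) : mu.-integrable `[x, +oo[ (EFin \o (fun y => expR (- y) * b y)) /\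
  `|\int[mu]_(y in `[x, +oo[) (expR (- y) * b y)| <= M * expR (- x).
Proof.
have [|||i le] := @intg_dom `[x, +oo[ (fun y => expR (- y) * b y) (fun y => expR (- y)) M _ (intg_expR_itvy x) _ _ => //.
- apply: measurable_funTS; apply: measurable_funM => //; apply: continuous_measurable_fun => y.
  by apply: (continuous_comp (f := fun y : R => - y)); [exact: oppr_continuous|exact: continuous_expR].
- by move=> y _; rewrite normrM (ger0_norm (expR_ge0 _)) mulrC ler_wpM2r ?expR_ge0.
by split=> //; apply: le_trans le _; rewrite /Rintegral expR_itvy.
Qed.

Lemma lconv_bound x : `|lconv b x| <= M.
Proof.
have [_ le] := lconv_intg x.
rewrite /lconv normrM (ger0_norm (expR_ge0 _)).
rewrite -[leRHS]mul1r -(expRxMexpNx_1 x) -mulrA (mulrC (expR x)) -mulrA.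
rewrite ler_wpM2l ?expR_ge0//.
Qed.

Lemma rconv_bound x : `|rconv b x| <= M.
Proof.
have [_ le] := rconv_intg x.
rewrite /rconv normrM (ger0_norm (expR_ge0 _)).
rewrite -[leRHS]mul1r -(expRxMexpNx_1 x) -mulrA (mulrC (expR (- x))).
by rewrite ler_wpM2l ?expR_ge0.
Qed.

Hypothesis cb : continuous b.

Let ceb (y : R) : {for y, continuous (fun y => expR y * b y)}.
Proof. by apply: cvgM; [exact: continuous_expR|exact: cb]. Qed.

Let ceNb (y : R) : {for y, continuous (fun y => expR (- y) * b y)}.
Proof.
apply: cvgM; last exact: cb.
by apply: (continuous_comp (f := fun y : R => - y)); [exact: oppr_continuous|exact: continuous_expR].
Qed.

Lemma is_derive_lconv (x : R) : is_derive x (1 : R) (lconv b) (b x - lconv b x).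
Proof.
have x1 : x < x + 1 by rewrite ltrDl.
have [dF Fx] := @continuous_FTC1 R _ -oo%O x (x + 1) x1 (lconv_intg _).1 (ltNyr x) (@ceb x).
have d1 : is_derive x (1 : R) (fun x : R => \int[mu]_(y in `]-oo, x]) (expR y * b y)) (expR x * b x).
  by split; [exact: dF|rewrite -derive1E].
rewrite /lconv; apply: trigger_derive; rewrite /GRing.scale/= mulrA mulrA.
rewrite (mulrC (expR (- x)) (expR x)) expRxMexpNx_1; ring.
Qed.

Lemma is_derive_rconv (x : R) : is_derive x (1 : R) (rconv b) (rconv b x - b x).
Proof.
have x1 : x < x + 1 by rewrite ltrDl.
have Nx : x - 1 < x by rewrite ltrBlDr ltrDl.
have [dF Fx] := @continuous_FTC1_closed R _ (x - 1) x (x + 1) x1 (itv_intg _ _ (@ceNb)) Nx (@ceNb x).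
have d1 : is_derive x (1 : R) (fun x' : R => \int[mu]_(y in `[x - 1, x']) (expR (- y) * b y)) (expR (- x) * b x).
  by split; [exact: dF|rewrite -derive1E].
have d2 : is_derive x (1 : R) (fun x : R => \int[mu]_(y in `[x, +oo[) (expR (- y) * b y)) (- (expR (- x) * b x)).
  have : is_derive x (1 : R) (fun x' : R => \int[mu]_(y in `[x - 1, +oo[) (expR (- y) * b y) - \int[mu]_(y in `[x - 1, x']) (expR (- y) * b y)) (- (expR (- x) * b x)).
    by rewrite -[X in is_derive _ _ _ X]sub0r; exact: is_deriveB.
  apply: near_eq_is_derive; near=> z.
  rewrite (@Rintegral_itvB _ _ (BLeft (x - 1)) +oo%O z).
  + rewrite Rintegral_itv_obnd_cbnd//; apply: integrableS (rconv_intg z).1 => //.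
    by move=> y /=; rewrite !in_itv/= !andbT => /ltW.
  + exact: (rconv_intg _).1.
  + by rewrite bnd_simp ltW//; near: z; exact: lt_nbhsr.
  + by [].
rewrite /rconv; apply: trigger_derive; rewrite /GRing.scale/= mulrN mulrA expRxMexpNx_1; ring.
Unshelve. all: by end_near. Qed.

End bounded.

Lemma lconvB b1 b2 M x : measurable_fun setT b1 -> measurable_fun setT b2 ->
  (forall x, `|b1 x| <= M) -> (forall x, `|b2 x| <= M) ->
  lconv b1 x - lconv b2 x = lconv (fun y => b1 y - b2 y) x.
Proof.
move=> m1 m2 M1 M2; rewrite /lconv -mulrBr; congr (_ * _).
rewrite -RintegralB//; [|exact: (lconv_intg m1 M1 x).1|exact: (lconv_intg m2 M2 x).1].
by apply: eq_Rintegral => y _; rewrite mulrBr.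
Qed.

Lemma rconvB b1 b2 M x : measurable_fun setT b1 -> measurable_fun setT b2 ->
  (forall x, `|b1 x| <= M) -> (forall x, `|b2 x| <= M) ->
  rconv b1 x - rconv b2 x = rconv (fun y => b1 y - b2 y) x.
Proof.
move=> m1 m2 M1 M2; rewrite /rconv -mulrBr; congr (_ * _).
rewrite -RintegralB//; [|exact: (rconv_intg m1 M1 x).1|exact: (rconv_intg m2 M2 x).1].
by apply: eq_Rintegral => y _; rewrite mulrBr.
Qed.

(** If w is an integrable density of the bounded continuous b, then convolving w
    with exp (- |x|) / 2 and integrating by parts moves the derivative onto the
    kernel. *)
Lemma inv_helmholtz_density b w (M : R) : continuous b -> (forall x, `|b x| <= M) -> intg w ->
  (forall (psi dpsi : R -> R) (c d : R), c <= d -> (forall x : R, is_derive x (1 : R) psi (dpsi x)) ->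
     continuous dpsi -> \int[mu]_(y in `[c, d]) (psi y * w y) =
     psi d * b d - psi c * b c - \int[mu]_(y in `[c, d]) (dpsi y * b y)) ->
  forall x, inv_helmholtz w x = 2^-1 * (rconv b x - lconv b x).
Proof.
move=> cb bM wi ibp x; rewrite /inv_helmholtz; congr (_ * _).
have mb : measurable_fun setT b by exact: continuous_measurable_fun.
have ce : continuous (fun y : R => expR y) by exact: continuous_expR.
have ceN : continuous (fun y : R => expR (- y)).
  by move=> y; apply: (continuous_comp (f := fun y : R => - y)); [exact: oppr_continuous|exact: continuous_expR].
have ceNN : continuous (fun y : R => - expR (- y)) by move=> y; apply: cvgN; exact: ceN.
have wA (A : set R) : measurable A -> mu.-integrable A (EFin \o w) by move=> mA; exact: integrableS wi.
have mw : measurable_fun setT w by exact: intg_meas.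
have dom (A : set R) (k : R -> R) C : measurable A -> continuous k -> (forall y, A y -> `|k y| <= C) ->
    mu.-integrable A (EFin \o (fun y => k y * w y)).
  move=> mA ck kC; have [|||//] := @intg_dom A (fun y => k y * w y) (fun y => `|w y|) C mA _ _ _.
  - by apply: integrable_norm; exact: wA.
  - by apply: measurable_funTS; apply: measurable_funM => //; exact: continuous_measurable_fun.
  - by move=> y Ay; rewrite normrM ler_wpM2r// kC.
have iL : mu.-integrable `]-oo, x] (EFin \o (fun y => expR y * w y)).
  apply: (dom _ _ (expR x)) => // y; rewrite /= in_itv/= => yx.
  by rewrite ger0_norm ?expR_ge0// ler_expR.
have iR : mu.-integrable `[x, +oo[ (EFin \o (fun y => expR (- y) * w y)).
  apply: (dom _ _ (expR (- x))) => // y; rewrite /= in_itv/= andbT => xy.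
  by rewrite ger0_norm ?expR_ge0// ler_expR lerN2.
have dE (y : R) : is_derive y (1 : R) (fun y : R => expR y) (expR y) by exact: is_derive_expR.
have dEN (y : R) : is_derive y (1 : R) (fun y : R => expR (- y)) (- expR (- y)).
  by derive_ring.
have nle (n : nat) : x - n%:R <= x by rewrite lerBlDr lerDl.
have nge (n : nat) : x <= x + n%:R by rewrite lerDl.
have cexpn : expR (- (n%:R : R)) @[n --> \oo] --> (0 : R).
  by have := cvg_comp _ _ (@cvgr_idn R) (@cvgr_expR R).
have EL : \int[mu]_(y in `]-oo, x]) (expR y * w y) =
    expR x * b x - \int[mu]_(y in `]-oo, x]) (expR y * b y).
  have A := cvg_itvNy iL; have B := cvg_itvNy (lconv_intg mb bM x).1.
  suff A' : \int[mu]_(y in `[x - n%:R, x]) (expR y * w y) @[n --> \oo] -->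
      expR x * b x - \int[mu]_(y in `]-oo, x]) (expR y * b y).
    exact: seq_cvg_unique A A'.
  have E n : \int[mu]_(y in `[x - n%:R, x]) (expR y * w y) =
     expR x * b x - expR (x - n%:R) * b (x - n%:R) - \int[mu]_(y in `[x - n%:R, x]) (expR y * b y).
    exact: ibp (nle _) dE ce.
  under eq_fun do rewrite E.
  apply: cvgB => //; rewrite -[X in _ --> X]subr0; apply: cvgB; first exact: cvg_cst.
  apply: norm_cvg0; apply: (@squeeze_cvgr _ _ _ _ (cst 0) (fun n => expR (- n%:R) * (expR x * M))).
  - apply: nearW => n; rewrite normr_ge0/= normrM (ger0_norm (expR_ge0 _)) (addrC x) expRD -mulrA.
    by rewrite ler_wpM2l ?expR_ge0// ler_wpM2l ?expR_ge0.
  - exact: cvg_cst.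
  - by rewrite -(mul0r (expR x * M)); apply: cvgM; [exact: cexpn|exact: cvg_cst].
have ER : \int[mu]_(y in `[x, +oo[) (expR (- y) * w y) =
    - (expR (- x) * b x) + \int[mu]_(y in `[x, +oo[) (expR (- y) * b y).
  have A := cvg_itvy iR; have B := cvg_itvy (rconv_intg mb bM x).1.
  suff A' : \int[mu]_(y in `[x, x + n%:R]) (expR (- y) * w y) @[n --> \oo] -->
      - (expR (- x) * b x) + \int[mu]_(y in `[x, +oo[) (expR (- y) * b y).
    exact: seq_cvg_unique A A'.
  have E n : \int[mu]_(y in `[x, x + n%:R]) (expR (- y) * w y) =
     expR (- (x + n%:R)) * b (x + n%:R) - expR (- x) * b x + \int[mu]_(y in `[x, x + n%:R]) (expR (- y) * b y).
    rewrite (ibp _ _ _ _ (nge _) dEN ceNN); congr (_ + _).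
    rewrite -mulN1r -RintegralZl//; last first.
      apply: itv_intg => y; apply: cvgM; [exact: ceNN|exact: cb].
    by apply: eq_Rintegral => y _; rewrite mulN1r mulNr opprK.
  under eq_fun do rewrite E.
  apply: cvgD => //; rewrite -[X in _ --> X]add0r; apply: cvgB; last exact: cvg_cst.
  apply: norm_cvg0; apply: (@squeeze_cvgr _ _ _ _ (cst 0) (fun n => expR (- n%:R) * (expR (- x) * M))).
  - apply: nearW => n; rewrite normr_ge0/= normrM (ger0_norm (expR_ge0 _)) opprD (addrC (- x)) expRD -mulrA.
    by rewrite ler_wpM2l ?expR_ge0// ler_wpM2l ?expR_ge0.
  - exact: cvg_cst.
  - by rewrite -(mul0r (expR (- x) * M)); apply: cvgM; [exact: cexpn|exact: cvg_cst].
have kabs (y : R) : `|expR (- `|x - y|)| <= 1.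
  by rewrite ger0_norm ?expR_ge0// -expR0 ler_expR lerNl oppr0.
have ck : continuous (fun y : R => expR (- `|x - y|)).
  move=> y; apply: (continuous_comp (f := fun y => - `|x - y|)); last exact: continuous_expR.
  apply: cvgN; apply: (continuous_comp (f := fun y => x - y)); last exact: norm_continuous.
  by apply: cvgB => //; exact: cvg_cst.
have iT : intg (fun y => expR (- `|x - y|) * w y) by apply: (dom setT _ 1).
have split2 : [set: R] = `]-oo, x] `|` `]x, +oo[.
  by apply/seteqP; split => y //= _; rewrite !in_itv/= andbT; case: leP; [left|right].
rewrite split2 Rintegral_setU//; first last.
- apply/disj_setPS => y [/=]; rewrite !in_itv/= andbT => yx xy.
  by move: xy; rewrite ltNge yx.
- by rewrite -split2.
have -> : \int[mu]_(y in `]-oo, x]) (expR (- `|x - y|) * w y) = expR (- x) * \int[mu]_(y in `]-oo, x]) (expR y * w y).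
  rewrite -RintegralZl//; apply: eq_Rintegral => y; rewrite inE/= in_itv/= => yx.
  by rewrite ger0_norm ?subr_ge0// opprB addrC expRD mulrA.
have -> : \int[mu]_(y in `]x, +oo[) (expR (- `|x - y|) * w y) = expR x * \int[mu]_(y in `[x, +oo[) (expR (- y) * w y).
  rewrite -RintegralZl// Rintegral_itv_obnd_cbnd; last by apply: integrableS iT.
  apply: eq_Rintegral => y; rewrite inE/= in_itv/= andbT => xy.
  by rewrite ler0_norm ?subr_le0// opprK expRD mulrA.
rewrite EL ER /lconv /rconv !mulrDr !mulrN !mulrA expRxMexpNx_1.
by rewrite (mulrC (expR (- x)) (expR x)) expRxMexpNx_1; ring.
Qed.

End helmholtz.

(** * Local integrability and vanishing weak derivatives *)

Section local_integrability.
Context {R : realType}.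
Notation mu := (@lebesgue_measure R).
Implicit Types f g h : R -> R.

Lemma Rint_ae_eq f g : measurable_fun setT f -> measurable_fun setT g ->
  {ae mu, forall x, f x = g x} -> \int[mu]_x f x = \int[mu]_x g x.
Proof.
move=> mf mg fg; rewrite /Rintegral; congr fine; apply: ae_eq_integral => //.
- exact/measurable_EFinP.
- exact/measurable_EFinP.
- by apply: ae_sub fg => x ->.
Qed.

Lemma ae_continuous0 (U : set R) f : open U -> (forall x, U x -> {for x, continuous f}) ->
  {ae mu, forall x, U x -> f x = 0} -> forall x, U x -> f x = 0.
Proof.
move=> oU cf [N [mN N0 sN]] x Ux; apply: contrapT => /eqP fx.
have fx0 : 0 < `|f x| by rewrite normr_gt0.
have /cvgrPdist_lt/(_ _ fx0) near_f := cf x Ux.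
have nU : nbhs x U by exact: open_nbhs_nbhs.
have /nbhs_ballP[d /= d0 Hd] : nbhs x ((fun y => `|f x - f y| < `|f x|) `&` U) by exact: filterI.
have bN : ball x d `<=` N.
  move=> y /Hd[/= fy Uy]; apply: sN => /= /(_ Uy) fy0.
  by move: fy; rewrite fy0 subr0 ltxx.
have : (mu (ball x d) <= mu N)%E by apply: le_measure; rewrite ?inE//; exact: measurable_ball.
by rewrite N0 (lebesgue_measure_ball x (ltW d0)) lee_fin leNgt pmulrn_lgt0// d0.
Qed.

Lemma continuous_sqr f : continuous f -> continuous (fun x => f x ^+ 2).
Proof.
move=> cf x; apply: (@continuous_comp _ _ _ f (fun y => y ^+ 2)); first exact: cf.
exact: exprn_continuous.
Qed.

Lemma loc_intgP h : measurable_fun setT h -> (forall n, intg (trunc n h)) ->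
  locally_integrable setT h.
Proof.
move=> mh H; split=> //; first exact: openT.
move=> K _ cK; have [M [_ HM]] := compact_bounded cK.
pose n := (Num.trunc (`|M| + 1)).+1.
have mK : measurable (K : set (g_sigma_algebraType R.-ocitv.-measurable)) by exact: compact_measurable.
have /integrableP[_] := integrableS measurableT mK (@subsetT _ K) (H n).
apply: le_lt_trans; rewrite le_eqVlt; apply/orP; left; apply/eqP.
apply: eq_integral => x /set_mem Kx /=; rewrite trunc_id//.
have M1 : M < `|M| + 1 by rewrite (le_lt_trans (ler_norm _))// ltrDl.
by apply: le_trans (HM _ M1 x Kx) _; apply: ltW; exact: truncnS_gt.
Qed.

Lemma loc_intg_trunc h n : locally_integrable setT h -> intg (trunc n h).
Proof.
move=> [mh _ lK]; have := (@restrict_intg R `[- n%:R, n%:R] h _).1.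
rewrite (_ : h \_ `[- n%:R, n%:R] = trunc n h); last by apply/funext => x; rewrite /trunc patch_indic.
apply=> //; apply/integrableP; split.
  by apply/measurable_EFinP; exact: measurable_funS mh.
by apply: lK => //; exact: segment_compact.
Qed.

Lemma continuous_loc_intg h : continuous h -> locally_integrable setT h.
Proof.
move=> ch; apply: loc_intgP => [|n]; first exact: continuous_measurable_fun.
have := (@restrict_intg R `[- n%:R, n%:R] h _).1.
rewrite (_ : h \_ `[- n%:R, n%:R] = trunc n h); last by apply/funext => x; rewrite /trunc patch_indic.
by apply=> //; exact: itv_intg.
Qed.

Lemma L2_loc_intg h : h \in Lfun mu 2%:E -> locally_integrable setT h.
Proof. by move=> hL; apply: loc_intgP => [|n]; [exact: L2_meas|exact: trunc_intg]. Qed.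

Lemma intg_loc_intg h : intg h -> locally_integrable setT h.
Proof.
move=> hi; apply: loc_intgP => [|n]; first exact: intg_meas.
apply: (intg_le _ hi (trunc_le n h)); apply: meas_trunc; exact: intg_meas.
Qed.

Lemma loc_intg_cc h phi : locally_integrable setT h -> cc phi -> intg (fun x => h x * phi x).
Proof.
move=> lh cphi; have [N HN] := cc_trunc cphi; have [M HM] := cc_bounded cphi.
have := intg_bM (M := M) (loc_intg_trunc N lh) (continuous_measurable_fun cphi.1) HM.
rewrite (_ : (fun x => trunc N h x * phi x) = (fun x => h x * phi x))//.
by apply/funext => x; rewrite -{2}(HN N (leqnn N)) /trunc mulrAC mulrA.
Qed.

Lemma cc_continuousM h phi : continuous h -> cc phi -> cc (fun x => h x * phi x).
Proof.
move=> ch [cphi [M HM]]; split; first by move=> x; apply: cvgM; [exact: ch|exact: cphi].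
by exists M => x /HM ->; rewrite mulr0.
Qed.

Lemma loc_intg_ae f g : locally_integrable setT f -> locally_integrable setT g ->
  (forall phi, test_function phi -> \int[mu]_x (f x * phi x) = \int[mu]_x (g x * phi x)) ->
  {ae mu, forall x, f x = g x}.
Proof.
move=> lf lg H; have : {ae mu, forall x, (f \- g) x = 0}.
  apply: fundamental_lemma => [|phi tphi]; first exact: locally_integrableB.
  have cphi := test_cc tphi.
  under eq_Rintegral do rewrite mulrBl.
  by rewrite RintegralB ?H ?subrr//; exact: loc_intg_cc.
by apply: ae_sub => x /= /eqP; rewrite subr_eq0 => /eqP.
Qed.

(** Du Bois-Reymond's lemma: a test function with integral 0 is the derivative of
    a test function, so that W integrates against every test function like a
    constant. *)
Lemma weak_deriv0_cst (W : R -> R) : continuous W ->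
  (forall phi, test_function phi -> \int[mu]_x (W x * derive1 phi x) = 0) ->
  forall a b, W a = W b.
Proof.
move=> cW HW; pose eta : R -> R := bump 1 0 1.
have teta : test_function eta by exact: bump_test.
have ceta := test_cc teta; pose m := \int[mu]_x eta x.
have m0 : 0 < m.
  rewrite /m (@Rint_supp _ _ 0 1) => [|x Hx]; last first.
    by apply: bump_out => // /andP[p q]; apply: Hx; rewrite !ltW.
  rewrite (FTC2 ler01 (is_derive_prim ceta.1) ceta.1).
  have [x /andP[x0 x1] ->] := mvt ltr01 (is_derive_prim ceta.1).
  by rewrite subr0 mulr1 mulr_gt0// flat_gt0 ?mul1r ?subr0 ?subr_gt0.
pose k := \int[mu]_x (W x * eta x) / m.
have ic phi : cc phi -> intg (fun x => W x * phi x) by move=> cphi; exact: (cc_intg (cc_continuousM cW cphi)).1.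
have cWk : continuous (fun x => W x - k) by move=> x; apply: cvgB; [exact: cW|exact: cvg_cst].
have : {ae mu, forall x, W x - k = 0}.
  apply: fundamental_lemma => [|phi tphi]; first exact: continuous_loc_intg.
  have cphi := test_cc tphi; pose j := \int[mu]_x phi x / m.
  have tpsi := test_combination j tphi teta.
  have psi0 : \int[mu]_x (phi x - j * eta x) = 0.
    rewrite RintegralB// ?RintegralZl//; try exact: (cc_intg _).1.
      by rewrite -/m /j divfK ?subrr// gt_eqF.
    by apply: intgZ; exact: (cc_intg ceta).1.
  have [chi tchi chiE] := test_antiderivative tpsi psi0.
  have := HW chi tchi; rewrite chiE.
  under eq_Rintegral do rewrite mulrBr mulrCA.
  rewrite RintegralB ?RintegralZl//; try exact: ic; last by apply: intgZ; exact: ic.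
  move=> H; under eq_Rintegral do rewrite mulrBl.
  rewrite RintegralB ?RintegralZl//; try exact: ic; try exact: (cc_intg _).1; last by apply: intgZ; exact: (cc_intg cphi).1.
  by rewrite -H /k /j; congr (_ - _); ring.
move=> ae0 a b; have E x : W x - k = 0.
  by apply: (@ae_continuous0 setT (fun x => W x - k)) => //; [exact: openT|move=> y _; exact: cWk|exact: ae_sub ae0].
by apply: (@addIr _ (- k)); rewrite !E.
Qed.

End local_integrability.

(** * The square of an H^s function *)

Section h1.
Context {R : realType}.
Notation mu := (@lebesgue_measure R).
Variables (s : R) (f : R -> R).
Hypotheses (s1 : 1 <= s) (sf : sobolev s f).

Let cf : continuous (crep f) := continuous_crep s1 sf.
Let mf : measurable_fun setT (crep f) := continuous_measurable_fun cf.

Lemma crep_ae : {ae mu, forall x, f x = crep f x}.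
Proof.
apply: loc_intg_ae; [exact: L2_loc_intg sf.1|exact: continuous_loc_intg|].
by move=> phi /test_cc cphi; exact: crep_pair s1 sf cphi.
Qed.

Lemma crep_L2 : crep f \in Lfun mu 2%:E.
Proof.
have [mf0 /integrableP[_ i]] := (L2P f).1 sf.1.
apply/L2P; split=> //; apply/integrableP; split.
  by apply/measurable_EFinP; exact: measurable_funX.
apply: le_lt_trans i; rewrite le_eqVlt; apply/orP; left; apply/eqP.
apply: ae_eq_integral => //.
- apply: measurableT_comp => //; apply/measurable_EFinP; exact: measurable_funX.
- apply: measurableT_comp => //; apply/measurable_EFinP; exact: measurable_funX.
- by apply: ae_sub crep_ae => x /= ->.
Qed.

(** The square of the continuous representative is absolutely continuous with
    density w = 2 f f': integrate the product rule for the smooth approximations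
    over [c, d] and pass to the limit, uniformly in the functions and weakly in
    L^2 in their derivatives. *)
Lemma crep_sq_density : exists2 w : R -> R, intg w &
  forall (psi dpsi : R -> R) (c d : R), c <= d -> (forall x : R, is_derive x (1 : R) psi (dpsi x)) ->
     continuous dpsi -> \int[mu]_(y in `[c, d]) (psi y * w y) =
     psi d * crep f d ^+ 2 - psi c * crep f c ^+ 2 -
     \int[mu]_(y in `[c, d]) (dpsi y * crep f y ^+ 2).
Proof.
have [fN [dN [g [eps [dfN cLdN [eps0 Heps] gL dNg]]]]] := crep_approx s1 sf.
have fL := crep_L2.
have wi : intg (fun x => 2 * (crep f x * g x)) by apply: intgZ; exact: L2_mul.
exists (fun x => 2 * (crep f x * g x)) => // psi dpsi c d cd dpsiE cdpsi.
have cpsi : continuous psi by move=> x; exact: is_derive_continuous (dpsiE x).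
have cfN n : continuous (fN n) by move=> x; exact: is_derive_continuous (dfN n x).
have cI (h : R -> R) : continuous h -> h \_ `[c, d] \in Lfun mu 2%:E /\ intg (h \_ `[c, d]).
  move=> ch; split; last first.
    by have := (@restrict_intg R `[c, d] h _).1; apply=> //; exact: itv_intg.
  have i2 : intg ((fun x => h x ^+ 2) \_ `[c, d]).
    have := (@restrict_intg R `[c, d] (fun x => h x ^+ 2) _).1.
    by apply=> //; apply: itv_intg; exact: continuous_sqr.
  apply/L2P; split.
    by apply/measurable_restrict => //; apply: measurable_funS (continuous_measurable_fun ch).
  apply: eq_integrable i2 => // x _ /=; rewrite !patchE; case: ifP => //.
  by rewrite expr0n.
have pN n : \int[mu]_(x in `[c, d]) (dpsi x * fN n x ^+ 2 + 2 * psi x * (fN n x * dN n x)) =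
    psi d * fN n d ^+ 2 - psi c * fN n c ^+ 2.
  apply: (FTC2 (F := fun x => psi x * fN n x ^+ 2)) => //.
    move=> x; have d1 := dfN n x; have d2 := dpsiE x.
    by derive_ring.
  have [cdN _] := cLdN n.
  move=> x; apply: cvgD; apply: cvgM; first exact: cdpsi.
  - exact: (continuous_sqr (cfN n)).
  - by apply: cvgM; [exact: cvg_cst|exact: cpsi].
  - by apply: cvgM; [exact: cfN|exact: cdN].
have cfNx x : fN n x @[n --> \oo] --> crep f x.
  apply/subr_cvg0; apply: norm_cvg0; apply: (@squeeze_cvgr _ _ _ _ (cst 0) eps) => //.
  - by apply: nearW => n; rewrite normr_ge0 Heps.
  - exact: cvg_cst.
have cb x (a : R) : a * fN n x ^+ 2 @[n --> \oo] --> a * crep f x ^+ 2.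
  by apply: cvgM; [exact: cvg_cst|rewrite expr2; under eq_fun do rewrite expr2; apply: cvgM].
have [E HE] : exists E : R, forall n, eps n <= E.
  have /cvg_seq_bounded[B [_ HB]] : cvgn eps by apply/cvg_ex; exists 0.
  exists (B + 1) => n; apply: le_trans (ler_norm _) (HB (B + 1) _ n I).
  by rewrite ltrDl.
pose k := (fun x => 2 * psi x) \_ `[c, d].
have [kL ki] : k \in Lfun mu 2%:E /\ intg k.
  by apply: cI => x; apply: cvgM; [exact: cvg_cst|exact: cpsi].
have kfL (h : R -> R) : continuous h -> (fun x => h x * k x) \in Lfun mu 2%:E.
  move=> ch; have [] := cI (fun x => h x * (2 * psi x)).
    by move=> x; apply: cvgM; [exact: ch|apply: cvgM; [exact: cvg_cst|exact: cpsi]].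
  rewrite (_ : _ \_ _ = fun x => h x * k x)//.
  by apply/funext => x; rewrite /k !patchE; case: ifP => //; rewrite mulr0.
have lim1 : \int[mu]_(x in `[c, d]) (dpsi x * fN n x ^+ 2) @[n --> \oo] -->
    \int[mu]_(x in `[c, d]) (dpsi x * crep f x ^+ 2).
  have crepM x : `|crep f x| <= embed_const * fine (sobolev_norm s f) by exact: crep_bound.
  set M := embed_const * _ in crepM.
  have [_ di] := cI _ cdpsi.
  have fM n x : fN n x ^+ 2 <= (E + M) ^+ 2.
    rewrite -real_normK ?num_real// lerXn2r ?nnegrE//.
      by rewrite addr_ge0// ?(le_trans (normr_ge0 _) (crepM 0))// (le_trans _ (HE 0%N))// (le_trans _ (Heps 0%N 0)).
    rewrite -[fN n x](subrK (crep f x)) (le_trans (ler_normD _ _))// lerD//.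
    exact: le_trans (Heps _ _) (HE _).
  rewrite Rintegral_mkcond; under eq_fun do rewrite Rintegral_mkcond.
  have mr (h : R -> R) : continuous h -> measurable_fun setT ((fun x => dpsi x * h x ^+ 2) \_ `[c, d]).
    move=> ch; apply/measurable_restrict => //; apply: measurable_funTS.
    by apply: measurable_funM; [exact: continuous_measurable_fun|apply: measurable_funX; exact: continuous_measurable_fun].
  have [|||||_] // := @Rint_dct R (fun n => (fun x => dpsi x * fN n x ^+ 2) \_ `[c, d])
     ((fun x => dpsi x * crep f x ^+ 2) \_ `[c, d]) (fun x => (E + M) ^+ 2 * `|(dpsi \_ `[c, d]) x|).
  - by move=> n; exact: mr.
  - exact: mr.
  - apply: ae_all => x; under eq_fun do rewrite patchE; rewrite patchE; case: ifP => _; first exact: cb.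
    exact: cvg_cst.
  - by apply: intgZ; exact: intg_abs.
  - move=> n x; rewrite !patchE; case: ifP => _; last by rewrite !normr0 mulr0.
    by rewrite normrM mulrC ler_wpM2r// ger0_norm ?sqr_ge0.
have lim2 : \int[mu]_(x in `[c, d]) (2 * psi x * (fN n x * dN n x)) @[n --> \oo] -->
    \int[mu]_(x in `[c, d]) (psi x * (2 * (crep f x * g x))).
  have -> : \int[mu]_(x in `[c, d]) (psi x * (2 * (crep f x * g x))) = \int[mu]_x (g x * (crep f x * k x)).
    rewrite Rintegral_mkcond; apply: eq_Rintegral => x _; rewrite /k !patchE; case: ifP => _; first by ring.
    by rewrite !mulr0.
  have E2 n : \int[mu]_(x in `[c, d]) (2 * psi x * (fN n x * dN n x)) =
      \int[mu]_x (dN n x * ((fN n x - crep f x) * k x)) + \int[mu]_x (dN n x * (crep f x * k x)).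
    rewrite -RintegralD//; first last.
    - by apply: L2_mul; [exact: (cLdN n).2|exact: kfL].
    - apply: L2_mul; [exact: (cLdN n).2|apply: (kfL (fun x => fN n x - crep f x))].
      by move=> x; apply: cvgB; [exact: cfN|exact: cf].
    rewrite Rintegral_mkcond; apply: eq_Rintegral => x _; rewrite /k !patchE; case: ifP => _; first by ring.
    by rewrite !mulr0 addr0.
  under eq_fun do rewrite E2.
  have z0 (z : R) : z = 0 + z by rewrite add0r.
  rewrite [X in nbhs X](z0 (\int[mu]_x (g x * (crep f x * k x)))); apply: cvgD; last first.
    by apply: L2_cvg_pair => // [n|]; [exact: (cLdN n).2|exact: kfL].
  have sN n : sq (dN n) <= 2 * sq (fun x => dN n x - g x) + 2 * sq g.
    have := sqB_le (L2B (cLdN n).2 gL) (L2N gL).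
    have -> : sq (fun x => dN n x - g x - - g x) = sq (dN n).
      by apply: eq_Rintegral => x _; rewrite opprK subrK.
    by have -> : sq (fun x => - g x) = sq g by apply: eq_Rintegral => x _; rewrite sqrrN.
  apply: norm_cvg0; apply: (@squeeze_cvgr _ _ _ _ (cst 0)
    (fun n => eps n * (Num.sqrt (2 * sq (fun x => dN n x - g x) + 2 * sq g) * Num.sqrt (sq k)))).
  - apply: nearW => n; rewrite normr_ge0/=.
    have ie : intg (fun x => eps n * `|dN n x * k x|) by apply: intgZ; apply: intg_abs; exact: L2_mul (cLdN n).2 kL.
    apply: le_trans (Rint_norm_le _ ie _) _.
    + apply: measurable_funM; first exact: L2_meas (cLdN n).2.
      by apply: measurable_funM; [apply: measurable_funB => //; exact: continuous_measurable_fun|exact: intg_meas].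
    + by move=> x; rewrite !normrM mulrCA ler_wpM2r// mulr_ge0.
    rewrite RintegralZl//; last by apply: intg_abs; exact: L2_mul (cLdN n).2 kL.
    rewrite ler_wpM2l ?(le_trans _ (Heps n 0))//.
    apply: le_trans (L2_cs (cLdN n).2 kL) _.
    by rewrite ler_wpM2r ?sqrtr_ge0// ler_wsqrtr.
  - exact: cvg_cst.
  - rewrite -(mul0r (Num.sqrt (2 * 0 + 2 * sq g) * Num.sqrt (sq k))); apply: cvgM => //.
    apply: cvgM; last exact: cvg_cst.
    apply: continuous_cvg; first exact: sqrt_continuous.
    by apply: cvgD; [apply: cvgM => //; exact: cvg_cst|exact: cvg_cst].
have lim' : psi d * fN n d ^+ 2 - psi c * fN n c ^+ 2 @[n --> \oo] -->
   psi d * crep f d ^+ 2 - psi c * crep f c ^+ 2 by apply: cvgB; exact: cb.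
have ED n : \int[mu]_(x in `[c, d]) (dpsi x * fN n x ^+ 2) + \int[mu]_(x in `[c, d]) (2 * psi x * (fN n x * dN n x)) =
    psi d * fN n d ^+ 2 - psi c * fN n c ^+ 2.
  rewrite -pN RintegralD//; apply: itv_intg => x; apply: cvgM.
  - exact: cdpsi.
  - exact: (continuous_sqr (cfN n)).
  - by apply: cvgM; [exact: cvg_cst|exact: cpsi].
  - by apply: cvgM; [exact: cfN|exact: (cLdN n).1].
have lim : psi d * fN n d ^+ 2 - psi c * fN n c ^+ 2 @[n --> \oo] -->
   \int[mu]_(x in `[c, d]) (dpsi x * crep f x ^+ 2) + \int[mu]_(x in `[c, d]) (psi x * (2 * (crep f x * g x))).
  by under eq_fun do rewrite -ED; exact: cvgD.
by rewrite (seq_cvg_unique lim' lim) addrAC subrr add0r.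
Qed.

Let b x := crep f x ^+ 2.

Lemma crep_sq_continuous : continuous b.
Proof. exact: continuous_sqr. Qed.

Lemma crep_sq_bound x : `|b x| <= (embed_const * fine (sobolev_norm s f)) ^+ 2.
Proof.
rewrite normrX; have := crep_bound x s1 sf => H.
by rewrite lerXn2r ?nnegrE// (le_trans _ H).
Qed.

(** The weak derivative of f^2 coincides almost everywhere with the density of
    [crep_sq_density]; [inv_helmholtz_density] then removes all derivatives of f
    from the velocity. *)
Lemma inv_helmholtz_weak_deriv x :
  inv_helmholtz (weak_deriv (fun y => f y ^+ 2)) x = 2^-1 * (rconv b x - lconv b x).
Proof.
have [w wi ibp] := crep_sq_density.
have mf0 : measurable_fun setT f := L2_meas sf.1.
have ww : is_weak_deriv (fun y => f y ^+ 2) w.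
  split.
  - apply: intg_loc_intg; by case/L2P: sf.1.
  - exact: intg_loc_intg.
  - move=> phi tphi; have [N N0 HN] := test_supp tphi.
    have NN : - N <= N by rewrite (@le_trans _ _ 0)// ?oppr_le0 ltW.
    have weak y : ~ (- N <= y <= N) -> ~ (- N < y < N).
      by move=> H /andP[a c]; apply: H; rewrite !ltW.
    have cphi' := (test_cc (test_deriv tphi)).1.
    have -> : \int[mu]_y (f y ^+ 2 * derive1 phi y) = \int[mu]_y (derive1 phi y * b y).
      apply: Rint_ae_eq.
      + by apply: measurable_funM; [exact: measurable_funX|exact: continuous_measurable_fun].
      + by apply: measurable_funM; [exact: continuous_measurable_fun|exact: measurable_funX].
      + by apply: ae_sub crep_ae => y ->; rewrite mulrC.
    rewrite (@Rint_supp _ _ (- N) N) => [|y /weak/HN[_ ->]]; last by rewrite mul0r.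
    rewrite (@Rint_supp _ (fun y => w y * phi y) (- N) N) => [|y /weak/HN[-> _]]; last by rewrite mulr0.
    under [in RHS]eq_Rintegral do rewrite mulrC.
    rewrite (ibp phi (derive1 phi) (- N) N NN (test_is_derive tphi) cphi').
    have [-> _] : phi N = 0 /\ derive1 phi N = 0 by apply: HN; rewrite ltxx andbF.
    have [-> _] : phi (- N) = 0 /\ derive1 phi (- N) = 0 by apply: HN; rewrite ltxx.
    by rewrite !mul0r subrr sub0r opprK.
have := @xgetPex _ (fun=> 0) [set g | is_weak_deriv (fun y => f y ^+ 2) g] (ex_intro _ w ww).
rewrite -/(weak_deriv (fun y => f y ^+ 2)); set wd := weak_deriv _ => -[_ lwd Hwd].
have [_ lw Hw] := ww.
have wdw : {ae mu, forall x, wd x = w x}.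
  apply: loc_intg_ae => // phi tphi.
  by apply: oppr_inj; rewrite -Hwd// -Hw.
rewrite -(inv_helmholtz_density crep_sq_continuous crep_sq_bound wi ibp) /inv_helmholtz.
congr (_ * _); apply: Rint_ae_eq.
- apply: measurable_funM; last by case: lwd.
  apply: continuous_measurable_fun => y.
  apply: (continuous_comp (f := fun y => - `|x - y|)); last exact: continuous_expR.
  apply: cvgN; apply: (continuous_comp (f := fun y => x - y)); last exact: norm_continuous.
  by apply: cvgB => //; exact: cvg_cst.
- apply: measurable_funM; last exact: intg_meas.
  apply: continuous_measurable_fun => y.
  apply: (continuous_comp (f := fun y => - `|x - y|)); last exact: continuous_expR.
  apply: cvgN; apply: (continuous_comp (f := fun y => x - y)); last exact: norm_continuous.
  by apply: cvgB => //; exact: cvg_cst.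
- by apply: ae_sub wdw => y ->.
Qed.

End h1.

(** * Joint continuity in time and space *)

Section joint_continuity.
Context {R : realType}.
Implicit Types (K D : R -> R -> R) (f g : R -> R).

Definition jcont K (t x : R) := {for (t, x), continuous (fun z : R * R => K z.1 z.2)}.

Lemma jcontP K t x : jcont K t x <-> forall e : R, 0 < e -> exists2 d : R, 0 < d &
  forall t' x', `|t' - t| < d -> `|x' - x| < d -> `|K t' x' - K t x| < e.
Proof.
split=> [H e e0|H].
  have /cvgrPdist_lt/(_ _ e0)/nbhs_ballP[d /= d0 Hd] := H.
  exists d => // t' x' ht hx; rewrite distrC; apply: (Hd (t', x')).
  by split; rewrite /ball/= distrC.
apply/cvgrPdist_lt => e /H[d d0 Hd].
have : nbhs ((t, x) : R * R) (ball ((t, x) : R * R) d) by exact: nbhsx_ballx.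
by apply: filterS => -[t' x'] [/= ht hx]; rewrite distrC Hd// distrC.
Qed.

Lemma jcont_x K t x : jcont K t x -> {for x, continuous (K t)}.
Proof.
move=> /jcontP H; apply/cvgrPdist_lt => e /H[d d0 Hd]; apply/nbhs_ballP; exists d => //= y hy.
by rewrite distrC Hd ?subrr ?normr0// distrC.
Qed.

Lemma jcont_t K t x : jcont K t x -> {for t, continuous (K ^~ x)}.
Proof.
move=> /jcontP H; apply/cvgrPdist_lt => e /H[d d0 Hd]; apply/nbhs_ballP; exists d => //= y hy.
by rewrite distrC Hd ?subrr ?normr0// distrC.
Qed.

Lemma jcont_continuous_x K t : (forall x, jcont K t x) -> continuous (K t).
Proof. by move=> H x; have := jcont_x (H x). Qed.

Lemma jcont_continuous_t K x : (forall t, jcont K t x) -> continuous (K ^~ x).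
Proof. by move=> H t; have := jcont_t (H t). Qed.

Lemma jcont_unif K t x : {for x, continuous (K t)} ->
  (forall e : R, 0 < e -> exists2 d : R, 0 < d & forall t', `|t' - t| < d -> forall y, `|K t' y - K t y| <= e) ->
  jcont K t x.
Proof.
move=> cK H; apply/jcontP => e e0; have e2 : 0 < e / 2 by rewrite divr_gt0.
have [d d0 Hd] := H _ e2; have /cvgrPdist_lt/(_ _ e2)/nbhs_ballP[d' /= d'0 Hd'] := cK.
exists (Num.min d d'); first by rewrite lt_min d0.
move=> t' x'; rewrite !lt_min => /andP[ht _] /andP[_ hx].
rewrite -(subrK (K t x') (K t' x')) -addrA (le_lt_trans (ler_normD _ _))//.
rewrite [ltRHS]splitr ler_ltD// ?Hd// distrC; apply: Hd'.
by rewrite /ball/= distrC.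
Qed.

Lemma jcont_comp2 (F : R -> R -> R) K D t x : jcont K t x -> jcont D t x ->
  jcont F (K t x) (D t x) -> jcont (fun t x => F (K t x) (D t x)) t x.
Proof.
move=> /jcontP cK /jcontP cD /jcontP cF; apply/jcontP => e /cF[d d0 Hd].
have [d1 d10 H1] := cK _ d0; have [d2 d20 H2] := cD _ d0.
exists (Num.min d1 d2); first by rewrite lt_min d10.
move=> t' x'; rewrite !lt_min => /andP[? ?] /andP[? ?].
by apply: Hd; [exact: H1|exact: H2].
Qed.

Lemma jcont_comp1 f K t x : jcont K t x -> {for K t x, continuous f} ->
  jcont (fun t x => f (K t x)) t x.
Proof. by move=> cK cf; exact: (continuous_comp (f := fun z : R * R => K z.1 z.2)). Qed.

Lemma jcontD K D t x : jcont K t x -> jcont D t x -> jcont (fun t x => K t x + D t x) t x.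
Proof. by move=> cK cD; exact: cvgD. Qed.

Lemma jcontN K t x : jcont K t x -> jcont (fun t x => - K t x) t x.
Proof. by move=> cK; exact: cvgN. Qed.

Lemma jcontM K D t x : jcont K t x -> jcont D t x -> jcont (fun t x => K t x * D t x) t x.
Proof. by move=> cK cD; exact: cvgM. Qed.

Lemma jcont_cst (c : R) t x : jcont (fun _ _ => c) t x.
Proof. exact: cvg_cst. Qed.

(** Uniformity in t follows from the compactness of [a, b]. *)
Lemma jcont_tube K (a b x : R) : (forall t, a <= t <= b -> jcont K t x) ->
  forall e : R, 0 < e -> exists2 d : R, 0 < d &
    forall x', `|x' - x| < d -> forall t, a <= t <= b -> `|K t x' - K t x| < e.
Proof.
move=> cK e e0; have e2 : 0 < e / 2 by rewrite divr_gt0.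
have /compact_near_coveringP := @segment_compact R a b.
move=> /(_ R (nbhs x) (fun x' t => `|K t x' - K t x| < e) _)[t0 /=|].
  rewrite in_itv/= => /cK/jcontP/(_ _ e2)[d d0 Hd].
  exists (ball t0 d, ball x d); first by split; exact: nbhsx_ballx.
  move=> [t x'] /= [tt0 xx0]; have A := Hd t x'; have B := Hd t x.
  rewrite -(subrK (K t0 x) (K t x')) -addrA (le_lt_trans (ler_normD _ _))//.
  rewrite [ltRHS]splitr ltrD// ?A//; try by rewrite distrC.
  by rewrite distrC B ?subrr ?normr0// distrC.
move=> d /= d0 Hd; exists d => // x' hx t ht.
by apply: (Hd x') => /=; rewrite ?in_itv//= distrC.
Qed.

Lemma mvt_ball f (df : R -> R) (x r h : R) :
  (forall y : R, `|y - x| < r -> is_derive y (1 : R) f (df y)) -> `|h| < r ->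
  exists2 c, `|c - x| <= `|h| & f (x + h) - f x = df c * h.
Proof.
move=> dF hr.
have key (a b : R) : a < b -> (forall y : R, a <= y <= b -> `|y - x| < r) ->
   exists2 c, a <= c <= b & f b - f a = df c * (b - a).
  move=> ab H; have [y yab|| c cab E] := @MVT R f df a b ab.
  - by apply: dF; apply: H; move: yab; rewrite in_itv/= => /andP[/ltW -> /ltW ->].
  - apply: continuous_in_subspaceT => y /set_mem/=; rewrite in_itv/= => yab.
    exact: is_derive_continuous (dF _ (H _ yab)).
  - by exists c => //; move: cab; rewrite in_itv/= => /andP[/ltW -> /ltW ->].
have [h0|h0|->] := ltgtP h 0; last first.
- by exists x; rewrite ?addr0 !subrr ?normr0// mulr0.
- have [||c /andP[xc cx] E] := key x (x + h); first by rewrite ltrDl.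
    move=> y /andP[xy yx]; apply: le_lt_trans hr.
    by rewrite ger0_norm ?subr_ge0// (gtr0_norm h0) lerBlDl.
  exists c; last by rewrite E addrAC subrr add0r.
  by rewrite ger0_norm ?subr_ge0// (gtr0_norm h0) lerBlDl.
- have [||c /andP[xc cx] E] := key (x + h) x; first by rewrite gtrDl.
    move=> y /andP[xy yx]; apply: le_lt_trans hr.
    by rewrite ler0_norm ?subr_le0// (ltr0_norm h0) lerNl opprK lerBrDl.
  exists c; last by apply: oppr_inj; rewrite opprB E opprD addrA subrr add0r mulrN.
  by rewrite ler0_norm ?subr_le0// (ltr0_norm h0) lerNl opprK lerBrDl.
Qed.

Lemma prim_dist f g (t e : R) : continuous f -> continuous g ->
  (forall r, `|r| <= `|t| -> `|f r - g r| <= e) -> `|prim f t - prim g t| <= e * `|t|.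
Proof.
move=> cf cg H.
have d (y : R) : is_derive y (1 : R) (fun y => prim f y - prim g y) (f y - g y).
  by have := is_derive_prim cf y; have := is_derive_prim cg y => ? ?; exact: is_deriveB.
have [|c hc] := @mvt_ball (fun y => prim f y - prim g y) (fun y => f y - g y) 0 (`|t| + 1) t (fun y _ => d y).
  by rewrite ltrDl.
rewrite add0r !prim0 subrr subr0 => ->; rewrite normrM ler_wpM2r// H//.
by move: hc; rewrite subr0.
Qed.

Lemma jcont_prim K (t0 x0 r : R) : 0 < r ->
  (forall t x, `|x - x0| < r -> jcont K t x) -> jcont (fun t x => prim (K ^~ x) t) t0 x0.
Proof.
move=> r0 cK; have cKt x : `|x - x0| < r -> continuous (K ^~ x).
  by move=> hx t; apply: jcont_t; exact: cK.
have x0r : `|x0 - x0| < r by rewrite subrr normr0.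
apply/jcontP => e e0; have e2 : 0 < e / 2 by rewrite divr_gt0.
have p : 0 < `|t0| + 1 by rewrite ltr_wpDl.
have [d d0 Hd] := @jcont_tube K (- (`|t0| + 1)) (`|t0| + 1) x0 (fun t _ => cK t x0 x0r) _ (divr_gt0 e2 p).
have /cvgrPdist_lt/(_ _ e2)/nbhs_ballP[d' /= d'0 Hd'] := @continuous_prim _ _ (cKt _ x0r) t0.
exists (Num.min (Num.min d d') (Num.min r 1)); first by rewrite !lt_min d0 d'0 r0 ltr01.
move=> t x; rewrite !lt_min => /andP[/andP[_ td'] /andP[_ t1]] /andP[/andP[xd _] /andP[xr _]].
have tt : `|t| <= `|t0| + 1.
  by rewrite -[t](subrK t0) (le_trans (ler_normD _ _))// addrC lerD2l ltW.
rewrite -(subrK (prim (K ^~ x0) t) (prim (K ^~ x) t)) -addrA (le_lt_trans (ler_normD _ _))//.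
rewrite [ltRHS]splitr ler_ltD//; last by rewrite distrC; apply: Hd'; rewrite /ball/= distrC.
apply: (@le_trans _ _ (e / 2 / (`|t0| + 1) * `|t|)).
  apply: prim_dist; [exact: cKt|exact: cKt|move=> q qt].
  by apply: ltW; apply: Hd => //; rewrite -ler_norml (le_trans qt).
by rewrite mulrAC ler_pdivrMr// ler_wpM2l// ltW.
Qed.

Lemma is_derive_under_prim K D (t x0 r : R) : 0 < r ->
  (forall t x, `|x - x0| < r -> is_derive x (1 : R) (K t) (D t x)) ->
  (forall t x, `|x - x0| < r -> jcont K t x) -> (forall t x, `|x - x0| < r -> jcont D t x) ->
  is_derive x0 (1 : R) (fun x => prim (K ^~ x) t) (prim (D ^~ x0) t).
Proof.
move=> r0 dK cK cD; have x0r : `|x0 - x0| < r by rewrite subrr normr0.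
apply/is_derive_eps => e e0.
have p : 0 < `|t| + 1 by rewrite ltr_wpDl.
have [d d0 Hd] := @jcont_tube D (- `|t|) `|t| x0 (fun t _ => cD t x0 x0r) _ (divr_gt0 e0 p).
exists (Num.min d r); first by rewrite lt_min d0.
move=> h; rewrite lt_min => /andP[hd hr].
have cKt x : `|x - x0| < r -> continuous (K ^~ x) by move=> hx q; apply: jcont_t; exact: cK.
have cDt : continuous (D ^~ x0) by move=> q; apply: jcont_t; exact: cD.
have xhr : `|x0 + h - x0| < r by rewrite addrAC subrr add0r.
have dd (y : R) : is_derive y (1 : R) (fun y => prim (K ^~ (x0 + h)) y - prim (K ^~ x0) y - prim (D ^~ x0) y * h)
    (K y (x0 + h) - K y x0 - D y x0 * h).
  have d1 := is_derive_prim (cKt _ xhr) y; have d2 := is_derive_prim (cKt _ x0r) y.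
  have d3 := is_derive_prim cDt y.
  by derive_ring.
have [|c hc] := @mvt_ball _ _ 0 (`|t| + 1) t (fun y _ => dd y); first by rewrite ltrDl.
rewrite add0r !prim0 mul0r !subr0 => ->.
have [z zx ->] := mvt_ball (dK c) hr.
rewrite -mulrBl !normrM mulrAC ler_wpM2r//.
have : `|D c z - D c x0| < e / (`|t| + 1).
  by apply: Hd; [exact: le_lt_trans zx hd|rewrite -ler_norml -(subr0 c)].
move=> /ltW; rewrite ler_pdivlMr//; apply: le_trans.
by rewrite ler_wpM2l// lerDl.
Qed.

End joint_continuity.

(** * Clamped times *)

Section clamping.
Context {R : realType}.
Variable T : R.
Hypothesis T0 : 0 < T.

(** Times are clamped to [0, T], so that functions of time become defined and
    continuous on the whole line. *)
Definition clamp (t : R) : R := Num.min T (Num.max 0 t).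

Lemma clamp_itv t : 0 <= clamp t <= T.
Proof. by rewrite /clamp le_min ltW//= le_max lexx ge_min lexx. Qed.

Lemma clamp_id t : 0 <= t <= T -> clamp t = t.
Proof. by move=> /andP[t0 tT]; rewrite /clamp max_r// min_r. Qed.

Lemma clamp_dist t t' : `|clamp t - clamp t'| <= `|t - t'|.
Proof.
have := ler_norm (t - t'); have := ler_norm (- (t - t')); rewrite normrN.
move: `|t - t'| => A h1 h2; rewrite /clamp ler_norml /Order.min /Order.max.
have T1 := T0; case: (ltP 0 t) => ?; case: (ltP 0 t') => ?.
all: do ! (case: ifPn; rewrite -?leNgt => ?).
all: by apply/andP; split; lra.
Qed.

Lemma continuous_clamp : continuous clamp.
Proof.
move=> t; apply/cvgrPdist_lt => e e0; apply/nbhs_ballP; exists e => //= y hy.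
by apply: le_lt_trans (clamp_dist _ _) _.
Qed.

End clamping.

(** * The density and the velocity of a solution *)

Section density.
Context {R : realType}.
Notation mu := (@lebesgue_measure R).

(** The transform being defined by choice up to null sets, linearity comes from
    the uniqueness of continuous representatives. *)
Lemma crep_sub (s : R) (f g : R -> R) : 1 <= s -> sobolev s f -> sobolev s g -> sobolev s (f \- g) ->
  forall x, crep (f \- g) x = crep f x - crep g x.
Proof.
move=> s1 sf sg sd x; apply/eqP; rewrite -subr_eq0; apply/eqP.
apply: (@ae_continuous0 R setT (fun x => crep (f \- g) x - (crep f x - crep g x))) => //.
- exact: openT.
- move=> y _; apply: cvgB; first exact: (continuous_crep s1 sd).
  by apply: cvgB; [exact: (continuous_crep s1 sf)|exact: (continuous_crep s1 sg)].
- have := ae_and (crep_ae s1 sd) (ae_and (crep_ae s1 sf) (crep_ae s1 sg)).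
  by apply: ae_sub => y [E1 [E2 E3]]; rewrite -E1 -E2 -E3 /= subrr.
Qed.

Definition dens (T : R) (rho : R -> R -> R) (t x : R) : R := crep (rho (clamp T t)) x.

Definition dens_left T rho (t x : R) : R := lconv (fun y => dens T rho t y ^+ 2) x.
Definition dens_right T rho (t x : R) : R := rconv (fun y => dens T rho t y ^+ 2) x.
Definition vel T rho (t x : R) : R := 2^-1 * (dens_left T rho t x - dens_right T rho t x).

(** The mass that has crossed x during [0, t]. *)
Definition flux T rho (t x : R) : R := prim (fun r => dens T rho r x * vel T rho r x) t.

Variables (s T : R) (rho0 : R -> R) (rho : R -> R -> R).
Hypotheses (s1 : 1 <= s) (T0 : 0 < T) (hrho : brinkman_solution s T rho0 rho).

Let u := dens T rho.
Let v := vel T rho.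

Let crho : sobolev_continuous s `[0, T] rho. Proof. by case: hrho. Qed.

Lemma sobolev_clamp t : sobolev s (rho (clamp T t)).
Proof. by apply: crho.1; rewrite /= in_itv/= clamp_itv. Qed.

Lemma continuous_dens t : continuous (u t).
Proof. exact: continuous_crep s1 (sobolev_clamp t). Qed.

(** By the embedding, continuity in time with values in H^s is uniform in space. *)
Lemma dens_time t0 (e : R) : 0 < e -> exists2 d : R, 0 < d &
  forall t, `|t - t0| < d -> forall x, `|u t x - u t0 x| <= e.
Proof.
move=> e0; have It0 : `[0, T]%classic (clamp T t0) by rewrite /= in_itv/= clamp_itv.
have /fine_cvgP[fin lim] := crho.2 _ It0.
have C0 : 0 <= embed_const :> R.
  by rewrite mulr_ge0 ?addr_ge0 ?sqrtr_ge0// invr_ge0 mulr_ge0// pi_ge0.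
have p : 0 < (embed_const : R) + 1 by rewrite ltr_wpDl.
have /cvgrPdist_le/(_ _ (divr_gt0 e0 p)) {}lim := lim.
have : \forall t \near within `[0, T] (nbhs (clamp T t0)), sobolev_norm s (rho t \- rho (clamp T t0)) \is a fin_num /\
    `|0 - fine (sobolev_norm s (rho t \- rho (clamp T t0)))| <= e / (embed_const + 1).
  by apply: filterS2 fin lim => t ? ?; split.
rewrite near_withinE => /nbhs_ballP[d /= d0 Hd]; exists d => // t td x.
have [||fint le] := Hd (clamp T t).
- rewrite /ball/= distrC (le_lt_trans _ td)//; exact: clamp_dist.
- by rewrite in_itv/= clamp_itv.
have sd : sobolev s (rho (clamp T t) \- rho (clamp T t0)).
  split; first exact: L2B (sobolev_clamp t).1 (sobolev_clamp t0).1.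
  by rewrite -ge0_fin_numE// Lnorm_ge0.
rewrite /u /dens -(crep_sub s1 (sobolev_clamp t) (sobolev_clamp t0) sd).
apply: le_trans (crep_bound x s1 sd) _.
rewrite sub0r normrN in le; apply: (@le_trans _ _ (embed_const * (e / (embed_const + 1)))).
  by rewrite ler_wpM2l// (le_trans (ler_norm _)).
rewrite mulrA ler_pdivrMr// mulrC ler_wpM2l ?lerDl//; exact: ltW.
Qed.

Lemma jcont_dens t x : jcont u t x.
Proof. by apply: jcont_unif; [exact: continuous_dens|exact: dens_time]. Qed.

(** Local bounds near each time are made uniform by the compactness of [0, T]. *)
Lemma dens_bound : exists2 M, 0 <= M & forall t x, `|u t x| <= M.
Proof.
have /compact_near_coveringP := @segment_compact R 0 T.
move=> /(_ R (+oo%R : set_system R) (fun M t => forall x, `|u t x| <= M) _)[t /=|].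
  rewrite in_itv/= => tI; have [d d0 Hd] := dens_time t (ltr01 : 0 < (1 : R)).
  pose B : R := embed_const * fine (sobolev_norm s (rho (clamp T t))).
  exists (ball t d, [set M | B + 1 < M]).
    by split; [exact: nbhsx_ballx|apply: nbhs_pinfty_gt; exact: num_real].
  move=> [t' M] /= [tt' BM] x; apply: le_trans (ltW BM).
  rewrite -(subrK (u t x) (u t' x)) (le_trans (ler_normD _ _))// addrC lerD//.
    exact: crep_bound s1 (sobolev_clamp t).
  by apply: Hd; rewrite distrC.
move=> M0 /= [_ HM]; exists (`|M0| + 1); first by rewrite addr_ge0.
have M1 : M0 < `|M0| + 1 by rewrite (le_lt_trans (ler_norm _))// ltrDl.
move=> t x; have := HM _ M1 (clamp T t); rewrite /= in_itv/= clamp_itv//.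
by move=> /(_ isT x); rewrite /u /dens (clamp_id (clamp_itv _ _)).
Qed.

Lemma dens_ae t : 0 <= t <= T -> {ae mu, forall x, rho t x = u t x}.
Proof. by move=> tT; have := crep_ae s1 (sobolev_clamp t); rewrite /u /dens (clamp_id tT). Qed.

Lemma dens0_ae : {ae mu, forall x, rho0 x = u 0 x}.
Proof.
have [_ h0 _] := hrho; have := dens_ae (t := 0); rewrite lexx ltW// => /(_ isT) h1.
by have := ae_and h0 h1; apply: ae_sub => x [<- ->].
Qed.

Lemma velocityE t x : 0 <= t <= T -> velocity rho t x = v t x.
Proof.
move=> tT; rewrite /velocity.
have := inv_helmholtz_weak_deriv s1 (sobolev_clamp t) x; rewrite (clamp_id tT) => ->.
by rewrite /v /vel /dens_left /dens_right /dens (clamp_id tT) -mulrN opprB.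
Qed.

Let b t (x : R) := u t x ^+ 2.

Let mb t : measurable_fun setT (b t).
Proof. apply: continuous_measurable_fun; apply: continuous_sqr; exact: continuous_dens. Qed.

Let cb t : continuous (b t).
Proof. apply: continuous_sqr; exact: continuous_dens. Qed.

Let bound_sqr M : 0 <= M -> (forall t x, `|u t x| <= M) -> forall t x, `|b t x| <= M ^+ 2.
Proof. by move=> M0 HM t x; rewrite normrX lerXn2r ?nnegrE. Qed.

Let sqr_time M t0 (e : R) : 0 <= M -> (forall t x, `|u t x| <= M) -> 0 < e -> exists2 d : R, 0 < d &
  forall t, `|t - t0| < d -> forall x, `|b t x - b t0 x| <= e.
Proof.
move=> M0 HM e0; have p : 0 < M + M + 1 by rewrite ltr_wpDl// addr_ge0.
have [d d0 Hd] := dens_time t0 (divr_gt0 e0 p); exists d => // t td x.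
rewrite /b subr_sqr normrM (le_trans (ler_pM _ _ (Hd t td x) (_ : _ <= M + M + 1)))//.
- rewrite (le_trans (ler_normD _ _))// (@le_trans _ _ (M + M)) ?lerDl//.
  by rewrite lerD.
- by rewrite divfK// gt_eqF.
Qed.

Lemma is_derive_dens_left t (x : R) :
  is_derive x (1 : R) (dens_left T rho t) (u t x ^+ 2 - dens_left T rho t x).
Proof. by have [M M0 HM] := dens_bound; exact: is_derive_lconv (mb t) (bound_sqr M0 HM t) (@cb t) x. Qed.

Lemma is_derive_dens_right t (x : R) :
  is_derive x (1 : R) (dens_right T rho t) (dens_right T rho t x - u t x ^+ 2).
Proof. by have [M M0 HM] := dens_bound; exact: is_derive_rconv (mb t) (bound_sqr M0 HM t) (@cb t) x. Qed.

Lemma jcont_dens_left t x : jcont (dens_left T rho) t x.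
Proof.
have [M M0 HM] := dens_bound; have HM2 := bound_sqr M0 HM.
apply: jcont_unif => [|e e0]; first exact: is_derive_continuous (is_derive_dens_left t x).
have [d d0 Hd] := sqr_time t M0 HM e0; exists d => // t' tt' y.
rewrite /dens_left (lconvB y (mb t') (mb t) (HM2 t') (HM2 t)).
by apply: lconv_bound => [|z]; [exact: measurable_funB|exact: Hd].
Qed.

Lemma jcont_dens_right t x : jcont (dens_right T rho) t x.
Proof.
have [M M0 HM] := dens_bound; have HM2 := bound_sqr M0 HM.
apply: jcont_unif => [|e e0]; first exact: is_derive_continuous (is_derive_dens_right t x).
have [d d0 Hd] := sqr_time t M0 HM e0; exists d => // t' tt' y.
rewrite /dens_right (rconvB y (mb t') (mb t) (HM2 t') (HM2 t)).
by apply: rconv_bound => [|z]; [exact: measurable_funB|exact: Hd].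
Qed.

Lemma jcont_vel t x : jcont v t x.
Proof.
apply: jcontM; first exact: jcont_cst.
by apply: jcontD; [exact: jcont_dens_left|apply: jcontN; exact: jcont_dens_right].
Qed.

Lemma dens_left_bound M : 0 <= M -> (forall t x, `|u t x| <= M) ->
  forall t x, `|dens_left T rho t x| <= M ^+ 2 /\ `|dens_right T rho t x| <= M ^+ 2.
Proof.
move=> M0 HM t x; have HM2 := bound_sqr M0 HM.
split; first exact: (lconv_bound (mb t) (HM2 t) x).
exact: (rconv_bound (mb t) (HM2 t) x).
Qed.

Lemma vel_bound : exists2 M, 0 <= M & forall t x, `|v t x| <= M.
Proof.
have [M M0 HM] := dens_bound; exists (M ^+ 2); first exact: sqr_ge0.
move=> t x; have [lb rb] := dens_left_bound M0 HM t x.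
rewrite /v /vel normrM ger0_norm ?invr_ge0// mulrC ler_pdivrMr//.
by rewrite (le_trans (ler_normB _ _))// mulrDr mulr1 lerD.
Qed.

Let jcont_flux_density t x : jcont (fun t x => u t x * v t x) t x.
Proof. by apply: jcontM; [exact: jcont_dens|exact: jcont_vel]. Qed.

Lemma jcont_flux t x : jcont (flux T rho) t x.
Proof. by apply: (jcont_prim ltr01) => ? ? _; exact: jcont_flux_density. Qed.

Lemma continuous_flux t : continuous (flux T rho t).
Proof. exact: jcont_continuous_x (@jcont_flux t). Qed.

Lemma flux0 x : flux T rho 0 x = 0.
Proof. exact: prim0. Qed.

Let pairing (phi : R -> R) t := \int[mu]_x (u t x * phi x).

Let pairingE phi t : cc phi -> 0 <= t <= T -> \int[mu]_x (rho t x * phi x) = pairing phi t.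
Proof.
by move=> cphi tT; rewrite -{1}(clamp_id tT) (crep_pair s1 (sobolev_clamp t)).
Qed.

Let continuous_pairing phi : cc phi -> continuous (pairing phi).
Proof.
move=> cphi t0; have [ip _] := cc_intg cphi.
have I0 : 0 <= \int[mu]_x `|phi x| by apply: Rintegral_ge0.
have p : 0 < \int[mu]_x `|phi x| + 1 by rewrite ltr_wpDl.
apply/cvgrPdist_le => e e0; have [d d0 Hd] := dens_time t0 (divr_gt0 e0 p).
apply/nbhs_ballP; exists d => //= t tt0.
have cu r : intg (fun x => u r x * phi x).
  exact: (cc_intg (cc_continuousM (@continuous_dens r) cphi)).1.
rewrite -RintegralB//; pose k : R := e / (\int[mu]_x `|phi x| + 1).
apply: (@le_trans _ _ (\int[mu]_x (k * `|phi x|))).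
  apply: Rint_norm_le.
  - by apply: measurable_funB; exact: intg_meas.
  - by apply: intgZ; exact: intg_abs.
  - move=> x; rewrite -mulrBl normrM ler_wpM2r// distrC; apply: Hd.
    by rewrite distrC.
rewrite RintegralZl//; last exact: intg_abs.
by rewrite /k mulrAC ler_pdivrMr// ler_wpM2l ?lerDl// ltW.
Qed.

(** As s - 1 >= 0, [sobolev_pairing] turns the convergence of the difference
    quotients in H^(s-1) into convergence in the sense of distributions. *)
Let is_derive_pairing phi (t : R) : test_function phi -> 0 < t < T ->
  is_derive t (1 : R) (pairing phi) (\int[mu]_x (u t x * v t x * derive1 phi x)).
Proof.
move=> tphi /andP[t0 tT]; have cphi := test_cc tphi.
have [_ _ [drho [scr scd lim] eqn]] := hrho.
have tI : `]0, T[%classic t by rewrite /= in_itv/= t0.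
have tI' : 0 <= t <= T by rewrite !ltW.
have wE : \int[mu]_x (drho t x * phi x) = \int[mu]_x (u t x * v t x * derive1 phi x).
  have [_ _ /(_ phi tphi)] := eqn t (mem_set tI); move/eqP; rewrite -eqr_oppLR => /eqP <-.
  have mphi' := continuous_measurable_fun (test_cc (test_deriv tphi)).1.
  have mu' := continuous_measurable_fun (@continuous_dens t).
  have mv : measurable_fun setT (v t).
    apply: continuous_measurable_fun; exact: jcont_continuous_x (@jcont_vel t).
  have EN x : inv_helmholtz (weak_deriv (fun y => rho t y ^+ 2)) x = - v t x.
    by rewrite -(velocityE x tI') /velocity opprK.
  under eq_Rintegral do rewrite EN mulrN mulNr -mulN1r.
  have mr : measurable_fun setT (rho t).
    by have := L2_meas (sobolev_clamp t).1; rewrite (clamp_id tI').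
  rewrite (@Rint_ae_eq R _ (fun x => -1 * (u t x * v t x * derive1 phi x))).
  - rewrite RintegralZl ?mulN1r ?opprK//.
    apply: (cc_intg _).1; apply: cc_continuousM; last exact: test_cc (test_deriv tphi).
    exact: jcont_continuous_x (@jcont_flux_density t).
  - by apply: measurable_funM => //; apply: measurable_funM => //; exact: measurable_funM.
  - by apply: measurable_funM => //; apply: measurable_funM => //; exact: measurable_funM.
  - by apply: ae_sub (dens_ae tI') => x ->.
rewrite -wE; set l := \int[mu]_x (drho t x * phi x).
have near_in : \forall h \near (0 : R)^', 0 < t + h < T.
  rewrite near_withinE; apply/nbhs_ballP; exists (Num.min t (T - t)) => /=.
    by rewrite lt_min t0 subr_gt0.
  move=> h; rewrite /ball/= sub0r normrN lt_min !ltr_norml => /andP[/andP[? ?] /andP[? ?]] _.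
  by apply/andP; split; lra.
have /fine_cvgP[fin lim0] := lim t tI.
have cv : h^-1 *: (pairing phi (h *: (1 : R) + t) - pairing phi t) @[h --> 0^'] --> l.
  apply/subr_cvg0; apply: norm_cvg0.
  apply: (@squeeze_cvgr _ _ _ _ (cst 0) (fun h => pair_const phi * fine (sobolev_norm (s - 1)
      (fun x => h^-1 * (rho (t + h) x - rho t x) - drho t x)))).
  - apply: filterS2 near_in fin => h hI hfin; rewrite normr_ge0/=.
    have tI2 : `]0, T[%classic (t + h) by rewrite /= in_itv/= hI.
    have tI2' : 0 <= t + h <= T by case/andP: hI => /ltW -> /ltW ->.
    have qL : (fun x => h^-1 * (rho (t + h) x - rho t x) - drho t x) \in Lfun mu 2%:E.
      by apply: L2B (scd.1 _ tI).1; apply: L2Z; exact: L2B (scr.1 _ tI2).1 (scr.1 _ tI).1.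
    have sq' : sobolev (s - 1) (fun x => h^-1 * (rho (t + h) x - rho t x) - drho t x).
      by split=> //; rewrite -ge0_fin_numE// Lnorm_ge0.
    apply: le_trans (sobolev_pairing _ sq' cphi); last by rewrite subr_ge0.
    rewrite le_eqVlt; apply/orP; left; apply/eqP; congr `|_|.
    have pL := (cc_intg cphi).2.
    have i1 := L2_mul (scr.1 _ tI2).1 pL; have i2 := L2_mul (scr.1 _ tI).1 pL.
    have i3 := L2_mul (scd.1 _ tI).1 pL.
    rewrite /GRing.scale/= mulr1 (addrC h) -(pairingE cphi tI2') -(pairingE cphi tI') /l.
    rewrite -RintegralB// -RintegralZl//; last exact: intgB.
    rewrite -RintegralB//; last by apply: intgZ; exact: intgB.
    by apply: eq_Rintegral => x _; ring.
  - exact: cvg_cst.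
  - rewrite -[X in _ --> X](mulr0 (pair_const phi)).
    have c0 : cst (pair_const phi) h @[h --> (0 : R)^'] --> pair_const phi by exact: cvg_cst.
    exact: (cvgM c0 lim0).
by split; [apply/cvg_ex; exists l|exact/cvg_lim].
Qed.

(** The weak formulation integrated in time: the mass to the left of x changes
    by the flux through x. *)
Lemma mass_balance t x : 0 <= t <= T ->
  prim (fun y => u t y - u 0 y) x = flux T rho t 0 - flux T rho t x.
Proof.
move=> /andP[t0 tT].
have key phi : test_function phi ->
    pairing phi t - pairing phi 0 = \int[mu]_x (derive1 phi x * flux T rho t x).
  move=> tphi; have cphi := test_cc tphi; have cphi' := test_cc (test_deriv tphi).
  pose A r := \int[mu]_x (derive1 phi x * flux T rho r x).
  have [Mu Mu0 HMu] := dens_bound; have [Mv Mv0 HMv] := vel_bound.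
  have dA (r : R) : is_derive r (1 : R) A (\int[mu]_x (derive1 phi x * (u r x * v r x))).
    apply: (@is_derive_under_integral _ (fun r x => derive1 phi x * flux T rho r x)
      (fun r x => derive1 phi x * (u r x * v r x)) (fun x => Mu * Mv * `|derive1 phi x|) r 1 ltr01).
    - move=> z _; have : intg (fun x => flux T rho z x * derive1 phi x).
        exact: (cc_intg (cc_continuousM (@continuous_flux z) cphi')).1.
      by apply: eq_integrable => // y _ /=; rewrite mulrC.
    - move=> z y; have d1 : is_derive z (1 : R) (fun r => flux T rho r y) (u z y * v z y).
        apply: is_derive_prim; exact: jcont_continuous_t (fun q => @jcont_flux_density q y).
      by derive_ring.
    - by apply: intgZ; apply: intg_abs; exact: (cc_intg cphi').1.
    - by move=> z y _; rewrite normrM mulrC ler_wpM2r// normrM ler_pM.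
  have A0 : A 0 = 0.
    by rewrite /A /Rintegral integral0_eq// => y _; rewrite flux0 mulr0.
  have [->|tn] := eqVneq t 0; first by rewrite subrr -/(A 0) A0.
  have {tn} tp : 0 < t by rewrite lt_neqAle eq_sym tn.
  have [r rt|| c _] := @MVT R (fun r => pairing phi r - A r) (fun=> 0) 0 t tp.
  - have d1 : is_derive r (1 : R) (pairing phi) (\int[mu]_x (u r x * v r x * derive1 phi x)).
      apply: is_derive_pairing => //; move: rt; rewrite in_itv/= => /andP[-> rt]/=.
      exact: lt_le_trans rt tT.
    have E : \int[mu]_x (u r x * v r x * derive1 phi x) = \int[mu]_x (derive1 phi x * (u r x * v r x)).
      by apply: eq_Rintegral => y _; rewrite mulrC.
    by rewrite E in d1; have := is_deriveB d1 (dA r); rewrite subrr.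
  - apply: continuous_subspaceT => r; apply: cvgB; first exact: continuous_pairing.
    exact: is_derive_continuous (dA r).
  rewrite -[X in _ -> _ = X]/(A t) A0.
  by move: (A t) (pairing phi t) (pairing phi 0) => a p q; lra.
pose g y := u t y - u 0 y.
have cg : continuous g by move=> y; apply: cvgB; exact: continuous_dens.
pose W y := prim g y + flux T rho t y.
have cW : continuous W.
  move=> y; apply: cvgD; [exact: continuous_prim|exact: continuous_flux].
have : W x = W 0.
  apply: (weak_deriv0_cst cW) => phi tphi; have cphi := test_cc tphi.
  have cphi' := test_cc (test_deriv tphi).
  have ic (h : R -> R) : continuous h -> intg (fun y => h y * derive1 phi y).
    by move=> ch; apply: (cc_intg _).1; exact: cc_continuousM.
  under eq_Rintegral do rewrite mulrDl.
  rewrite RintegralD//; [|exact: ic (continuous_prim cg)|]; last first.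
    by apply: ic; exact: continuous_flux.
  rewrite (test_ibp (is_derive_prim cg) cg tphi).
  under [X in _ + X]eq_Rintegral do rewrite mulrC.
  rewrite -(key _ tphi) /pairing -RintegralB//.
  - apply/eqP; rewrite addrC subr_eq0; apply/eqP; apply: eq_Rintegral => y _.
    by rewrite mulrBl.
  - exact: (cc_intg (cc_continuousM (@continuous_dens t) cphi)).1.
  - exact: (cc_intg (cc_continuousM (@continuous_dens 0) cphi)).1.
by rewrite /W prim0 add0r => <-; rewrite addrK.
Qed.

End density.

(** * The flow of a velocity field *)

Section flow.
Context {R : realType}.

Lemma cst_on_itv (T : R) (f : R -> R) : (forall t : R, 0 < t < T -> is_derive t (1 : R) f 0) ->
  continuous f -> forall t, 0 <= t <= T -> f t = f 0.
Proof.
move=> df cf t /andP[t0 tT]; have [->//|tn] := eqVneq t 0.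
have tp : 0 < t by rewrite lt_neqAle eq_sym tn.
have [r rt|| c _] := @MVT R f (fun=> 0) 0 t tp.
- by apply: df; move: rt; rewrite in_itv/= => /andP[-> /lt_le_trans]; apply.
- exact: continuous_subspaceT.
- by rewrite mul0r => /eqP; rewrite subr_eq0 => /eqP.
Qed.

Lemma prim_bound (f : R -> R) (t e : R) : continuous f ->
  (forall r, `|r| <= `|t| -> `|f r| <= e) -> `|prim f t| <= e * `|t|.
Proof.
move=> cf H; have [|c hc] := @mvt_ball R (prim f) f 0 (`|t| + 1) t (fun y _ => is_derive_prim cf y).
  by rewrite ltrDl.
rewrite add0r prim0 subr0 => ->; rewrite normrM ler_wpM2r// H//.
by move: hc; rewrite subr0.
Qed.

Lemma prim_cst (c t : R) : prim (fun=> c) t = c * t.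
Proof.
have cc : continuous (fun _ : R => c) by move=> x; exact: cst_continuous.
have d (y : R) : is_derive y (1 : R) (fun y => prim (fun=> c) y - c * y) 0.
  have d1 := is_derive_prim cc y.
  by derive_ring.
have := @is_derive_0_is_cst R (fun y => prim (fun=> c) y - c * y) t 0 d.
by rewrite prim0 mulr0 subrr => /eqP; rewrite subr_eq0 => /eqP.
Qed.

Lemma jcont_fst (f : R -> R) (t x : R) : {for t, continuous f} -> jcont (fun t _ => f t) t x.
Proof. by move=> cf; apply: (@continuous_comp _ _ _ fst f); [exact: cvg_fst|exact: cf]. Qed.

Lemma jcont_snd (f : R -> R) (t x : R) : {for x, continuous f} -> jcont (fun _ x => f x) t x.
Proof. by move=> cf; apply: (@continuous_comp _ _ _ snd f); [exact: cvg_snd|exact: cf]. Qed.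

Lemma jcont_id2 (t x : R) : jcont (fun _ x : R => x) t x.
Proof. exact: cvg_snd. Qed.

Lemma jcont_id1 (t x : R) : jcont (fun t _ : R => t) t x.
Proof. exact: cvg_fst. Qed.

(** Chain rule when F is continuously differentiable in x but only differentiable
    in t at the point: the increment in x is taken first, at the shifted time. *)
Lemma is_derive_joint (F D : R -> R -> R) (Y : R -> R) (t a y r : R) : 0 < r ->
  (forall t' x : R, `|t' - t| < r -> is_derive x (1 : R) (F t') (D t' x)) -> jcont D t (Y t) ->
  is_derive t (1 : R) (F ^~ (Y t)) a -> is_derive t (1 : R) Y y ->
  is_derive t (1 : R) (fun t => F t (Y t)) (a + D t (Y t) * y).
Proof.
move=> r0 dF /jcontP cD /is_derive_eps dt /is_derive_eps dY; apply/is_derive_eps => e e0.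
have e3 : 0 < e / 3 by rewrite divr_gt0.
have pC : 0 < `|y| + 1 by rewrite ltr_wpDl.
have pD : 0 < `|D t (Y t)| + 1 by rewrite ltr_wpDl.
have [d1 d10 H1] := cD _ (divr_gt0 e3 pC).
have [d2 d20 H2] := dt _ e3.
have [d3 d30 H3] := dY _ ltr01.
have [d4 d40 H4] := dY _ (divr_gt0 e3 pD).
exists (Num.min (Num.min (Num.min d1 (d1 / (`|y| + 1))) d2) (Num.min (Num.min d3 d4) r)).
  by rewrite !lt_min d10 d20 d30 d40 r0 divr_gt0.
move=> h; rewrite !lt_min => /andP[/andP[/andP[h1 h1'] h2] /andP[/andP[h3 h4] hr]].
pose k := Y (t + h) - Y t.
have kh : `|k| <= (`|y| + 1) * `|h|.
  have := H3 h h3; rewrite -/k mul1r => A.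
  by rewrite -(subrK (y * h) k) (le_trans (ler_normD _ _))// mulrDl mul1r addrC normrM lerD.
have thr : `|t + h - t| < r by rewrite addrAC subrr add0r.
have [|c ck Ec] := @mvt_ball R (F (t + h)) (D (t + h)) (Y t) (`|k| + 1) k (fun x _ => dF _ x thr).
  by rewrite ltrDl.
have kd : `|k| < d1.
  by apply: le_lt_trans kh _; rewrite mulrC -ltr_pdivlMr.
have Dc : `|D (t + h) c - D t (Y t)| < e / 3 / (`|y| + 1).
  by apply: H1; [rewrite addrAC subrr add0r|exact: le_lt_trans kd].
have -> : F (t + h) (Y (t + h)) - F t (Y t) - (a + D t (Y t) * y) * h =
    (D (t + h) c - D t (Y t)) * k + D t (Y t) * (k - y * h) + (F (t + h) (Y t) - F t (Y t) - a * h).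
  move: Ec; rewrite /k (addrC (Y t)) subrK => Ec.
  rewrite mulrBl -Ec; ring.
have -> : e * `|h| = e / 3 * `|h| + e / 3 * `|h| + e / 3 * `|h| by field.
rewrite (le_trans (ler_normD _ _))// lerD ?H2// (le_trans (ler_normD _ _))// lerD// normrM.
- apply: (@le_trans _ _ (e / 3 / (`|y| + 1) * ((`|y| + 1) * `|h|))).
    by rewrite ler_pM// ltW.
  by rewrite mulrA divfK// gt_eqF.
- apply: (@le_trans _ _ ((`|D t (Y t)| + 1) * (e / 3 / (`|D t (Y t)| + 1) * `|h|))).
    by rewrite ler_pM// ?lerDl// H4.
  by rewrite mulrA mulrC [X in _ * X]mulrC divfK ?gt_eqF// mulrC.
Qed.

Lemma increment_prim (f df : R -> R) (y z : R) : continuous df ->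
  (forall x : R, is_derive x (1 : R) f (df x)) ->
  f z - f y = (z - y) * prim (fun q => df (y + q * (z - y))) 1.
Proof.
move=> cdf dF; set d := z - y.
have cg : continuous (fun q : R => df (y + q * d)).
  move=> q; apply: (continuous_comp (f := fun q : R => y + q * d)); last exact: cdf.
  by apply: cvgD; [exact: cvg_cst|apply: cvgM; [exact: cvg_id|exact: cvg_cst]].
have D (q : R) : is_derive q (1 : R) (fun q : R => f (y + q * d) - d * prim (fun q => df (y + q * d)) q) 0.
  have d1 : is_derive q (1 : R) (fun q : R => y + q * d) d.
    by derive_ring.
  have d2 := @is_derive1_comp R f (fun q => y + q * d) q _ _ (dF (y + q * d)) d1.
  have d3 := is_derive_prim cg q.
  have d4 : is_derive q (1 : R) (fun q => d * prim (fun q => df (y + q * d)) q) (df (y + q * d) * d).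
    by derive_ring.
  by have := is_deriveB d2 d4; rewrite subrr.
have := @is_derive_0_is_cst R _ 1 0 D.
rewrite mul1r mul0r addr0 prim0 mulr0 subr0 (_ : y + d = z); last by rewrite /d addrC subrK.
by move=> <-; rewrite subKr.
Qed.

Variables (T L : R) (v w X : R -> R -> R).
Hypotheses (T0 : 0 < T) (jw : forall t x, jcont w t x).
Hypothesis dv : forall t x : R, is_derive x (1 : R) (v t) (w t x).
Hypothesis wL : forall t x, `|w t x| <= L.
Hypothesis hX : forall x : R, [/\ X 0 x = x, {within `[0, T], continuous (fun t => X t x)} &
  forall t : R, 0 < t < T -> is_derive t (1 : R) (fun r => X r x) (v t (X t x))].

Definition cflow (t x : R) : R := X (clamp T t) x.

Local Notation Y := cflow.

Lemma cflow_clamp t x : Y (clamp T t) x = Y t x.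
Proof. by rewrite /cflow clamp_id// clamp_itv. Qed.

Lemma cflow0 x : Y 0 x = x.
Proof. by have [X0 _ _] := hX x; rewrite /cflow clamp_id ?lexx ?ltW. Qed.

Lemma continuous_cflow x : continuous (Y ^~ x).
Proof.
move=> t; have [_ /subspace_continuousP cX _] := hX x.
have It : `[0, T]%classic (clamp T t) by rewrite /= in_itv/= clamp_itv.
apply/cvgrPdist_lt => e e0; have /cvgrPdist_lt/(_ _ e0) := cX _ It.
rewrite near_withinE => /nbhs_ballP[d /= d0 Hd].
apply/nbhs_ballP; exists d => //= y ty; apply: Hd.
- by rewrite /ball/= (le_lt_trans (clamp_dist T0 _ _)).
- by rewrite /= in_itv/= clamp_itv.
Qed.

Lemma is_derive_cflow_t (t x : R) : 0 < t < T -> is_derive t (1 : R) (Y ^~ x) (v t (Y t x)).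
Proof.
move=> tT; have [_ _ dX] := hX x; have := dX t tT.
have tT' : 0 <= t <= T by case/andP: tT => ? ?; rewrite !ltW.
have -> : Y t x = X t x by rewrite /cflow clamp_id.
apply: near_eq_is_derive.
have tI : t \in `]0, T[ by rewrite in_itv.
near=> y; rewrite /cflow clamp_id//.
have : y \in `]0, T[ by near: y; exact: near_in_itvoo.
by rewrite in_itv/= => /andP[? ?]; rewrite !ltW.
Unshelve. all: by end_near. Qed.

(** The average of w = v_x between two trajectories. *)
Let m (a b t : R) : R := prim (fun q => w t (Y t a + q * (Y t b - Y t a))) 1.

Let jcont_segment a b q t : jcont (fun q t => w t (Y t a + q * (Y t b - Y t a))) q t.
Proof.
apply: (@jcont_comp2 R w (fun q t => t) (fun q t => Y t a + q * (Y t b - Y t a))).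
- exact: jcont_id2.
- apply: jcontD; first by apply: jcont_snd; exact: continuous_cflow.
  apply: jcontM; first exact: jcont_id1.
  by apply: (@jcont_snd (fun t => Y t b - Y t a)); apply: cvgB; exact: continuous_cflow.
- exact: jw.
Qed.

Let continuous_m a b : continuous (m a b).
Proof.
have := jcont_continuous_x (fun t => @jcont_prim R (fun q t => w t (Y t a + q * (Y t b - Y t a))) 1 t 1 ltr01 (fun q t _ => @jcont_segment a b q t)).
exact.
Qed.

Let m_bound a b t : `|m a b t| <= L.
Proof.
rewrite -[leRHS]mulr1 -[X in _ * X](normr1 R); apply: prim_bound => [|q _]; last exact: wL.
exact: jcont_continuous_t (fun q => @jcont_segment a b q t).
Qed.

(** The difference of two trajectories solves the scalar linear equation
    D' = m D. *)
Lemma cflow_diff a b t : Y t b - Y t a = (b - a) * expR (prim (m a b) (clamp T t)).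
Proof.
rewrite -(cflow_clamp t b) -(cflow_clamp t a).
have := clamp_itv T0 t; move: (clamp T t) => {}t tT.
have cw r : continuous (w r) by exact: jcont_continuous_x (@jw r).
pose f r := (Y r b - Y r a) * expR (- prim (m a b) r).
have : f t = f 0.
  apply: (cst_on_itv _ _ tT) => [r rT|r].
  - have d1 := is_derive_cflow_t a rT; have d2 := is_derive_cflow_t b rT.
    have d3 := is_derive_prim (@continuous_m a b) r.
    have E := increment_prim (Y r a) (Y r b) (cw r) (dv r).
    apply: trigger_derive; rewrite /GRing.scale/= E -/(m a b r); ring.
  - apply: cvgM; first by apply: cvgB; exact: continuous_cflow.
    apply: continuous_cvg; first exact: continuous_expR.
    by apply: cvgN; apply: continuous_prim; exact: continuous_m.
rewrite /f prim0 oppr0 expR0 mulr1 !cflow0 => <-.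
by rewrite -mulrA -expRD addNr expR0 mulr1.
Qed.

Let prim_m_bound a b t : `|prim (m a b) (clamp T t)| <= L * T.
Proof.
have L0 : 0 <= L by exact: le_trans (wL 0 0).
apply: le_trans (prim_bound (@continuous_m a b) (fun r _ => m_bound a b r)) _.
by have /andP[c0 cT] := clamp_itv T0 t; rewrite ger0_norm// ler_wpM2l.
Qed.

Lemma cflow_lip a b t : `|Y t b - Y t a| <= `|b - a| * expR (L * T).
Proof.
rewrite cflow_diff normrM (ger0_norm (expR_ge0 _)) ler_wpM2l// ler_expR.
by rewrite (le_trans (ler_norm _)).
Qed.

Lemma cflow_lt a b t : a < b -> Y t a < Y t b.
Proof. by move=> ab; rewrite -subr_gt0 cflow_diff mulr_gt0 ?expR_gt0// subr_gt0. Qed.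

Lemma jcont_cflow t x : jcont Y t x.
Proof.
apply/jcontP => e e0; have e2 : 0 < e / 2 by rewrite divr_gt0.
have /cvgrPdist_lt/(_ _ e2)/nbhs_ballP[d /= d0 Hd] := @continuous_cflow x t.
have pE := expR_gt0 (L * T).
exists (Num.min d (e / 2 / expR (L * T))); first by rewrite lt_min d0 divr_gt0.
move=> t' x'; rewrite !lt_min => /andP[td _] /andP[_ xd].
rewrite -(subrK (Y t' x) (Y t' x')) -addrA (le_lt_trans (ler_normD _ _))//.
rewrite [ltRHS]splitr ltrD//; last by rewrite distrC; apply: Hd; rewrite /ball/= distrC.
by apply: le_lt_trans (cflow_lip _ _ _) _; rewrite -ltr_pdivlMr.
Qed.

(** The derivative of the flow with respect to the starting point. *)
Definition jacobian (t x : R) : R := expR (prim (fun r => w r (Y r x)) (clamp T t)).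

Lemma jacobian_gt0 t x : 0 < jacobian t x.
Proof. exact: expR_gt0. Qed.

Lemma continuous_w_cflow x : continuous (fun r => w r (Y r x)).
Proof.
have H r : jcont (fun r x => w r (Y r x)) r x.
  by apply: (@jcont_comp2 R w (fun r x => r) Y); [exact: jcont_id1|exact: jcont_cflow|exact: jw].
by have := jcont_continuous_t H.
Qed.

(** The exponential formula for the difference of two trajectories passes to the
    limit because the averages of w converge uniformly on bounded times. *)
Lemma is_derive_cflow (t x : R) : is_derive x (1 : R) (Y t) (jacobian t x).
Proof.
set ct := clamp T t.
have Tn0 : 0 < T + 1 by rewrite ltr_wpDl// ltW.
have ctT : `|ct| <= T by have /andP[c0 cT] := clamp_itv T0 t; rewrite ger0_norm.
have lim : prim (m x (h + x)) ct @[h --> (0 : R)^'] --> prim (fun r => w r (Y r x)) ct.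
  apply/cvgrPdist_le => e e0.
  have jK r : jcont (fun r z => w r (Y r x + z)) r 0.
    apply: (@jcont_comp2 R w (fun r z => r) (fun r z => Y r x + z)); [exact: jcont_id1| |exact: jw].
    by apply: jcontD; [apply: (@jcont_fst (Y ^~ x)); exact: continuous_cflow|exact: jcont_id2].
  have [d d0 Hd] := @jcont_tube R _ (- T) T 0 (fun r _ => jK r) _ (divr_gt0 e0 Tn0).
  have pE := expR_gt0 (L * T).
  rewrite near_withinE; apply/nbhs_ballP; exists (d / expR (L * T)); first by rewrite /= divr_gt0.
  move=> h; rewrite /ball/= sub0r normrN => hd _.
  rewrite distrC; apply: (@le_trans _ _ (e / (T + 1) * `|ct|)); last first.
    by rewrite mulrAC ler_pdivrMr// ler_wpM2l ?(ltW e0)// (le_trans ctT)// lerDl.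
  apply: prim_dist; [exact: continuous_m|exact: continuous_w_cflow|move=> r rt].
  have -> : w r (Y r x) = prim (fun=> w r (Y r x)) 1 by rewrite prim_cst mulr1.
  rewrite -[leRHS]mulr1 -[X in _ * X](normr1 R); apply: prim_dist.
  - exact: jcont_continuous_t (fun q => @jcont_segment x (h + x) q r).
  - by move=> q; exact: cst_continuous.
  - move=> q; rewrite normr1 => q1.
    have -> : w r (Y r x) = w r (Y r x + 0) by rewrite addr0.
    apply: ltW.
    apply: Hd; last by rewrite -ler_norml (le_trans rt).
    rewrite subr0 normrM (le_lt_trans (ler_piMl _ q1))//.
    by apply: le_lt_trans (cflow_lip _ _ _) _; rewrite addrK -ltr_pdivlMr.
have cv : h^-1 *: (Y t (h *: (1 : R) + x) - Y t x) @[h --> (0 : R)^'] --> jacobian t x.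
  have lim2 : expR (prim (m x (h + x)) ct) @[h --> (0 : R)^'] --> jacobian t x.
    by apply: continuous_cvg => //; exact: continuous_expR.
  apply: cvg_trans lim2; apply: near_eq_cvg; near=> h.
  have h0 : h != 0 by near: h; exact: nbhs_dnbhs_neq.
  by rewrite /GRing.scale/= mulr1 cflow_diff addrK mulrA mulVf// mul1r.
by split; [apply/cvg_ex; exists (jacobian t x)|exact/cvg_lim].
Unshelve. all: by end_near. Qed.

End flow.

(** * Transport along the characteristics *)

Section characteristics.
Context {R : realType}.

Lemma is_derive_unique (f : R -> R) (x a b : R) :
  is_derive x (1 : R) f a -> is_derive x (1 : R) f b -> a = b.
Proof. by move=> [_ <-] [_ <-]. Qed.

Variables (T L : R) (u l r X : R -> R -> R).
Let v t x := 2^-1 * (l t x - r t x).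
Let w t x := u t x ^+ 2 - 2^-1 * (l t x + r t x).
Let N t x := prim (fun q => u q x * v q x) t.
Hypothesis T0 : 0 < T.
Hypotheses (ju : forall t x, jcont u t x) (jl : forall t x, jcont l t x) (jr : forall t x, jcont r t x).
Hypothesis dl : forall t x : R, is_derive x (1 : R) (l t) (u t x ^+ 2 - l t x).
Hypothesis dr : forall t x : R, is_derive x (1 : R) (r t) (r t x - u t x ^+ 2).
Hypothesis wL : forall t x, `|w t x| <= L.
Hypothesis u_clamp : forall t x, u (clamp T t) x = u t x.
Hypothesis balance : forall t x, 0 <= t <= T -> prim (fun y => u t y - u 0 y) x = N t 0 - N t x.
Hypothesis hX : forall x : R, [/\ X 0 x = x, {within `[0, T], continuous (fun t => X t x)} &
  forall t : R, 0 < t < T -> is_derive t (1 : R) (fun q => X q x) (v t (X t x))].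

Local Notation Y := (cflow T X).
Local Notation J := (jacobian T w X).

Let jv t x : jcont v t x.
Proof.
apply: jcontM; first exact: jcont_cst.
by apply: jcontD; [exact: jl|apply: jcontN; exact: jr].
Qed.

Let jw t x : jcont w t x.
Proof.
apply: jcontD.
  by apply: (@jcont_comp1 R (fun y => y ^+ 2) u); [exact: ju|exact: exprn_continuous].
apply: jcontN; apply: jcontM; first exact: jcont_cst.
by apply: jcontD; [exact: jl|exact: jr].
Qed.

Let dv t (x : R) : is_derive x (1 : R) (v t) (w t x).
Proof.
have d1 := dl t x; have d2 := dr t x.
by apply: trigger_derive; rewrite /w /GRing.scale/=; field.
Qed.

Let jY t x : jcont Y t x. Proof. exact: (jcont_cflow T0 (@jw) dv wL hX). Qed.

Lemma characteristic_lt t a b : a < b -> Y t a < Y t b.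
Proof. exact: (cflow_lt T0 (@jw) dv hX). Qed.

Lemma is_derive_characteristic t (x : R) : is_derive x (1 : R) (Y t) (J t x).
Proof. exact: (is_derive_cflow T0 (@jw) dv wL hX). Qed.

Let cY x : continuous (Y ^~ x). Proof. exact: (continuous_cflow T0 hX). Qed.

Let cu t : continuous (u t). Proof. exact: jcont_continuous_x (@ju t). Qed.

Let jN t x : jcont N t x.
Proof. by apply: (jcont_prim ltr01) => ? ? _; apply: jcontM; [exact: ju|exact: jv]. Qed.

(** The mass between two trajectories is conserved; differentiating with respect
    to the starting point gives the transport formula for the density. *)
Lemma transport t x : u t (Y t x) * J t x = u 0 x.
Proof.
rewrite -(u_clamp t) -(cflow_clamp X T0 t).
have -> : J t x = J (clamp T t) x by rewrite /jacobian (clamp_id (clamp_itv _ _)).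
have := clamp_itv T0 t; move: (clamp T t) => {}t tT.
pose G t x := prim (u 0) x - N t x.
have dG q (y : R) : 0 <= q <= T -> is_derive y (1 : R) (G q) (u q y).
  move=> qT; have -> : G q = fun y => prim (u 0) y + prim (fun y => u q y - u 0 y) y - N q 0.
    by apply/funext => z; rewrite (balance z qT) /G; ring.
  have d1 := is_derive_prim (@cu 0) y.
  have cg : continuous (fun y => u q y - u 0 y) by move=> z; apply: cvgB; exact: cu.
  have d2 := is_derive_prim cg y.
  by derive_ring.
have GE y : G t (Y t y) = prim (u 0) y.
  pose f q := G q (Y q y).
  have : f t = f 0.
    apply: (cst_on_itv _ _ tT) => [q /andP[q0 qT]|q].
    - have qT' : 0 < q < T by rewrite q0.
      have d1 := is_derive_cflow_t hX y qT'.
      have d2 : is_derive q (1 : R) (fun q' => G q' (Y q y)) (- (u q (Y q y) * v q (Y q y))).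
        have cuv : continuous (fun q' => u q' (Y q y) * v q' (Y q y)).
          have H q' : jcont (fun q z => u q z * v q z) q' (Y q y) by apply: jcontM; [exact: ju|exact: jv].
          by have := jcont_continuous_t H.
        have d3 := is_derive_prim cuv q.
        by rewrite /G /N; derive_ring.
      have pm : 0 < Num.min q (T - q) by rewrite lt_min q0 subr_gt0.
      have := is_derive_joint pm _ (@ju q (Y q y)) d2 d1.
      rewrite addNr; apply=> q' z; rewrite lt_min !ltr_norml => /andP[/andP[? ?] /andP[? ?]].
      by apply: dG; apply/andP; split; lra.
    - apply: cvgB.
        by apply: (continuous_comp (f := Y ^~ y)); [exact: cY|exact: continuous_prim].
      have H : jcont (fun q z => N q (Y q z)) q y.
        by apply: (@jcont_comp2 R N (fun q z => q) Y); [exact: jcont_id1|exact: jY|exact: jN].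
      by have := jcont_t H.
  by rewrite /f /G (cflow0 T0 hX) /N prim0 subr0.
have d1 := @is_derive1_comp R (G t) (Y t) x _ _ (dG t (Y t x) tT) (is_derive_characteristic t x).
have d2 := is_derive_prim (@cu 0) x.
apply: is_derive_unique d1 _.
by rewrite (_ : G t \o Y t = prim (u 0))//; apply/funext => y; exact: GE.
Qed.

(** Values along trajectories of (1 - d_x^2)^(-1) u^2 and of its x-derivative. *)
Definition pflow t x := 2^-1 * (l t (Y t x) + r t (Y t x)).
Definition qflow t x := 2^-1 * (r t (Y t x) - l t (Y t x)).

Lemma jcont_pflow t x : jcont pflow t x.
Proof.
have jc (f : R -> R -> R) : (forall t x, jcont f t x) -> jcont (fun t x => f t (Y t x)) t x.
  by move=> jf; apply: (@jcont_comp2 R f (fun t x => t) Y); [exact: jcont_id1|exact: jY|exact: jf].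
apply: jcontM; first exact: jcont_cst.
by apply: jcontD; exact: jc.
Qed.

Lemma jcont_qflow t x : jcont qflow t x.
Proof.
have jc (f : R -> R -> R) : (forall t x, jcont f t x) -> jcont (fun t x => f t (Y t x)) t x.
  by move=> jf; apply: (@jcont_comp2 R f (fun t x => t) Y); [exact: jcont_id1|exact: jY|exact: jf].
apply: jcontM; first exact: jcont_cst.
by apply: jcontD; [exact: jc|apply: jcontN; exact: jc].
Qed.

Lemma is_derive_pflow t (x : R) : is_derive x (1 : R) (pflow t) (qflow t x * J t x).
Proof.
have d1 := @is_derive1_comp R (l t) (Y t) x _ _ (dl t (Y t x)) (is_derive_characteristic t x).
have d2 := @is_derive1_comp R (r t) (Y t) x _ _ (dr t (Y t x)) (is_derive_characteristic t x).
have := is_deriveZ 2^-1 (is_deriveD d1 d2); rewrite /GRing.scale/=.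
by rewrite (_ : 2^-1 * _ = qflow t x * J t x)// /qflow; ring.
Qed.

Lemma is_derive_qflow t (x : R) :
  is_derive x (1 : R) (qflow t) (pflow t x * J t x - u 0 x ^+ 2 * (J t x)^-1).
Proof.
have d1 := @is_derive1_comp R (l t) (Y t) x _ _ (dl t (Y t x)) (is_derive_characteristic t x).
have d2 := @is_derive1_comp R (r t) (Y t) x _ _ (dr t (Y t x)) (is_derive_characteristic t x).
have := is_deriveZ 2^-1 (is_deriveB d2 d1); rewrite /GRing.scale/=.
rewrite (_ : 2^-1 * _ = pflow t x * J t x - u 0 x ^+ 2 * (J t x)^-1)//.
have J0 : J t x != 0 by rewrite gt_eqF// jacobian_gt0.
by rewrite -(transport t) /pflow; field.
Qed.

Definition aflow t x := prim (fun q => pflow q x) t.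
Definition bflow t x := prim (fun q => expR (2 * aflow q x)) t.

(** The square K of the Jacobian solves the linear equation K' = 2 u0^2 - 2 p K,
    whose integrating factor is exp (2 A). *)
Lemma jacobianE t x : 1 + 2 * u 0 x ^+ 2 * bflow (clamp T t) x = (J t x * expR (aflow (clamp T t) x)) ^+ 2.
Proof.
have -> : J t x = J (clamp T t) x by rewrite /jacobian (clamp_id (clamp_itv _ _)).
have := clamp_itv T0 t; move: (clamp T t) => {}t tT.
pose E q := expR (prim (fun q => w q (Y q x)) q).
have EJ q : 0 <= q <= T -> J q x = E q by move=> qT; rewrite /jacobian clamp_id.
have cw : continuous (fun q => w q (Y q x)) by exact: (continuous_w_cflow T0 (@jw) dv wL hX).
have cp : continuous (fun q => pflow q x) by exact: jcont_continuous_t (fun q => @jcont_pflow q x).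
have dA (q : R) : is_derive q (1 : R) (aflow ^~ x) (pflow q x) by exact: is_derive_prim.
have cE : continuous (fun q => expR (2 * aflow q x)).
  move=> q; apply: (continuous_comp (f := fun q => 2 * aflow q x)); last exact: continuous_expR.
  by apply: cvgM; [exact: cvg_cst|exact: is_derive_continuous (dA q)].
have dB (q : R) : is_derive q (1 : R) (bflow ^~ x) (expR (2 * aflow q x)) by exact: is_derive_prim.
pose f q := E q ^+ 2 * expR (2 * aflow q x) - 2 * u 0 x ^+ 2 * bflow q x.
have df (q : R) : is_derive q (1 : R) f (2 * expR (2 * aflow q x) * (E q ^+ 2 * (w q (Y q x) + pflow q x) - u 0 x ^+ 2)).
  have d1 := dA q; have d2 := dB q; have d3 := is_derive_prim cw q.
  have d4 : is_derive q (1 : R) E (w q (Y q x) * E q).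
    by rewrite /E; derive_ring.
  by rewrite /f; derive_ring.
have : f t = f 0.
  apply: (cst_on_itv _ _ tT) => [q qT|q]; last exact: is_derive_continuous (df q).
  have qT' : 0 <= q <= T by case/andP: qT => ? ?; rewrite !ltW.
  have := df q; rewrite (_ : _ - u 0 x ^+ 2 = 0) ?mulr0//.
  by rewrite -(transport q) -(EJ q qT') /w /pflow; ring.
have -> : f 0 = 1.
  by rewrite /f /E /aflow /bflow !prim0 mulr0 expR0 expr1n !mulr0 subr0 mulr1.
rewrite /f => /eqP; rewrite subr_eq => /eqP <-.
by rewrite EJ// exprMn expRM_natl.
Qed.

End characteristics.

(** * Regularity along the characteristics *)

Section joint_regularity.
Context {R : realType}.
Variable U : set R.
Hypothesis oU : open U.
Implicit Types F G D : R -> R -> R.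

Lemma open_ball_sub x : U x -> exists2 r : R, 0 < r & forall y, `|y - x| < r -> U y.
Proof.
move=> Ux; have /nbhs_ballP[r /= r0 Hr] := open_nbhs_nbhs (conj oU Ux).
by exists r => // y hy; apply: Hr; rewrite /ball/= distrC.
Qed.

(** Joint continuity in t is included because it lets integration in time preserve
    the class. *)
Fixpoint CK (n : nat) F : Prop :=
  (forall t x, U x -> jcont F t x) /\
  (if n is m.+1 then exists2 D, CK m D &
    forall t (x : R), U x -> is_derive x (1 : R) (F t) (D t x) else True).

Lemma CK_jcont n F t x : CK n F -> U x -> jcont F t x.
Proof. by case: n => [|n] [jF _]; exact: jF. Qed.

Lemma CK_pred n F : CK n.+1 F -> CK n F.
Proof.
elim: n F => [|n IH] F; first by case.
by move=> [jF [D cD dF]]; split=> //; exists D => //; exact: IH.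
Qed.

Lemma CK_le m n F : (m <= n)%N -> CK n F -> CK m F.
Proof.
move=> /subnK <-; elim: (n - m)%N => [|k IH] //.
by rewrite addSn => /CK_pred.
Qed.

Lemma CK_ext n F G : (forall t x, U x -> F t x = G t x) -> CK n F -> CK n G.
Proof.
move=> FG; have jG : (forall t x, U x -> jcont F t x) -> forall t x, U x -> jcont G t x.
  move=> jF t x Ux; have [r r0 Hr] := open_ball_sub Ux.
  apply/jcontP => e e0; have /jcontP/(_ _ e0)[d d0 Hd] := jF t x Ux.
  exists (Num.min d r); first by rewrite lt_min d0.
  move=> t' x'; rewrite !lt_min => /andP[td _] /andP[xd xr].
  by rewrite -!FG//; [exact: Hd|exact: Hr].
case: n => [[jF _]|n [jF [D cD dF]]]; split=> //; [exact: jG|exact: jG|].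
exists D => // t x Ux; have := dF t x Ux; apply: near_eq_is_derive.
have nU : nbhs x U by exact: open_nbhs_nbhs.
by near=> y; apply: FG; near: y.
Unshelve. all: by end_near. Qed.

Lemma CK_cst n (c : R) : CK n (fun _ _ => c).
Proof.
elim: n c => [|n IH] c; split=> //; try by move=> *; exact: jcont_cst.
by exists (fun _ _ => 0) => [|t x _]; [exact: IH|exact: is_derive_cst].
Qed.

Lemma CK_add n F G : CK n F -> CK n G -> CK n (fun t x => F t x + G t x).
Proof.
elim: n F G => [|n IH] F G [jF HF] [jG HG]; split=> //.
1,2: by move=> t x Ux; apply: jcontD; [exact: jF|exact: jG].
have [D cD dF] := HF; have [E cE dG] := HG.
exists (fun t x => D t x + E t x) => [|t x Ux]; first exact: IH.
by have := dF t x Ux; have := dG t x Ux => ? ?; exact: is_deriveD.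
Qed.

Lemma CK_mul n F G : CK n F -> CK n G -> CK n (fun t x => F t x * G t x).
Proof.
elim: n F G => [|n IH] F G cF cG; have [jF HF] := cF; have [jG HG] := cG; split=> //.
1,2: by move=> t x Ux; apply: jcontM; [exact: jF|exact: jG].
have [D cD dF] := HF; have [E cE dG] := HG.
exists (fun t x => D t x * G t x + F t x * E t x) => [|t x Ux].
  by apply: CK_add; apply: IH => //; exact: CK_pred.
have d1 := dF t x Ux; have d2 := dG t x Ux.
by derive_ring.
Qed.

Lemma CK_scale n (c : R) F : CK n F -> CK n (fun t x => c * F t x).
Proof. by apply: CK_mul; exact: CK_cst. Qed.

Lemma CK_time n (c : R -> R) F : continuous c -> CK n F -> CK n (fun t x => F (c t) x).
Proof.
move=> cc; elim: n F => [|n IH] F [jF HF]; split=> //.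
1,2: by move=> t x Ux; apply: (@jcont_comp2 R F (fun t x => c t) (fun t x => x));
  [apply: jcont_fst; exact: cc|exact: jcont_id2|exact: jF].
by have [D cD dF] := HF; exists (fun t x => D (c t) x) => [|t x Ux]; [exact: IH|exact: dF].
Qed.

Lemma CK_expR n F : CK n F -> CK n (fun t x => expR (F t x)).
Proof.
elim: n F => [|n IH] F cF; have [jF HF] := cF; split=> //.
1,2: by move=> t x Ux; apply: jcont_comp1; [exact: jF|exact: continuous_expR].
have [D cD dF] := HF; exists (fun t x => expR (F t x) * D t x) => [|t x Ux].
  by apply: CK_mul => //; apply: IH; exact: CK_pred.
exact: is_derive1_comp (is_derive_expR (F t x)) (dF t x Ux).
Qed.

Lemma CK_inv n F : (forall t x, U x -> F t x != 0) -> CK n F -> CK n (fun t x => (F t x)^-1).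
Proof.
move=> F0; elim: n F F0 => [|n IH] F F0 cF; have [jF HF] := cF; split=> //.
1,2: by move=> t x Ux; apply: cvgV; [exact: F0|exact: jF].
have [D cD dF] := HF.
exists (fun t x => -1 * ((F t x)^-1 * (F t x)^-1 * D t x)) => [|t x Ux].
  apply: CK_scale; apply: CK_mul => //.
  by apply: CK_mul; apply: IH => //; exact: CK_pred.
have := is_deriveV (F0 t x Ux) (dF t x Ux).
by rewrite /GRing.scale/= mulN1r mulNr -exprVn expr2.
Qed.

Lemma CK_sqrt n F : (forall t x, U x -> 0 < F t x) -> CK n F -> CK n (fun t x => Num.sqrt (F t x)).
Proof.
move=> F0; elim: n F F0 => [|n IH] F F0 cF; have [jF HF] := cF; split=> //.
1,2: by move=> t x Ux; apply: jcont_comp1; [exact: jF|exact: sqrt_continuous].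
have [D cD dF] := HF.
have IHF : CK n (fun t x => Num.sqrt (F t x)) by apply: IH => //; exact: CK_pred.
exists (fun t x => (2 * Num.sqrt (F t x))^-1 * D t x) => [|t x Ux].
  apply: CK_mul => //; apply: CK_inv; last exact: CK_scale.
  by move=> t x Ux; rewrite mulf_neq0// gt_eqF// sqrtr_gt0 F0.
exact: is_derive1_comp (is_derive1_sqrt (F0 t x Ux)) (dF t x Ux).
Qed.

Lemma CK_prim n F : CK n F -> CK n (fun t x => prim (fun q => F q x) t).
Proof.
elim: n F => [|n IH] F cF; have [jF HF] := cF; split=> //.
1,2: by move=> t x Ux; have [r r0 Hr] := open_ball_sub Ux; apply: (jcont_prim r0) => q y /Hr; exact: jF.
have [D cD dF] := HF; exists (fun t x => prim (fun q => D q x) t) => [|t x Ux]; first exact: IH.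
have [r r0 Hr] := open_ball_sub Ux.
apply: (is_derive_under_prim t r0) => q y /Hr Uy; [exact: dF|exact: jF|exact: CK_jcont cD Uy].
Qed.

(** The Jacobian is an explicit function of u0 and p; the derivatives of p and q
    are polynomial in p, q, u0, J and 1 / J.  Hence each derivative gained by p and
    q passes to J, as long as u0 has it, and back. *)
Lemma bootstrap (k : nat) (c u0 : R -> R) (p q J : R -> R -> R) : continuous c ->
  (forall t x, jcont p t x) -> (forall t x, jcont q t x) -> (forall t x, 0 < J t x) ->
  (forall t (x : R), is_derive x (1 : R) (p t) (q t x * J t x)) ->
  (forall t (x : R), is_derive x (1 : R) (q t) (p t x * J t x - u0 x ^+ 2 * (J t x)^-1)) ->
  (forall t x, 1 + 2 * u0 x ^+ 2 * prim (fun r => expR (2 * prim (fun r => p r x) r)) (c t) =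
     (J t x * expR (prim (fun r => p r x) (c t))) ^+ 2) ->
  CK k (fun _ => u0) -> CK k J.
Proof.
move=> cc jp jq J0 dp dq JE cu0.
have cu2 n : (n <= k)%N -> CK n (fun _ x => u0 x ^+ 2).
  move=> nk; apply: (@CK_ext n (fun _ x => u0 x * u0 x)) => [t x _|]; first by rewrite expr2.
  by apply: CK_mul; exact: CK_le nk cu0.
have JCK n : (n <= k)%N -> CK n p -> CK n J.
  move=> nk cp; pose a t x := prim (fun r => p r x) t.
  pose b t x := prim (fun r => expR (2 * a r x)) t.
  have ca : CK n a by exact: CK_prim.
  have cb : CK n b by apply: CK_prim; apply: CK_expR; exact: CK_scale.
  have cE : CK n (fun t x => expR (a (c t) x)) by apply: CK_expR; exact: (CK_time cc ca).
  have cK : CK n (fun t x => 1 + 2 * (u0 x ^+ 2 * b (c t) x)).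
    apply: CK_add; first exact: CK_cst.
    by apply: CK_scale; apply: CK_mul; [exact: cu2|exact: (CK_time cc cb)].
  have KE t x : 1 + 2 * (u0 x ^+ 2 * b (c t) x) = (J t x * expR (a (c t) x)) ^+ 2.
    by rewrite mulrA JE.
  have JE0 t x : 0 < J t x * expR (a (c t) x) by rewrite mulr_gt0// expR_gt0.
  apply: (@CK_ext n (fun t x => Num.sqrt (1 + 2 * (u0 x ^+ 2 * b (c t) x)) * (expR (a (c t) x))^-1)).
    by move=> t x _; rewrite KE sqrtr_sqr gtr0_norm// mulfK// gt_eqF// expR_gt0.
  apply: CK_mul; first by apply: CK_sqrt => // t x _; rewrite KE exprn_gt0.
  by apply: CK_inv => // t x _; rewrite gt_eqF// expR_gt0.
suff H n : (n <= k)%N -> CK n p /\ CK n q by have [cp _] := H k (leqnn k); exact: JCK.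
elim: n => [_|n IH nk]; first by split; split.
have [cp cq] := IH (ltnW nk).
have cJ := JCK _ (ltnW nk) cp.
split; split=> //.
  by exists (fun t x => q t x * J t x) => //; exact: CK_mul.
exists (fun t x => p t x * J t x + -1 * (u0 x ^+ 2 * (J t x)^-1)).
  apply: CK_add; first exact: CK_mul.
  apply: CK_scale; apply: CK_mul; first exact: cu2 (ltnW nk).
  by apply: CK_inv => // t x _; rewrite gt_eqF.
by move=> t x _; rewrite mulN1r.
Qed.

(** The intermediate value theorem between f (x - h) and f (x + h). *)
Lemma open_image (f : R -> R) : continuous f -> (forall a b, a < b -> f a < f b) -> open (f @` U).
Proof.
move=> cf lf; rewrite openE => y [x Ux <-] /=.
have [r r0 Hr] := open_ball_sub Ux.
pose h := r / 2; have h0 : 0 < h by rewrite divr_gt0.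
have hr : h < r by rewrite ltr_pdivrMr// mulrDr mulr1 ltrDl.
have A : f (x - h) < f x by apply: lf; rewrite ltrBlDr ltrDl.
have B : f x < f (x + h) by apply: lf; rewrite ltrDl.
have : \forall z \near f x, f (x - h) < z < f (x + h).
  have : f x \in `](f (x - h)), (f (x + h))[ by rewrite in_itv/= A.
  by move=> /near_in_itvoo; apply: filterS => z; rewrite in_itv.
apply: filterS => z /andP[z1 z2].
have [|||c] := @IVT R f (x - h) (x + h) z.
- by rewrite lerD2l ge0_cp// ltW.
- exact: continuous_subspaceT.
- rewrite /Order.min /Order.max (lt_trans A B) !ltW//.
rewrite in_itv/= => /andP[c1 c2] fc; exists c => //; apply: Hr.
by apply: le_lt_trans hr; rewrite ler_norml; apply/andP; split; lra.
Qed.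

(** g is F t composed with the inverse of Y, so that g' composed with Y is
    D t / J t, a function of the same kind with one derivative less. *)
Lemma CK_image n F (J : R -> R -> R) (Y : R -> R) (t : R) (g : R -> R) :
  (forall a b, a < b -> Y a < Y b) -> (forall x : R, is_derive x (1 : R) Y (J t x)) ->
  (forall t x, 0 < J t x) -> CK n J -> CK n F -> (forall x, U x -> g (Y x) = F t x) ->
  (forall j x, (j < n)%N -> U x -> derivable (derive1n j g) (Y x) 1) /\
  (forall j x, (j <= n)%N -> U x -> {for Y x, continuous (derive1n j g)}).
Proof.
move=> Ylt dY J0; have cY : continuous Y by move=> x; exact: is_derive_continuous (dY x).
have Yinj : injective Y.
  by move=> a b; case: (ltgtP a b) => // /Ylt; [|move=> + /esym]; move=> + E; rewrite E ltxx.
pose Z y := xget 0 [set x | Y x = y].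
have ZK : cancel Y Z by move=> x; apply: Yinj; exact: (@xgetPex _ 0 [set z | Y z = Y x] (ex_intro _ x erefl)).
have dZ x : is_derive (Y x) (1 : R) Z (J t x)^-1.
  apply: (@is_derive_inverse R Y Z (J t x) x _ _ (dY x)); last by rewrite gt_eqF.
  - by near=> z; exact: ZK.
  - by near=> z; exact: cY.
have near_g (h : R -> R) (H : R -> R) x : U x -> (forall x, U x -> h (Y x) = H x) ->
    \forall y \near Y x, H (Z y) = h y.
  move=> Ux hH; have oV : open (Y @` U) by exact: open_image.
  have : nbhs (Y x) (Y @` U) by apply: open_nbhs_nbhs; split=> //; exists x.
  by apply: filterS => y [z Uz <-]; rewrite ZK hH.
have cont (h H : R -> R) x : U x -> (forall x, U x -> h (Y x) = H x) -> {for x, continuous H} ->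
    {for Y x, continuous h}.
  move=> Ux hH cH; rewrite /prop_for /continuous_at hH//.
  apply: cvg_trans (near_eq_cvg (near_g _ _ _ Ux hH)) _.
  have cZ : {for Y x, continuous Z} := is_derive_continuous (dZ x).
  have := @continuous_comp _ _ _ Z H (Y x) cZ; rewrite ZK => /(_ cH).
  by rewrite /prop_for /continuous_at /= ZK.
elim: n F g => [|n IH] F g cJ cF gF.
  split=> // j x; rewrite leqn0 => /eqP -> Ux.
  by apply: (cont g (F t) x Ux gF); have := jcont_x (@CK_jcont _ _ t x cF Ux).
have [jF [D cD dF]] := cF.
have dg x : U x -> is_derive (Y x) (1 : R) g (D t x * (J t x)^-1).
  move=> Ux; have dFx : is_derive (Z (Y x)) (1 : R) (F t) (D t x) by rewrite ZK; exact: dF.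
  have := is_derive1_comp dFx (dZ x).
  by apply: near_eq_is_derive; exact: near_g.
have [||H1 H2] := IH (fun t x => D t x * (J t x)^-1) (derive1 g) (CK_pred cJ) _ _.
- apply: CK_mul => //; apply: CK_inv; last exact: CK_pred.
  by move=> q x _; rewrite gt_eqF.
- by move=> x Ux; rewrite derive1E; case: (dg x Ux).
split=> [[|j] x jn Ux|[|j] x jn Ux].
- by case: (dg x Ux).
- by rewrite derive1Sn; exact: H1.
- exact: is_derive_continuous (dg x Ux).
- by rewrite derive1Sn; exact: H2.
Unshelve. all: by end_near. Qed.

End joint_regularity.

(** * Regularity of the solution *)

(** A continuous function and a C^k function on U that agree almost everywhere on
    U agree on U. *)
Lemma Ck_on_CK (R : realType) (k : nat) (U : set R) (f u0 : R -> R) : open U -> continuous u0 ->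
  {ae @lebesgue_measure R, forall x, f x = u0 x} -> Ck_on k U f -> CK U k (fun _ => u0).
Proof.
move=> oU cu hf [g [fg dg cg]].
have gE x : U x -> u0 x = g x.
  move=> Ux; apply/eqP; rewrite -subr_eq0; apply/eqP.
  apply: (@ae_continuous0 R U (fun x => u0 x - g x)) Ux => // [y Uy|].
    by apply: cvgB; [exact: cu|exact: (cg 0%N y (leq0n k) Uy)].
  have := ae_and fg hf; apply: ae_sub => y [E1 E2] Uy.
  by rewrite -E2 E1// subrr.
apply: (@CK_ext R U oU k (fun _ => g)) => [_ x Ux|]; first by rewrite gE.
suff H n j : (j + n <= k)%N -> CK U n (fun _ => derive1n j g) by exact: (H k 0%N).
elim: n j => [|n IH] j jn; split=> //.
- by move=> t x Ux; apply: jcont_snd; apply: cg => //; rewrite (leq_trans _ jn)// leq_addr.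
- by move=> t x Ux; apply: jcont_snd; apply: cg => //; rewrite (leq_trans _ jn)// leq_addr.
- exists (fun _ => derive1n j.+1 g) => [|t x Ux]; first by apply: IH; rewrite addSnnS.
  split; last by rewrite derive1nS derive1E.
  by apply: dg => //; rewrite (leq_trans _ jn)// addnS ltnS leq_addr.
Qed.

Theorem theorem1p12 (R : realType) (s : R) (hs : 1 <= s)
  (rho0 : R -> R) (hrho0 : sobolev s rho0)
  (k : nat) (hk : (0 < k)%N)
  (Omega : set R) (hOmega : open Omega) (hreg : Ck_on k Omega rho0)
  (T : R) (hT : 0 < T)
  (rho : R -> R -> R) (hrho : brinkman_solution s T rho0 rho)
  (X : R -> R -> R) (hX : is_flow T (velocity rho) X)
  (t : R) (ht : t \in `[0, T]) :
  open (X t @` Omega) /\ Ck_on k (X t @` Omega) (rho t).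
Proof.
have tT : 0 <= t <= T by move: ht; rewrite in_itv.
pose u := dens T rho; pose l := dens_left T rho; pose r := dens_right T rho.
have ju q x : jcont u q x := jcont_dens hs hT hrho (t := q) (x := x).
have jl q x : jcont l q x := jcont_dens_left hs hT hrho (t := q) (x := x).
have jr q x : jcont r q x := jcont_dens_right hs hT hrho (t := q) (x := x).
have dl q (x : R) : is_derive x (1 : R) (l q) (u q x ^+ 2 - l q x) := is_derive_dens_left hs hT hrho q x.
have dr q (x : R) : is_derive x (1 : R) (r q) (r q x - u q x ^+ 2) := is_derive_dens_right hs hT hrho q x.
have u_clamp q x : u (clamp T q) x = u q x by rewrite /u /dens (clamp_id (clamp_itv hT _)).
have [M M0 HM] := dens_bound hs hT hrho.
have wL q x : `|u q x ^+ 2 - 2^-1 * (l q x + r q x)| <= M ^+ 2 + M ^+ 2.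
  have [Hl Hr] := dens_left_bound hs hT hrho M0 HM q x.
  rewrite (le_trans (ler_normB _ _))// lerD//.
    by rewrite normrX lerXn2r ?nnegrE//; exact: HM.
  rewrite normrM ger0_norm ?invr_ge0// mulrC ler_pdivrMr// (le_trans (ler_normD _ _))//.
  by rewrite mulrDr mulr1 lerD.
have bal q x : 0 <= q <= T -> prim (fun y => u q y - u 0 y) x =
   prim (fun p => u p 0 * (2^-1 * (l p 0 - r p 0))) q - prim (fun p => u p x * (2^-1 * (l p x - r p x))) q.
  exact: (mass_balance hs hT hrho).
have flow x : [/\ X 0 x = x, {within `[0, T], continuous (fun q => X q x)} &
    forall q : R, 0 < q < T -> is_derive q (1 : R) (fun p => X p x) (2^-1 * (l q (X q x) - r q (X q x)))].
  have [X0 cX dX] := hX x; split=> // q qT.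
  have qT' : 0 <= q <= T by case/andP: qT => ? ?; rewrite !ltW.
  have := dX q; rewrite inE/= in_itv/= => /(_ qT).
  by rewrite (velocityE hs hT hrho _ qT').
pose w q x := u q x ^+ 2 - 2^-1 * (l q x + r q x).
pose J := jacobian T w X.
have J0 q x : 0 < J q x by exact: jacobian_gt0.
have cu0 : continuous (u 0) by exact: jcont_continuous_x (@ju 0).
have ck0 : CK Omega k (fun _ => u 0) := Ck_on_CK hOmega cu0 (dens0_ae hs hT hrho) hreg.
have cJ : CK Omega k J.
  apply: (bootstrap hOmega (continuous_clamp hT)
    (jcont_pflow hT (@ju) (@jl) (@jr) dl dr wL flow)
    (jcont_qflow hT (@ju) (@jl) (@jr) dl dr wL flow) J0
    (is_derive_pflow hT (@ju) (@jl) (@jr) dl dr wL flow)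
    (is_derive_qflow hT (@ju) (@jl) (@jr) dl dr wL u_clamp bal flow)
    (jacobianE hT (@ju) (@jl) (@jr) dl dr wL u_clamp bal flow) ck0).
have XE : X t = cflow T X t by apply/funext => x; rewrite /cflow clamp_id.
rewrite XE.
have Xlt a b : a < b -> cflow T X t a < cflow T X t b.
  exact: (characteristic_lt hT (@ju) (@jl) (@jr) dl dr flow).
have dX (x : R) : is_derive x (1 : R) (cflow T X t) (J t x).
  exact: (is_derive_characteristic hT (@ju) (@jl) (@jr) dl dr wL flow).
have cX : continuous (cflow T X t) by move=> x; exact: is_derive_continuous (dX x).
split; first exact: open_image.
have cF : CK Omega k (fun q x => u 0 x * (J q x)^-1).
  by apply: CK_mul => //; apply: CK_inv => // q x _; rewrite gt_eqF.
have uE x : Omega x -> u t (cflow T X t x) = u 0 x * (J t x)^-1.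
  move=> _; rewrite -(transport hT (@ju) (@jl) (@jr) dl dr wL u_clamp bal flow t x).
  by rewrite mulfK// gt_eqF.
have [H1 H2] := CK_image hOmega Xlt dX J0 cJ cF uE.
exists (u t); split.
- by apply: ae_sub (dens_ae hs hT hrho tT) => x ->.
- by move=> j y jk [x Ux <-]; exact: H1.
- by move=> j y jk [x Ux <-]; exact: H2.
Qed.
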